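(* If $\mathcal P$ is an atomic chiral $4$-polytope with regular facets and chiral vertex-figures, then its vertex-figures are atomic chiral polyhedra.
   Context: Tight: a polytope of type $\{p_1,\dots,p_{n-1}\}$ with exactly $2p_1\cdots p_{n-1}$ flags. A tight chiral $4$-polytope is atomic if it does not properly cover any tight chiral polytope. An atomic chiral polyhedron is a tight chiral polyhedron of type $\{p,q\}$ that covers no chiral polyhedron of type $\{p',q\}$ or $\{p,q'\}$ with $p'$ a proper divisor of $p$ or $q'$ a proper divisor of $q$. *)

(* Defs.v *)
From HB Require Import structures.
From mathcomp Require Import all_boot perm.

Set Implicit Arguments.
Unset Strict Implicit.
Unset Printing Implicit Defensive.

Section Polytopes.
Variables (T : finType) (le : rel T).

Definition ltp (x y : T) : bool := (x != y) && le x y.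

Definition partial_order : Prop :=
  [/\ reflexive le, antisymmetric le & transitive le].

Definition chain (C : {set T}) : bool :=
  [forall x in C, [forall y in C, le x y || le y x]].

(* rk x = (rank of the face x) + 2 : the maximal size of a chain of faces
   below x (this counts the least face F_{-1} and x itself). *)
Definition rk (x : T) : nat :=
  \max_(C : {set T} | chain C && (C \subset [set y | le y x])) #|C|.

Definition flag (C : {set T}) : bool :=
  chain C && [forall x, (x \notin C) ==> ~~ chain (x |: C)].

Definition adjacent (P Q : {set T}) : bool := #|P :\: Q| == 1.

Definition strongly_flag_connected : Prop :=
  forall P Q, flag P -> flag Q ->
    exists s : seq {set T},
      [/\ path adjacent P s, last P s = Q &
          all (fun L => flag L && (P :&: Q \subset L)) s].

Definition diamond : Prop :=
  forall F G, ltp F G -> rk G = (rk F).+2 ->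
    #|[set H | ltp F H && ltp H G]| = 2.

Definition polytope (n : nat) : Prop :=
  [/\ partial_order /\ (exists b, forall x, le b x),
      (exists t, forall x, le x t),
      (forall P, flag P -> #|P| = n.+2),
      diamond & strongly_flag_connected].

Definition is_aut (f : {perm T}) : Prop := forall x y, le (f x) (f y) = le x y.

Definition same_orbit (P Q : {set T}) : Prop :=
  exists f : {perm T}, is_aut f /\ f @: P = Q.

Definition regular : Prop :=
  forall P Q, flag P -> flag Q -> same_orbit P Q.

Definition chiral : Prop :=
  (forall P Q, flag P -> flag Q -> adjacent P Q -> ~ same_orbit P Q) /\
  exists P0 P1, [/\ flag P0, flag P1, ~ same_orbit P0 P1 &
                    forall P, flag P -> same_orbit P0 P \/ same_orbit P1 P].

(* Schlaefli type {p_1, ..., p_{n-1}}, ps = [:: p_1; ...; p_{n-1}]: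
   every section F/G with rank G = i-2, rank F = i+1 is a p_i-gon
   (has p_i vertices, i.e. faces of rank i-1). *)
Definition has_type (n : nat) (ps : seq nat) : Prop :=
  size ps = n.-1 /\
  forall (i : nat) (F G : T), 0 < i < n -> ltp G F -> rk G = i -> rk F = i + 3 ->
    #|[set H | ltp G H && ltp H F && (rk H == i.+1)]| = nth 0 ps i.-1.

Definition num_flags : nat := #|[set P : {set T} | flag P]|.

Definition tight (n : nat) (ps : seq nat) : Prop :=
  has_type n ps /\ num_flags = 2 * \prod_(p <- ps) p.

End Polytopes.

Definition covering (T1 T2 : finType) (le1 : rel T1) (le2 : rel T2)
    (h : T1 -> T2) : Prop :=
  [/\ (forall y, exists x, h x = y),
      (forall x, rk le2 (h x) = rk le1 x),
      (forall x y, le1 x y -> le2 (h x) (h y)) &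
      (forall P Q, flag le1 P -> flag le1 Q -> adjacent P Q ->
         adjacent (h @: P) (h @: Q))].

Definition covers (T1 T2 : finType) (le1 : rel T1) (le2 : rel T2) : Prop :=
  exists h : T1 -> T2, covering le1 le2 h.

Definition isomorphism (T1 T2 : finType) (le1 : rel T1) (le2 : rel T2)
    (h : T1 -> T2) : Prop :=
  bijective h /\ forall x y, le2 (h x) (h y) = le1 x y.

Definition properly_covers (T1 T2 : finType) (le1 : rel T1) (le2 : rel T2) : Prop :=
  exists h : T1 -> T2, covering le1 le2 h /\ ~ isomorphism le1 le2 h.

Definition facet_le (T : finType) (le : rel T) (F : T) : rel {x : T | le x F} :=
  fun x y => le (val x) (val y).

Definition vfig_le (T : finType) (le : rel T) (v : T) : rel {x : T | le v x} :=
  fun x y => le (val x) (val y).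

Definition atomic_chiral4 (T : finType) (le : rel T) : Prop :=
  exists ps : seq nat,
  [/\ polytope le 4, chiral le, tight le 4 ps &
      forall (T' : finType) (le' : rel T') (m : nat) (qs : seq nat),
        polytope le' m -> chiral le' -> tight le' m qs ->
        ~ properly_covers le le'].

Definition atomic_chiral_polyhedron (T : finType) (le : rel T) : Prop :=
  exists p q : nat,
  [/\ polytope le 3, chiral le, tight le 3 [:: p; q] &
      forall (T' : finType) (le' : rel T') (p' q' : nat),
        polytope le' 3 -> chiral le' ->
        (has_type le' 3 [:: p'; q] /\ p' %| p /\ p' != p) \/
        (has_type le' 3 [:: p; q'] /\ q' %| q /\ q' != q) ->
        ~ covers le le'].

(* Main.v *)
From mathcomp Require Import all_boot all_fingroup ssralg all_solvable zify.
Require Import Defs.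

(** Let [Gam] be the automorphism group, generated by the rotations [s1], [s2], [s3] of a base
flag. Tightness means that [Gam] factors uniquely as [<s1> <s2> <s3>], and the vertex stabiliser
is [GV = <s2> <s3>]. Mirroring [s2 |-> s2^-1], [s3 |-> s3^-1] generates a subgroup of [GV * GV];
its second-coordinate kernel is the chirality group [Ch] of the vertex-figure, and a quotient of
the vertex-figure by a normal subgroup [N] contained in [<s2>] or [<s3>] is chiral only if [Ch] is
not contained in [N]. Likewise, a normal subgroup [K] of [Gam] compatible with the factorisation
gives a tight quotient polytope, which is chiral unless [K] contains [Ch]; so atomicity forces
every such [K] to contain [Ch].

If the vertex-figure covers a chiral polyhedron in a forbidden way, the kernel [N] lies in [<s2>]
or [<s3>]. A subgroup of [<s3>] normal in [GV] is normal in [Gam], and we are done. If [N] lies in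
[<s2>], regularity of the facets makes [s3^2] fix all vertices, so [s3^2] lies in the core of
[GV]. One may take [N] of prime order [s]; then [Ch] has prime order [l <> s] and the normal
closure [L] of [N] centralises the core. By Ito's theorem [L'] is abelian; it is an [l]-group
whose hull [K = A1 B1] is determined by the action of [N]. The Hall [l]-subgroup of [<s2>] is then
[B1], it is inverted by [s3], and a Gaschuetz complement of [B1] in [GV] shows [Ch] meets [B1]
trivially, although it is contained in it. *)

Set Implicit Arguments.
Unset Strict Implicit.
Unset Printing Implicit Defensive.

Import GroupScope.

(** * Finite groups *)

Section Conjugation.

Variable gT : finGroupType.
Implicit Types (A : {set gT}) (G H N R V X : {group gT}) (x y t : gT).

Lemma conjg_cent A x y : x \in A -> y \in 'C(A) -> x ^ y = x.
Proof. by move=> Ax /centP cAy; apply/conjg_fixP/commgP/esym/cAy. Qed.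

Lemma mulg_sq1C x y : (x * y) ^+ 2 = 1 -> (y * x) ^+ 2 = 1.
Proof.
move=> xy2; have -> : y * x = (x * y) ^ x by rewrite conjgE !mulgA mulVg mul1g.
by rewrite -conjXg xy2 conj1g.
Qed.

Lemma conjg_mul_sq1 x y : (x * y) ^+ 2 = 1 -> y ^ x * y = x ^- 2.
Proof.
move=> xy2; apply: (mulgI (x * x)); rewrite -expg2 mulgV conjgE !mulgA expg2.
by rewrite mulgK -!mulgA -[RHS]xy2 expg2 !mulgA.
Qed.

Lemma invg_conj_involution t x : t ^+ 2 = 1 -> (t * x) ^+ 2 = 1 -> x ^ t = x^-1.
Proof.
move=> t2 tx2; have tV : t^-1 = t by apply: (mulgI t); rewrite mulgV -expg2.
by apply: (mulIg x); rewrite mulVg conjgE tV -tx2 expg2 !mulgA.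
Qed.

Lemma cycle_involution t x : t ^+ 2 = 1 -> x \in <[t]> -> x = 1 \/ x = t.
Proof.
move=> t2 /cycleP[k ->]; rewrite (divn_eq k 2) expgD mulnC expgM t2 expg1n mul1g.
by rewrite modn2; case: odd; [right; rewrite expg1 | left].
Qed.

Lemma gen_ind A (P : gT -> Prop) :
  P 1 -> (forall x, x \in A -> P x) -> (forall x y, P x -> P y -> P (x * y)) ->
  forall x, x \in <<A>> -> P x.
Proof.
move=> P1 PA PM x /gen_prodgP[n [c Ac ->]].
by apply: (big_ind P) => // i _; apply: PA.
Qed.

Lemma cents_card2 X N : #|X| = 2 -> N \subset 'N(X) -> N \subset 'C(X).
Proof.
move=> oX nXN; rewrite centsC; apply/centsP=> x Xx n Nn.
have [-> | ntx] := eqVneq x 1; first exact/commute_sym/commute1.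
apply/commgP/conjg_fixP.
have defX : X :=: [set 1; x].
  apply/eqP; rewrite eq_sym eqEcard oX cards2 eq_sym ntx andbT.
  by rewrite subUset !sub1set group1 Xx.
have : x ^ n \in X by rewrite memJ_norm ?(subsetP nXN).
by rewrite defX !inE conjg_eq1 (negbTE ntx) => /eqP.
Qed.

Lemma der1_norm_cyclic_cents R : cyclic R -> 'N(R)^`(1) \subset 'C(R).
Proof.
move=> cycR; rewrite -ker_conj_aut ker_trivg_morphim der_sub morphim_der //=.
apply/trivgP/derG1P.
exact: abelianS (Aut_conj_aut _ _) (Aut_cyclic_abelian cycR).
Qed.

(* Correct the [V]-part of [t] by a square root, which exists because [#|V|] is odd. *)
Lemma inverting_complement G V t :
  V <| G -> abelian V -> odd #|V| -> [splits G, over V] ->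
  t \in G -> {in V, forall v, v ^ t = v^-1} ->
  exists2 H : {group gT}, H \in [complements to V in G] & t \in H.
Proof.
move=> /andP[sVG nVG] abV oddV /splitsP[H /complP[tiH defG]] Gt invt.
have /mulsgP[u h Vu Hh def_t] : t \in V * H by rewrite defG.
have odd2 : coprime #|V| 2 by rewrite coprimen2.
have [v Vv def_u] : exists2 v, v \in V & v ^+ 2 = u.
  by exists (u ^+ (expg_invn V 2)); rewrite ?groupX // -expgM mulnC expgM (expgK odd2).
have invh : v ^ h = v^-1.
  by rewrite -invt // def_t conjgM (@conjg_cent V v u) ?(subsetP abV).
have def_th : t = h ^ v^-1.
  have hv : h * v^-1 = v * h by rewrite -invh conjgE mulKVg.
  by rewrite def_t -def_u conjgE invgK hv mulgA expg2.
have VJv : V :^ v^-1 = V by rewrite conjGid ?groupV.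
exists (H :^ v^-1)%G; last by rewrite def_th memJ_conjg.
apply/complP; split; first by rewrite /= -{1}VJv -conjIg tiH conjs1g.
by rewrite -{1}VJv /= -conjsMg defG conjGid // groupV (subsetP sVG).
Qed.

End Conjugation.

Lemma morphim_cycle_mul_sq1 (gT rT : finGroupType) (G : {group gT})
    (f : {morphism G >-> rT}) (x y : gT) :
  odd #|f @* G| -> x \in G -> y \in G -> (x * y) ^+ 2 = 1 -> f @* <[x]> = f @* <[y]>.
Proof.
move=> oddf Gx Gy xy2; rewrite !morphim_cycle //.
suff -> : f x = (f y)^-1 by rewrite cycleV.
apply: (mulIg (f y)); rewrite mulVg -morphM //; apply/eqP; rewrite -order_eq1 -dvdn1.
have Gf : f (x * y) \in f @* G by rewrite mem_morphim ?groupM.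
have <- : gcdn 2 #|f @* G| = 1%N by apply/eqP; rewrite -/(coprime _ _) coprime2n.
by rewrite dvdn_gcd order_dvdG // order_dvdn -morphX ?groupM // xy2 morph1 eqxx.
Qed.

Lemma functional_morphism (aT rT : finGroupType) (G : {group aT}) (R : aT -> rT -> Prop) :
  (forall g, g \in G -> exists u, R g u) ->
  (forall g u v, g \in G -> R g u -> R g v -> u = v) ->
  (forall g h u v, g \in G -> h \in G -> R g u -> R h v -> R (g * h) (u * v)) ->
  exists f : {morphism G >-> rT}, forall g, g \in G -> R g (f g).
Proof.
move=> exR uniqR mulR.
have [f fR] : exists f : aT -> rT, forall g, g \in G -> R g (f g).
  apply: (fin_all_exists (P := fun g u => g \in G -> R g u)) => g.
  have [/exR[u Rgu]|nGg] := boolP (g \in G); first by exists u.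
  by exists 1 => Gg; case/negP: nGg.
have fM : {in G &, {morph f : g h / g * h}}.
  move=> g h Gg Gh; have Ggh := groupM Gg Gh.
  exact: uniqR Ggh (fR _ Ggh) (mulR _ _ _ _ Gg Gh (fR _ Gg) (fR _ Gh)).
by exists (Morphism fM).
Qed.

Lemma TI_mulg_inj (gT : finGroupType) (G H : {group gT}) (x y u v : gT) :
  G :&: H = 1 -> x \in G -> y \in G -> u \in H -> v \in H -> x * u = y * v -> x = y.
Proof.
move=> tiGH Gx Gy Hu Hv xu_yv; apply/eqP; rewrite eq_mulVg1; apply/eqP/set1gP.
rewrite -tiGH inE groupM ?groupV //=; have -> : x^-1 * y = u * v^-1; last by rewrite groupM ?groupV.
by apply: (mulgI x); apply: (mulIg v); rewrite mulKVg mulgA mulgKV xu_yv.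
Qed.

Section KernelOfProduct.

Variables (gT rT : finGroupType) (G : {group gT}) (f : {morphism G >-> rT}) (x y : gT).
Hypotheses (Gx : x \in G) (Gy : y \in G) (defG : <[x]> * <[y]> = G).
Hypothesis ti_f : <[f x]> :&: <[f y]> = 1.

Let ker_factors g : g \in 'ker f ->
  exists i j, [/\ g = x ^+ i * y ^+ j, f x ^+ i = 1 & f y ^+ j = 1].
Proof.
move=> kg; have Gg := subsetP (subsetIl _ _) _ kg; move: Gg kg; rewrite -{1}defG.
case/mulsgP=> _ _ /cycleP[i ->] /cycleP[j ->] -> kg.
have fxy : f x ^+ i * f y ^+ j = 1 by rewrite -!morphX // -morphM ?groupX // (mker kg).
have fy1 : f y ^+ j = 1.
  by apply/set1gP; rewrite -ti_f inE mem_cycle andbT -(mulg1_eq fxy) groupV mem_cycle.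
by exists i, j; rewrite fy1 mulg1 in fxy.
Qed.

Lemma ker_sub_cyclel : #[f y] = #[y] -> 'ker f \subset <[x]>.
Proof.
move=> fy; apply/subsetP => g /ker_factors[i [j [-> _ /eqP]]].
by rewrite -order_dvdn fy order_dvdn => /eqP->; rewrite mulg1 mem_cycle.
Qed.

Lemma ker_sub_cycler : #[f x] = #[x] -> 'ker f \subset <[y]>.
Proof.
move=> fx; apply/subsetP => g /ker_factors[i [j [-> /eqP + _]]].
by rewrite -order_dvdn fx order_dvdn => /eqP->; rewrite mul1g mem_cycle.
Qed.

End KernelOfProduct.

Lemma quotient_TI (gT : finGroupType) (K G H : {group gT}) :
  G :&: K * H \subset K -> G / K :&: H / K = 1.
Proof.
move=> capK; apply/trivgP/subsetP => _ /setIP[/morphimP[x nKx Gx ->] /morphimP[y nKy Hy]].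
case/(kercoset_rcoset nKx nKy) => k Kk def_x; apply/set1gP/coset_id/(subsetP capK).
by rewrite inE Gx def_x mem_mulg.
Qed.

Section CoprimeAction.

Variable gT : finGroupType.
Implicit Types (K L N R S : {group gT}).

Lemma coprime_cent_prod K N :
  N \subset 'N(K) -> coprime #|K| #|N| -> solvable K ->
  [~: K, N] * 'C_K(N) = K.
Proof.
move=> nKN coKN solK; have sRK : [~: K, N] \subset K by rewrite commg_subl.
have nRK : K \subset 'N([~: K, N]) by apply: commg_norml.
have eqC : 'C_K(N) / [~: K, N] = K / [~: K, N].
  rewrite (coprime_quotient_cent sRK) ?commg_normr //.
  by apply/setIidPl; apply: quotient_cents2r.
apply/eqP; rewrite eqEsubset mul_subG ?subsetIl //=.
by move: (subxx (K / [~: K, N])); rewrite -{2}eqC quotientSK.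
Qed.

Lemma coprime_commGid K N :
  N \subset 'N(K) -> coprime #|K| #|N| -> solvable K ->
  [~: [~: K, N], N] = [~: K, N].
Proof.
move=> nKN coKN solK; have nRN : N \subset 'N([~: K, N]) by apply: commg_normr.
apply/eqP; rewrite eqEsubset commg_subl nRN gen_subG /=.
apply/subsetP=> _ /imset2P[k n Kk Nn ->].
have /mulsgP[r c Rr /setIP[Kc cNc] ->] : k \in [~: K, N] * 'C_K(N).
  by rewrite coprime_cent_prod.
rewrite commMgJ (_ : [~ c, n] = 1) ?mulg1; last first.
  by apply/eqP/commgP; apply: (centP cNc).
rewrite conjRg (conjg_cent Nn cNc).
have nRc : c \in 'N([~: K, N]) by apply: (subsetP (commg_norml K N)).
by apply: mem_commg; rewrite ?memJ_norm.
Qed.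

Lemma coprime_cents_Phi K N :
  N \subset 'N(K) -> coprime #|K| #|N| -> solvable K ->
  [~: K, N] \subset 'Phi(K) -> N \subset 'C(K).
Proof.
move=> nKN coKN solK sRP; rewrite centsC; apply/setIidPl.
rewrite -[LHS]genGid; apply: Phi_nongen; apply/eqP.
rewrite eqEsubset join_subG Phi_sub subsetIl /=.
rewrite -{1}(coprime_cent_prod nKN coKN solK) mulG_subG joing_subr.
by rewrite (subset_trans sRP) ?joing_subl.
Qed.

Lemma quotient_Sylow_mul p L R S :
  R <| L -> p.-Sylow(L) S -> p.-group (L / R) -> R * S = L.
Proof.
move=> /andP[sRL nRL] sylS pLR; have sSL := pHall_sub sylS.
have eLR : S / R = L / R.
  apply/eqP; rewrite eqEcard quotientS //=.
  by rewrite (card_Hall (quotient_pHall (subset_trans sSL nRL) sylS)) part_pnat_id.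
by apply/eqP; rewrite eqEsubset mul_subG //= -quotientSK ?eLR.
Qed.

Lemma der1_sub_commg L R S N :
  R * S = L -> abelian R -> abelian S -> S \subset 'N(R) -> N \subset S ->
  coprime #|R| #|N| -> S \subset 'C('C_R(N)) -> L^`(1) \subset [~: R, N].
Proof.
move=> defL abR abS nRS sNS coRN cSC.
have nRN := subset_trans sNS nRS.
have nSM : S \subset 'N([~: R, N]).
  by rewrite normsR // (subset_trans abS) // (subset_trans (centS sNS)) ?cent_sub.
have nRM : R \subset 'N([~: R, N]) by apply: commg_norml.
have sRS : [~: R, S] \subset [~: R, N].
  rewrite gen_subG; apply/subsetP=> _ /imset2P[r t Rr St ->].
  have /mulsgP[r1 x Rr1 Xx ->] : r \in [~: R, N] * 'C_R(N).
    by rewrite (coprime_cent_prod nRN coRN (abelian_sol abR)).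
  have -> : [~ r1 * x, t] = [~ r1, t] ^ x.
    rewrite commMgJ (_ : [~ x, t] = 1) ?mulg1 //; apply/eqP/commgP.
    by apply/commute_sym; apply: (centsP cSC).
  rewrite memJ_norm ?(subsetP nRM) //; last by case/setIP: Xx.
  by rewrite commgEl groupMl ?groupV // memJ_norm ?(subsetP nSM).
apply: (@der1_min _ L [~: R, N]%G); first by rewrite -defL mul_subG.
rewrite -defL quotientMl // abelianM !quotient_abelian //=.
by apply: quotient_cents2r; rewrite commGC.
Qed.

End CoprimeAction.

Section HallProducts.

Variables (gT : finGroupType) (A B G : {group gT}).
Hypotheses (defG : A * B = G) (tiAB : A :&: B = 1).

Lemma TI_mul_pHall (pi : nat_pred) (H : {group gT}) :
  H \subset G -> #|H| = (#|A|`_pi * #|B|`_pi)%N -> pi.-Hall(G) H.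
Proof.
by move=> sHG oH; rewrite pHallE sHG oH -partnM ?cardG_gt0 // -(TI_cardMg tiAB) defG /=.
Qed.

(* Gaschuetz: the product of [V] and a Hall subgroup of [B] is a Hall subgroup of [G] that splits
   over [V]. *)
Lemma TI_mul_Hall_splits (pi : nat_pred) (V : {group gT}) :
  pi.-Hall(A) V -> abelian V -> V <| G -> nilpotent B -> [splits G, over V].
Proof.
move=> hallV abV nsV nilB; have [sVA piV _] := and3P hallV.
pose W := 'O_pi(B)%G; have hallW : pi.-Hall(B) W := nilpotent_pcore_Hall pi nilB.
have sWG : W \subset G by rewrite -defG (subset_trans (pcore_sub _ _)) ?mulG_subr.
have tiVW : V :&: W = 1 by apply/trivgP; rewrite -tiAB setISS ?pcore_sub.
have sPG : V <*> W \subset G by rewrite join_subG (normal_sub nsV).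
have defP : V * W = V <*> W by rewrite norm_joinEr // (subset_trans sWG) ?normal_norm.
have hallP : pi.-Hall(G) (V <*> W)%G.
  by apply: TI_mul_pHall; rewrite //= -defP (TI_cardMg tiVW) (card_Hall hallV) -(card_Hall hallW).
rewrite (Gaschutz_split nsV (joing_subl _ _) sPG abV).
  by apply/splitsP; exists W; apply/complP.
by apply: pnat_coprime piV _; case/and3P: hallP.
Qed.

End HallProducts.

Section Ito.

Variables (gT : finGroupType) (A B G : {group gT}).
Hypotheses (defG : A * B = G) (abA : abelian A) (abB : abelian B).

Lemma Ito_commg_conj a x b y : a \in A -> x \in A -> b \in B -> y \in B ->
  [~ a, b] ^ (x * y) = [~ a, b] ^ (y * x).
Proof.
move=> Aa Ax Bb By.
have [fixA fixB] : {in A &, forall u v, u ^ v = u} /\ {in B &, forall u v, u ^ v = u}.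
  split=> u v Xu Xv; first by rewrite (conjg_cent Xu) ?(subsetP abA).
  by rewrite (conjg_cent Xu) ?(subsetP abB).
have [comA comB] : {in A &, forall u v, [~ u, v] = 1} /\ {in B &, forall u v, [~ u, v] = 1}.
  by split=> u v Xu Xv; apply/eqP/conjg_fixP; [apply: fixA | apply: fixB].
have defG' : B * A = G by rewrite -invMG defG invGid.
have [sAG sBG] : A \subset G /\ B \subset G by rewrite -defG mulG_subl mulG_subr.
have /mulsgP[a1 b1 Aa1 Bb1 def_bx] : b ^ x \in A * B.
  by rewrite defG groupJ ?(subsetP sAG x) ?(subsetP sBG b).
have /mulsgP[b2 a2 Bb2 Aa2 def_ay] : a ^ y \in B * A.
  by rewrite defG' groupJ ?(subsetP sAG a) ?(subsetP sBG y).
rewrite !conjgM conjRg (fixA a x) // def_bx commgMJ (comA a a1) // conj1g mulg1.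
rewrite conjRg (fixB b1 y) // def_ay commMgJ (comB b2 b1) // conj1g mul1g.
rewrite [in RHS]conjRg (fixB b y) // def_ay commMgJ (comB b2 b) // conj1g mul1g.
by rewrite [in RHS]conjRg (fixA a2 x) // def_bx commgMJ (comA a2 a1) // conj1g mulg1.
Qed.

Theorem Ito_der1_abelian : abelian G^`(1).
Proof.
have abR : abelian [~: A, B].
  rewrite /commutator abelian_gen; apply/centsP.
  move=> _ /imset2P[a b Aa Bb ->] _ /imset2P[x y Ax By ->].
  apply/commgP/conjg_fixP.
  have -> : [~ x, y] = (x^-1 * y^-1) * (x * y) by rewrite commgEl conjgE mulgA.
  by rewrite conjgM Ito_commg_conj ?groupV // -conjgM mulgA mulgKV mulVg conjg1.
apply: abelianS abR; apply: der1_min.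
  by rewrite -defG mul_subG // (subset_trans _ (commg_norm A B)) ?joing_subl ?joing_subr.
rewrite -defG quotientMl; last by rewrite (subset_trans _ (commg_norm A B)) ?joing_subl.
rewrite abelianM !quotient_abelian //=.
by rewrite centsC; apply: quotient_cents2r.
Qed.

End Ito.

Section ProductsOfCyclicPGroups.

Variables (gT : finGroupType) (p : nat).
Hypothesis p_pr : prime p.
Implicit Types (K M R U V X Y Z : {group gT}) (x y : gT).

Lemma abelem_TI_p2 V X Y :
  p.-abelem V -> #|V| <= p ^ 2 -> X \subset V -> Y \subset V -> X :&: Y = 1 ->
  X :!=: 1 -> Y :!=: 1 -> #|X| = p /\ X * Y = V.
Proof.
move=> abV oV sXV sYV tiXY ntX ntY; have oXY := TI_cardMg tiXY.
have p_leq Z : Z \subset V -> Z :!=: 1 -> p <= #|Z|.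
  move=> sZV ntZ; have [_ dvp _] := pgroup_pdiv (pgroupS sZV (abelem_pgroup abV)) ntZ.
  exact: dvdn_leq.
have [leX leY] := (p_leq _ sXV ntX, p_leq _ sYV ntY).
have defV : X * Y = V.
  by apply/eqP; rewrite eqEcard mul_subG //= oXY (leq_trans oV) // leq_mul.
split=> //; apply/eqP; rewrite eqn_leq leX andbT.
move: oV; rewrite -defV oXY => /(leq_trans (leq_mul (leqnn _) leY)).
by rewrite leq_pmul2r ?prime_gt0.
Qed.

Lemma pgroup_comm2_p2 K U :
  p.-group K -> U <| K -> #|U| = (p ^ 2)%N -> [~: [~: U, K], K] = 1.
Proof.
move=> pK /andP[sUK nUK] oU; have nilK := pgroup_nil pK.
have smaller X : X \subset K -> K \subset 'N(X) -> X :!=: 1 -> [~: X, K] \proper X.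
  by move=> sXK nXK ntX; apply: (nil_comm_properl nilK); rewrite // subsetI subxx.
have ntU : U :!=: 1 by rewrite -cardG_gt1 oU (ltn_exp2l 0) ?prime_gt1.
have [pU prop1] := (pgroupS sUK pK, smaller U sUK nUK ntU).
have s1K := subset_trans (proper_sub prop1) sUK.
apply/eqP/negPn/negP => nt2.
have nt1 : [~: U, K] != 1 by apply: contra nt2 => /eqP->; rewrite comm1G.
have prop2 := smaller [~: U, K]%G s1K (commg_normr _ _) nt1.
have log1 := properG_ltn_log pU prop1; rewrite oU pfactorK // ltnS in log1.
have := leq_trans (properG_ltn_log (pgroupS s1K pK) prop2) log1; rewrite ltnS leqn0 /=.
apply/negP; apply: contra nt2 => /eqP log2.
have p2 : p.-group [~: [~: U, K], K].
  by apply: pgroupS pK; apply: subset_trans (proper_sub prop2) s1K.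
by rewrite trivg_card1 (card_pgroup p2) log2.
Qed.

(* [x ^+ p] lies in [<[x]> :&: <[y]>], which bounds #[x]; but #|K| forces #[x] to be [p] times
   larger. *)
Lemma prod_cycles_abelem_p2 K U x y :
  p.-group K -> <[x]> * <[y]> = K -> U <| K -> p.-abelem U -> #|U| = (p ^ 2)%N ->
  U * <[y]> = K -> U :&: <[y]> = 1 -> p = 2.
Proof.
move=> pK defK nsUK abU oU defKU tiUy; apply/eqP/negPn/negP => neq_p2.
have p_gt2 : 2 < p by rewrite ltn_neqAle eq_sym neq_p2 prime_gt1.
have [_ abUp] := abelemP p_pr abU.
have sUK := normal_sub nsUK.
have Kx : x \in K by rewrite -defK (subsetP (mulG_subl _ _)) ?cycle_id.
have Ky : y \in K by rewrite -defK (subsetP (mulG_subr _ _)) ?cycle_id.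
have /mulsgP[u v Uu /cycleP[i def_v] def_x] : x \in U * <[y]> by rewrite defKU.
have [Ku Kv] : u \in K /\ v \in K by rewrite (subsetP sUK) // def_v groupX.
have UKc : [~ v, u] \in [~: U, K] by rewrite commGC mem_commg.
have Uc : [~ v, u] \in U by apply: subsetP UKc; rewrite commg_subl normal_norm.
have centK z : z \in K -> commute z [~ v, u].
  move=> Kz; apply/commute_sym.
  by apply: (centsP (introT commG1P (pgroup_comm2_p2 pK nsUK oU))).
have xp : x ^+ p \in <[y]>.
  rewrite def_x expMg_Rmul; try exact: centK.
  rewrite abUp // mul1g.
  have /dvdnP[j ->] : p %| 'C(p, 2) by apply: prime_dvd_bin.
  by rewrite mulnC expgM (abUp [~ v, u]) // expg1n mulg1 def_v -expgM mem_cycle.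
have le_x : #[x] <= p * #[x ^+ p].
  rewrite orderXgcd -{1}(divnK (dvdn_gcdl #[x] p)) mulnC leq_mul // dvdn_leq ?prime_gt0 //.
  exact: dvdn_gcdr.
have le_xp : #[x ^+ p] <= #|<[x]> :&: <[y]>|.
  by apply: subset_leq_card; rewrite subsetI !cycle_subG mem_cycle.
have : (#[x] * #[y] <= p * #|<[x]> :&: <[y]>| * #[y])%N.
  by rewrite leq_pmul2r ?order_gt0 // (leq_trans le_x) // leq_pmul2l ?prime_gt0.
have := mul_cardG <[x]> <[y]>; rewrite defK -defKU (TI_cardMg tiUy) oU -!orderE => ->.
rewrite mulnAC leq_pmul2r ?order_gt0 // leq_pmul2r ?cardG_gt0 //.
by rewrite leqNgt -{1}(expn1 p) ltn_exp2l ?prime_gt1.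
Qed.

Lemma exists_normal_abelem_p2 K R :
  p.-group K -> R <| K -> ~~ cyclic R ->
  exists M, [/\ M <| K, M \subset R, p.-abelem (R / M) & #|R / M| = (p ^ 2)%N].
Proof.
move=> pK nsRK ncycR; have sRK := normal_sub nsRK; have pR := pgroupS sRK pK.
set F := 'Phi(R)%G; have nsFR : F <| R := Phi_normal R.
have nsFK : F <| K := char_normal_trans (Phi_char R) nsRK.
have abRF : p.-abelem (R / F) := Phi_quotient_abelem pR.
have rRF : 2 <= logn p #|R / F|.
  rewrite ltnNge -(abelem_cyclic abRF).
  by apply: contra ncycR => /Phi_quotient_cyclic.
have pKF : p.-group (K / F) by apply: quotient_pgroup.
have [Q [sQR nsQ oQ]] := normal_pgroup pKF (quotient_normal F nsRK) (leq_subr 2 _).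
have [M defQ sFM nsMK] := inv_quotientN nsFK nsQ.
have sMR : M \subset R.
  rewrite -(quotientSGK _ (normal_sub nsFR)) -?defQ //.
  by rewrite (subset_trans (normal_sub nsMK)) ?normal_norm.
have nsMR : M <| R by apply: normalS nsMK.
exists M; split=> //.
  by rewrite -(isog_abelem (third_isog sFM nsFR nsMR)) quotient_abelem.
rewrite -(card_isog (third_isog sFM nsFR nsMR)) -defQ card_quotient; last first.
  exact: subset_trans (quotientS F sRK) (normal_norm nsQ).
rewrite -divgS // oQ {1}(card_pgroup (abelem_pgroup abRF)).
by rewrite -expnB ?prime_gt0 ?leq_subr // subKn.
Qed.

Lemma card_Phi_prod_cycles K x y :
  p.-group K -> <[x]> * <[y]> = K -> #|K / 'Phi(K)| <= p ^ 2.
Proof.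
move=> pK defK; have abK := Phi_quotient_abelem pK.
have nPhi z : z \in K -> z \in 'N('Phi(K)) by apply: subsetP (normal_norm (Phi_normal K)) z.
have Kx : x \in K by rewrite -defK (subsetP (mulG_subl _ _)) ?cycle_id.
have Ky : y \in K by rewrite -defK (subsetP (mulG_subr _ _)) ?cycle_id.
have card_cycle z : z \in K -> #|<[z]> / 'Phi(K)| <= p.
  move=> Kz; rewrite quotient_cycle ?nPhi // -orderE.
  apply: dvdn_leq (prime_gt0 p_pr) _; rewrite order_dvdn.
  by have [_ ->] := abelemP p_pr abK; rewrite ?mem_quotient.
have -> : K / 'Phi(K) = <[x]> / 'Phi(K) * (<[y]> / 'Phi(K)).
  by rewrite -quotientMl ?cycle_subG ?nPhi // defK.
rewrite -mulnn.
apply: leq_trans (dvdn_leq _ (dvdn_cardMg _ _)) _; first by rewrite muln_gt0 !cardG_gt0.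
by rewrite leq_mul ?card_cycle.
Qed.

End ProductsOfCyclicPGroups.

Section CoprimeProductsOfCycles.

Variables (gT : finGroupType) (p : nat) (K N : {group gT}) (x y : gT).
Hypotheses (p_pr : prime p) (pK : p.-group K) (defK : <[x]> * <[y]> = K).
Hypotheses (nKN : N \subset 'N(K)) (coKN : coprime #|K| #|N|).
Hypotheses (cNy : y \in 'C(N)) (neq_xK : <[x]> != K) (ncNK : ~~ (N \subset 'C(K))).

Let R := [~: K, N]%G.
Let P := 'Phi(K)%G.
Let solK : solvable K. Proof. exact: pgroup_sol pK. Qed.
Let sRK : R \subset K. Proof. by rewrite commg_subl. Qed.
Let nRK : K \subset 'N(R). Proof. exact: commg_norml. Qed.
Let nRN : N \subset 'N(R). Proof. exact: commg_normr. Qed.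
Let Ky : y \in K. Proof. by rewrite -defK (subsetP (mulG_subr _ _)) ?cycle_id. Qed.
Let Kx : x \in K. Proof. by rewrite -defK (subsetP (mulG_subl _ _)) ?cycle_id. Qed.
Let nPK : K \subset 'N(P). Proof. exact: normal_norm (Phi_normal K). Qed.
Let nPN : N \subset 'N(P). Proof. exact: char_norm_trans (Phi_char K) nKN. Qed.
Let nPy : <[y]> \subset 'N(P). Proof. by rewrite cycle_subG (subsetP nPK). Qed.
Let RN : [~: R, N] = R. Proof. exact: coprime_commGid. Qed.

(* [N] has no fixed points on the commutator of an abelian group with it. *)
Let quotient_commg_TI (M : {group gT}) : K \subset 'N(M) -> N \subset 'N(M) ->
  abelian (R / M) -> R / M :&: <[y]> / M = 1.
Proof.
move=> nMK nMN abRM; apply/trivgP.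
rewrite -(coprime_abel_cent_TI (quotient_norms M nRN) _ abRM); last first.
  by apply: coprime_morph; apply: coprimeSg coKN.
rewrite -quotientR ?(subset_trans sRK) // [[~: gval R, _]]RN.
by apply: setIS; apply: quotient_cents; rewrite cycle_subG.
Qed.

Lemma commg_Phi_prod_cycles : #|R / P| = p /\ R / P * (<[y]> / P) = K / P.
Proof.
have abK : p.-abelem (K / P) := Phi_quotient_abelem pK.
have sRKP := quotientS P sRK.
have syKP : <[y]> / P \subset K / P by rewrite quotientS // cycle_subG.
apply: (abelem_TI_p2 p_pr abK (card_Phi_prod_cycles p_pr pK defK) sRKP syKP).
- apply: quotient_commg_TI => //.
  exact: abelianS sRKP (abelem_abelian abK).
- rewrite -subG1 quotient_sub1; last exact: subset_trans sRK nPK.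
  by apply: contra ncNK => /(coprime_cents_Phi nKN coKN solK).
rewrite -subG1 quotient_sub1 // cycle_subG; apply: contra neq_xK => Py.
apply/eqP; rewrite -[LHS]genGid; apply: Phi_nongen.
apply/eqP; rewrite eqEsubset join_subG Phi_sub cycle_subG Kx /=.
by rewrite -{1}defK mulG_subG joing_subr cycle_subG mem_gen // inE Py.
Qed.

Lemma commg_mul_prod_cycles : R * <[y]> = K.
Proof.
have nRy : <[y]> \subset 'N(R) by rewrite cycle_subG (subsetP nRK).
rewrite -norm_joinEr //= -[LHS]genGid; apply: Phi_nongen.
apply/eqP; rewrite eqEsubset join_subG Phi_sub join_subG sRK cycle_subG Ky /=.
have nPRy : R <*> <[y]> \subset 'N(P) by rewrite join_subG nPy (subset_trans sRK).
rewrite (norm_joinEr nPRy) -quotientSK //= (norm_joinEr nRy) quotientMl ?(subset_trans sRK) //.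
by have [_ ->] := commg_Phi_prod_cycles.
Qed.

Lemma coprime_prod_cycles_gt2 : 2 < p.
Proof.
have [oRP _] := commg_Phi_prod_cycles.
rewrite ltn_neqAle prime_gt1 // andbT; apply/negP => /eqP p2.
have cNR : N / P \subset 'C(R / P).
  by apply: cents_card2; rewrite ?oRP //; apply: quotient_norms.
have : R / P = 1.
  by rewrite /= -[gval R]RN quotientR ?(subset_trans sRK) //; apply/commG1P; rewrite centsC.
by move/(congr1 (fun X : {set _} => #|X|)); rewrite oRP cards1 -p2.
Qed.

Lemma cyclic_commg_prod_cycles : cyclic R.
Proof.
apply: contraT => ncycR; have p_gt2 := coprime_prod_cycles_gt2.
have pR := pgroupS sRK pK; have nsRK : R <| K by rewrite /normal sRK.
have nPhiR (X : {set gT}) : X \subset 'N(R) -> X \subset 'N('Phi(R)).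
  exact: char_norm_trans (Phi_char R).
have sRyF : R :&: <[y]> \subset 'Phi(R).
  rewrite -quotient_sub1; last by rewrite subIset // nPhiR ?normG.
  rewrite -(@quotient_commg_TI 'Phi(R)%G) ?nPhiR ?quotientI //.
  exact: abelem_abelian (Phi_quotient_abelem pR).
have [M [nsMK sMR abRM oRM]] := exists_normal_abelem_p2 p_pr pK nsRK ncycR.
have nMK := normal_norm nsMK; have nMR := subset_trans sRK nMK.
have nMz z : z \in K -> <[z]> \subset 'N(M) by move=> Kz; rewrite cycle_subG (subsetP nMK).
have cycM z : z \in K -> <[coset M z]> = <[z]> / M.
  by move=> Kz; rewrite quotient_cycle ?(subsetP nMK).
suff p2 : p = 2 by rewrite p2 in p_gt2.
apply: (@prod_cycles_abelem_p2 _ p p_pr (K / M)%G (R / M)%G (coset M x) (coset M y)) => //.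
- exact: quotient_pgroup.
- by rewrite !cycM // -quotientMl ?defK ?nMz.
- exact: quotient_normal.
- by rewrite cycM // -quotientMl ?commg_mul_prod_cycles.
rewrite cycM // -quotientGI //; apply/trivgP.
rewrite quotient_sub1; last exact: subset_trans (subsetIl _ _) nMR.
exact: subset_trans sRyF (Phi_min pR nMR abRM).
Qed.

End CoprimeProductsOfCycles.

Section Transfer.

Variables (gT : finGroupType) (G S : {group gT}).
Hypotheses (sSG : S \subset G) (abS : abelian S).

Lemma transfer_central : exists f : {morphism G >-> gT},
  f @* G \subset S /\ {in S :&: 'C(G), forall z, f z = z ^+ #|G : S|}.
Proof.
have abA : abelian (idm S @* S) by rewrite morphim_idm.
pose f x := FiniteModule.fmval (transfer G abA x).
have fM : {in G &, {morph f : x y / x * y}}.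
  by move=> x y Gx Gy; rewrite /f transferM.
exists (Morphism fM); split.
  apply/subsetP=> _ /morphimP[x _ _ ->] /=.
  apply: (subsetP (_ : idm S @* S \subset S)); first by rewrite morphim_idm.
  exact: FiniteModule.fmodP.
move=> z /setIP[Sz /centP cGz] /=; rewrite /f /transfer.
rewrite (eq_bigr (fun _ => FiniteModule.fmod abA z)) => [|_ /rcosetsP[x Gx ->]]; last first.
  have Grx : repr (S :* x) \in G.
    have := mem_repr_rcoset S x; case/rcosetP=> t St ->.
    by rewrite groupM // (subsetP sSG).
  rewrite /= -rcosetM /= (_ : S :* (x * z) = S :* x); last first.
    by have -> : x * z = z * x; [rewrite cGz | rewrite rcosetM (rcoset_id Sz)].
  by rewrite -cGz // mulgK.
rewrite GRing.sumr_const FiniteModule.fmvalZ FiniteModule.fmodK //.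
by apply: (subsetP (_ : S \subset idm S @* S)); rewrite ?morphim_idm.
Qed.

End Transfer.

Lemma cyclic_Sylow_transfer_onto (gT : finGroupType) (p : nat) (G S X : {group gT}) :
  prime p -> p.-Sylow(G) S -> cyclic S -> X \subset S -> #|X| = p -> X \subset 'C(G) ->
  exists f : {morphism G >-> gT}, f @* G \subset S /\ f @* S = S.
Proof.
move=> p_pr /and3P[sSG pS p'S] cycS sXS oX cGX.
have [f [sfS fz]] := transfer_central sSG (cyclic_abelian cycS).
exists f; split=> //; apply/eqP; rewrite eqEcard (subset_trans (morphimS f sSG)) //=.
suff kerf : S :&: 'ker f = 1 by rewrite card_morphim (setIidPr sSG) -indexgI kerf indexg1.
apply/eqP/negPn/negP => ntSf.
have [_ dvp _] := pgroup_pdiv (pgroupS (subsetIl S ('ker f)) pS) ntSf.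
have sXf : X \subset S :&: 'ker f by rewrite -(cardSg_cyclic cycS) ?subsetIl ?oX.
have [|y Xy oy] := @Cauchy _ p X p_pr; first by rewrite oX.
have /setIP[Sy /mker] := subsetP sXf y Xy.
rewrite fz => [/eqP|]; last by rewrite inE Sy (subsetP cGX).
by rewrite -order_dvdn oy; apply/negP; rewrite -p'natE.
Qed.

(** * The chirality group *)

Section ChiralityGroup.

Variables (gT : finGroupType) (s t : gT).

Definition mirror_pairs : {group gT * gT} := <<[set (s, s^-1); (t, t^-1)]>>%G.

Definition chirality_group : {group gT} := (@pair1g gT gT @*^-1 mirror_pairs)%G.

Lemma mem_chirality_group h : (h \in chirality_group) = ((1, h) \in mirror_pairs).
Proof. by rewrite !inE. Qed.

Lemma mirror_pairsl : (s, s^-1) \in mirror_pairs.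
Proof. by rewrite mem_gen // !inE eqxx. Qed.

Lemma mirror_pairsr : (t, t^-1) \in mirror_pairs.
Proof. by rewrite mem_gen // !inE eqxx orbT. Qed.

Lemma mirror_pairs_ind (P : gT -> gT -> Prop) :
  P 1 1 -> P s s^-1 -> P t t^-1 ->
  (forall g h g' h', P g h -> P g' h' -> P (g * g') (h * h')) ->
  forall g h, (g, h) \in mirror_pairs -> P g h.
Proof.
move=> P1 Ps Pt PM g h gh.
apply: (gen_ind (P := fun u => P u.1 u.2) _ _ _ gh) => //.
  by move=> _ /set2P[]->.
by move=> [a b] [c d]; apply: PM.
Qed.

Lemma mirror_pairs_sub (G : {group gT}) g h :
  s \in G -> t \in G -> (g, h) \in mirror_pairs -> g \in G /\ h \in G.
Proof.
move=> Gs Gt; move: g h; apply: mirror_pairs_ind; rewrite ?groupV //.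
by move=> g h g' h' [Gg Gh] [Gg' Gh']; rewrite !groupM.
Qed.

Lemma chirality_group_sub (G : {group gT}) : s \in G -> t \in G -> chirality_group \subset G.
Proof.
move=> Gs Gt; apply/subsetP=> h.
by rewrite mem_chirality_group => /(mirror_pairs_sub Gs Gt)[].
Qed.

Lemma mirror_pairs_norm g h : (g, h) \in mirror_pairs -> h \in 'N(chirality_group).
Proof.
move=> gh; rewrite inE; apply/subsetP=> _ /imsetP[k + ->].
rewrite !mem_chirality_group => k1.
have : (1 ^ g, k ^ h) \in mirror_pairs by apply: (groupJ k1 gh).
by rewrite conj1g.
Qed.

Lemma mirror_pairs_cycle g : (g \in <[s]>) || (g \in <[t]>) -> (g, g^-1) \in mirror_pairs.
Proof.
have pairX u i : (u, u^-1) \in mirror_pairs -> (u ^+ i, u ^- i) \in mirror_pairs.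
  move=> Mu; elim: i => [|i IH]; first by rewrite !expg0 invg1 (group1 mirror_pairs).
  by have := groupM IH Mu; rewrite -[_ * _]/(u ^+ i * u, u ^- i * u^-1) -invMg -expgS -expgSr.
by case/orP=> /cycleP[i ->]; apply: pairX; rewrite (mirror_pairsl, mirror_pairsr).
Qed.

(* If conjugation by [x] inverts both generators modulo [X], it realises the mirror map there. *)
Lemma chirality_sub_conj (X : {group gT}) x :
  s \in 'N(X) -> t \in 'N(X) -> s ^ x * s \in X -> t ^ x * t \in X ->
  chirality_group \subset X.
Proof.
move=> nXs nXt Xs Xt.
have mirrorJ g h : (g, h) \in mirror_pairs -> h \in 'N(X) /\ h * (g ^ x)^-1 \in X.
  move: g h; apply: mirror_pairs_ind; rewrite ?groupV //.
  - by rewrite conj1g invg1 mulg1.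
  - by rewrite -invMg groupV.
  - by rewrite -invMg groupV.
  move=> g h g' h' [nh Xh] [nh' Xh']; split; first exact: groupM.
  rewrite conjMg invMg.
  have -> : h * h' * ((g' ^ x)^-1 * (g ^ x)^-1) =
            (h' * (g' ^ x)^-1) ^ h^-1 * (h * (g ^ x)^-1).
    by rewrite [_ ^ h^-1]conjgE invgK !mulgA mulgKV.
  by rewrite groupM // memJ_norm ?groupV.
apply/subsetP=> h; rewrite mem_chirality_group => /mirrorJ[_].
by rewrite conj1g invg1 mulg1.
Qed.

Section Complement.

Variables G V H : {group gT}.
Hypotheses (defG : V * H = G) (tiVH : V :&: H = 1) (abV : abelian V) (nVG : G \subset 'N(V)).
Hypotheses (Gs : s \in G) (cVs : s \in 'C(V)) (Ht : t \in H).
Hypothesis invt : {in V, forall b, b ^ t = b^-1}.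

(* Along [mirror_pairs] the [V]-parts stay mutually inverse, while the [H]-parts act alike on
   [V]. *)
Let mirror_parts g h := exists b k k',
  [/\ b \in V, k \in H /\ k' \in H, g = b * k, h = b^-1 * k'
    & {in V, forall v, v ^ k^-1 = v ^ k'^-1}].

Let nVH x : x \in H -> x \in 'N(V).
Proof. by move=> Hx; rewrite (subsetP nVG) // -defG (subsetP (mulG_subr _ _)). Qed.

Let mirror_parts_mul g h g' h' :
  mirror_parts g h -> mirror_parts g' h' -> mirror_parts (g * g') (h * h').
Proof.
move=> [b [k [k' [Vb [Hk Hk'] -> -> eq_k]]]] [c [l [l' [Vc [Hl Hl'] -> -> eq_l]]]].
exists (b * c ^ k^-1), (k * l), (k' * l'); split.
- by rewrite groupM // memJ_norm ?groupV ?nVH.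
- by rewrite !groupM.
- by rewrite conjgE invgK !mulgA mulgKV.
- rewrite eq_k // invMg -conjVg.
  have -> : c^-1 ^ k'^-1 * b^-1 = b^-1 * c^-1 ^ k'^-1.
    by apply: (centsP abV); rewrite ?groupV // memJ_norm ?groupV ?nVH.
  by rewrite conjgE invgK !mulgA mulgKV.
by move=> v Vv; rewrite !invMg !conjgM eq_l // eq_k // memJ_norm ?groupV ?nVH.
Qed.

Lemma mirror_pairs_complement g h : (g, h) \in mirror_pairs -> mirror_parts g h.
Proof.
move: g h; apply: mirror_pairs_ind; last exact: mirror_parts_mul.
- by exists 1, 1, 1; split; rewrite ?group1 ?invg1 ?mulg1.
- have /mulsgP[b k Vb Hk def_s] : s \in V * H by rewrite defG.
  have cVk : k \in 'C(V) by rewrite -(mulKg b k) -def_s groupM // groupV (subsetP abV).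
  exists b, k, k^-1; split; rewrite ?groupV //.
    by rewrite def_s invMg; apply: (centP (groupVr cVk)); rewrite groupV.
  by move=> v Vv; rewrite invgK !(conjg_cent Vv) ?groupV.
exists 1, t, t^-1; split; rewrite ?groupV ?group1 ?invg1 ?mul1g //.
move=> v Vv; rewrite invgK invt //; apply: (conjg_inj t).
by rewrite conjgKV conjVg invt // invgK.
Qed.

Lemma chirality_TI_complement : chirality_group :&: V = 1.
Proof.
apply/trivgP/subsetP=> h /setIP[].
rewrite mem_chirality_group => /mirror_pairs_complement[b [k [k' [Vb [Hk Hk'] bk1 -> _]]]] Vh.
have b1 : b = 1.
  by apply/set1gP; rewrite -tiVH inE Vb -groupV -(mulg1 b^-1) bk1 mulKg.
have : k' \in V :&: H by rewrite inE Hk' andbT; move: Vh; rewrite b1 invg1 mul1g.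
by rewrite tiVH b1 invg1 mul1g.
Qed.

End Complement.

End ChiralityGroup.

Section ChiralityMorphism.

Variables (gT rT : finGroupType) (G : {group gT}) (f : {morphism G >-> rT}) (s t : gT).
Hypotheses (Gs : s \in G) (Gt : t \in G).

Lemma mirror_pairs_morph u v : (u, v) \in mirror_pairs (f s) (f t) ->
  exists g h, [/\ (g, h) \in mirror_pairs s t, f g = u & f h = v].
Proof.
move: u v; apply: mirror_pairs_ind.
- by exists 1, 1; rewrite morph1; split=> //; apply: (group1 (mirror_pairs s t)).
- by exists s, s^-1; rewrite morphV //; split=> //; apply: mirror_pairsl.
- by exists t, t^-1; rewrite morphV //; split=> //; apply: mirror_pairsr.
move=> u v u' v' [g [h [gh <- <-]]] [g' [h' [gh' <- <-]]].
have [Gg Gh] := mirror_pairs_sub Gs Gt gh; have [Gg' Gh'] := mirror_pairs_sub Gs Gt gh'.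
by exists (g * g'), (h * h'); rewrite !morphM //; split=> //; apply: (groupM gh gh').
Qed.

Lemma morphim_mirror_pairs g h : (g, h) \in mirror_pairs s t ->
  (f g, f h) \in mirror_pairs (f s) (f t).
Proof.
suff gen_fgh : (g, h) \in mirror_pairs s t ->
    [/\ (f g, f h) \in mirror_pairs (f s) (f t), g \in G & h \in G] by case/gen_fgh.
move: g h; apply: mirror_pairs_ind.
- by rewrite morph1; split=> //; apply: (group1 (mirror_pairs _ _)).
- by rewrite morphV // groupV; split=> //; apply: mirror_pairsl.
- by rewrite morphV // groupV; split=> //; apply: mirror_pairsr.
move=> g h g' h' [fgh Gg Gh] [fgh' Gg' Gh'].
by split; [rewrite !morphM //; apply: (groupM fgh fgh') | apply: groupM | apply: groupM].
Qed.

(* An element inverting the images of both generators kills the chirality group. *)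
Lemma chirality_sub_ker x : f s ^ x = (f s)^-1 -> f t ^ x = (f t)^-1 ->
  chirality_group s t \subset 'ker f.
Proof.
move=> invs invt.
have Ch1 : chirality_group (f s) (f t) \subset [1 rT]%G.
  by apply: (@chirality_sub_conj _ _ _ _ x); rewrite ?norm1 ?invs ?invt ?mulVg ?inE.
apply/subsetP => h; rewrite mem_chirality_group => h1.
have [_ Gh] := mirror_pairs_sub Gs Gt h1; apply/kerP => //; apply/set1gP/(subsetP Ch1).
by rewrite mem_chirality_group -[1](morph1 f) morphim_mirror_pairs.
Qed.

Lemma chirality_group_morph1 :
  ('ker f \subset <[s]>) || ('ker f \subset <[t]>) ->
  chirality_group s t \subset 'ker f -> chirality_group (f s) (f t) :=: 1.
Proof.
move=> sK sCh; apply/trivgP/subsetP => v.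
rewrite mem_chirality_group => /mirror_pairs_morph[g [h [gh fg <-]]].
have [Gg _] := mirror_pairs_sub Gs Gt gh.
have kg : g \in 'ker f by apply/kerP.
have gV : (g, g^-1) \in mirror_pairs s t.
  by apply: mirror_pairs_cycle; case/orP: sK => /subsetP->; rewrite ?orbT.
have : (1, g * h) \in mirror_pairs s t.
  have := groupM (groupVr gV) gh.
  by rewrite -[_ * _]/(g^-1 * g, g^-1^-1 * h) mulVg invgK.
rewrite -mem_chirality_group => /(subsetP sCh); rewrite groupMl // => kh.
by rewrite inE; apply/eqP/mker.
Qed.

End ChiralityMorphism.

(** * Tight factorisations *)

Section TightFactorisation.

Variables (gT : finGroupType) (s1 s2 s3 : gT) (Gam GF GV : {group gT}).
Local Notation A := <[s1]>.
Local Notation B := <[s2]>.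
Local Notation D := <[s3]>.
Local Notation Ch := (chirality_group s2 s3).
Local Notation core := (gcore GV Gam).

Hypotheses (mul12_sq1 : (s1 * s2) ^+ 2 = 1) (mul23_sq1 : (s2 * s3) ^+ 2 = 1)
  (mul123_sq1 : (s1 * s2 * s3) ^+ 2 = 1).
Hypotheses (defGF : A * B = GF) (defGV : B * D = GV) (defGam : A * GV = Gam).
Hypotheses (tiAGV : A :&: GV = 1) (capGFGV : GF :&: GV = B) (tiBD : B :&: D = 1).
Hypothesis core_s3 : s3 ^+ 2 \in core.
Hypothesis atomic : forall K : {group gT}, K <| Gam -> K :!=: 1 -> K \subset GF ->
  K \subset (K :&: A) * (K :&: B) -> s1 \notin K -> s2 \notin K -> Ch \subset K.

Let sAF : A \subset GF. Proof. by rewrite -defGF mulG_subl. Qed.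
Let sBF : B \subset GF. Proof. by rewrite -defGF mulG_subr. Qed.
Let sBV : B \subset GV. Proof. by rewrite -defGV mulG_subl. Qed.
Let sDV : D \subset GV. Proof. by rewrite -defGV mulG_subr. Qed.
Let sAGam : A \subset Gam. Proof. by rewrite -defGam mulG_subl. Qed.
Let sVGam : GV \subset Gam. Proof. by rewrite -defGam mulG_subr. Qed.
Let sFGam : GF \subset Gam. Proof. by rewrite -defGF -defGam mulgS. Qed.
Let GVs2 : s2 \in GV. Proof. by rewrite -cycle_subG. Qed.
Let GVs3 : s3 \in GV. Proof. by rewrite -cycle_subG. Qed.
Let tiAB : A :&: B = 1. Proof. by apply/trivgP; rewrite -tiAGV setIS. Qed.
Let abA : abelian A. Proof. exact: cycle_abelian. Qed.
Let abB : abelian B. Proof. exact: cycle_abelian. Qed.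

Let invA a : a \in A -> a ^ (s2 * s3) = a^-1.
Proof.
case/cycleP=> i ->; rewrite conjXg (invg_conj_involution mul23_sq1) ?expgVn //.
by apply: mulg_sq1C; rewrite mulgA.
Qed.

Let norm_Gam (X : {group gT}) :
  s1 \in 'N(X) -> s2 \in 'N(X) -> s3 \in 'N(X) -> Gam \subset 'N(X).
Proof. by move=> n1 n2 n3; rewrite -defGam -defGV !mul_subG ?cycle_subG. Qed.

Let Ch_GV : Ch \subset GV. Proof. exact: chirality_group_sub. Qed.

Let nChGV : GV \subset 'N(Ch).
Proof.
rewrite -defGV mul_subG ?cycle_subG // -groupV.
  exact: mirror_pairs_norm (mirror_pairsl _ _).
exact: mirror_pairs_norm (mirror_pairsr _ _).
Qed.

Let nsCore : core <| Gam. Proof. exact: gcore_normal. Qed.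
Let sCoreV : core \subset GV. Proof. exact: gcore_sub. Qed.

Lemma Ch_sub_sq_s2 (K : {group gT}) : K <| Gam -> s2 ^+ 2 \in K -> Ch \subset K.
Proof.
move=> /andP[_ nK] Ks2; have nKV := subset_trans sVGam nK.
apply: (@chirality_sub_conj _ _ _ K s2); rewrite ?(subsetP nKV) //.
  by rewrite /conjg mulKg -expg2.
by rewrite conjg_mul_sq1 // groupV.
Qed.

Lemma Ch_sub_core : Ch \subset core.
Proof.
have nCV := subset_trans sVGam (normal_norm nsCore).
apply: (@chirality_sub_conj _ _ _ _ s3); rewrite ?(subsetP nCV) //.
  by rewrite conjg_mul_sq1 ?groupV //; apply: mulg_sq1C.
by rewrite /conjg mulKg -expg2.
Qed.

Lemma Ch_sub_factorised (K : {group gT}) : K <| Gam -> K :!=: 1 -> K \subset GF ->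
  K \subset (K :&: A) * (K :&: B) -> Ch \subset K.
Proof.
move=> nsK ntK sKF facK; have nK := normal_norm nsK.
have [Ks1 | nKs1] := boolP (s1 \in K).
  apply: Ch_sub_sq_s2 => //; rewrite -groupV -(conjg_mul_sq1 (mulg_sq1C mul12_sq1)).
  by rewrite groupM // memJ_norm // (subsetP nK) // (subsetP sVGam).
have [Ks2 | nKs2] := boolP (s2 \in K); first by rewrite Ch_sub_sq_s2 ?groupX.
exact: atomic.
Qed.

Section Hull.

Variable Y : {group gT}.
Hypotheses (nsY : Y <| Gam) (sYF : Y \subset GF).
Let nY := normal_norm nsY.
Let nYF : GF \subset 'N(Y). Proof. exact: subset_trans sFGam nY. Qed.
Let nYB : B \subset 'N(Y). Proof. exact: subset_trans sBF nYF. Qed.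

(* The hull [Y (A :&: Y B)] of [Y] factors along [A * B]. *)
Definition hull : {group gT} := (Y <*> (A :&: (Y <*> B)))%G.

Lemma sub_hull : Y \subset hull. Proof. exact: joing_subl. Qed.

Lemma hull_sub : hull \subset GF.
Proof. by rewrite join_subG sYF subIset ?sAF. Qed.

Let sub_capA : A :&: (Y <*> B) \subset hull. Proof. exact: joing_subr. Qed.

Lemma hull_capA : hull :&: A = A :&: (Y <*> B).
Proof.
apply/eqP; rewrite eqEsubset [X in _ && X]subsetI sub_capA subsetIl !andbT setIC setIS //.
by rewrite join_subG joing_subl subsetIr.
Qed.

Lemma hull_mulA : hull = Y * (hull :&: A) :> {set gT}.
Proof. by rewrite hull_capA /= norm_joinEr // subIset ?(subset_trans sAF nYF). Qed.

Lemma hull_factor : (hull :&: A) * (hull :&: B) = hull.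
Proof.
apply/eqP; rewrite eqEsubset mul_subG ?subsetIl //=; apply/subsetP=> k Kk.
have /mulsgP[a b Aa Bb def_k] : k \in A * B by rewrite defGF (subsetP hull_sub).
have YBk : k \in Y <*> B.
  by apply: subsetP Kk; rewrite join_subG joing_subl subsetIr.
have Ka : a \in hull :&: A.
  rewrite hull_capA inE Aa -(mulgK b a) -def_k groupM ?groupV //.
  by rewrite (subsetP (joing_subr _ _)).
have Kb : b \in hull by rewrite -(mulKg a b) -def_k groupM ?groupV //; case/setIP: Ka.
by rewrite def_k mem_mulg // inE Kb.
Qed.

Let norm_hull t : t \in Gam -> {in hull :&: A, forall a, a ^ t \in hull} -> t \in 'N(hull).
Proof.
move=> Gt hullJ; rewrite inE; apply/subsetP=> _ /imsetP[k + ->].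
rewrite {1}hull_mulA => /mulsgP[y a Yy Ka ->]; rewrite conjMg (groupMr _ (hullJ _ Ka)).
by apply: (subsetP sub_hull); rewrite memJ_norm // (subsetP nY).
Qed.

Lemma hull_normal : hull <| Gam.
Proof.
have sub_hullA : {subset hull :&: A <= hull} by apply/subsetP/subsetIl.
have n2 : s2 \in 'N(hull).
  apply: norm_hull => [|a Ka]; first exact: (subsetP sVGam).
  have : a \in Y * B by rewrite -(norm_joinEr nYB); move: Ka; rewrite hull_capA => /setIP[].
  case/mulsgP=> y b Yy Bb def_a.
  have -> : a ^ s2 = y ^ s2 * y^-1 * a.
    rewrite def_a conjMg -[RHS]mulgA mulKg; congr (_ * _).
    by rewrite (conjg_cent Bb) // (subsetP abB) ?cycle_id.
  rewrite (groupMr _ (sub_hullA _ Ka)); apply: (subsetP sub_hull).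
  by rewrite groupMr ?groupV // memJ_norm // (subsetP nYF) // (subsetP sBF) ?cycle_id.
have n23 : s2 * s3 \in 'N(hull).
  apply: norm_hull => [|a Ka]; first by rewrite (subsetP sVGam) ?groupM.
  by rewrite invA ?groupV ?sub_hullA //; case/setIP: Ka.
rewrite /normal (subset_trans hull_sub) //=; apply: norm_Gam => //.
  apply: norm_hull => [|a Ka]; first by rewrite (subsetP sAGam) ?cycle_id.
  have /setIP[Khull Aa] := Ka.
  by rewrite (conjg_cent Aa) // (subsetP abA) ?cycle_id.
by rewrite -(mulKg s2 s3) groupM ?groupV.
Qed.

Lemma card_hull_capA : (#|hull :&: A| * #|Y :&: B|)%N = #|Y|.
Proof.
have tiKAB : hull :&: A :&: B = 1 by apply/trivgP; rewrite -tiAB setSI ?subsetIr.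
have defYB : (hull :&: A) * B = Y * B.
  rewrite hull_capA setIC group_modr ?joing_subr // defGF -(norm_joinEr nYB).
  by apply/setIidPl; rewrite join_subG sYF.
have := mul_cardG Y B; rewrite -defYB (TI_cardMg tiKAB) mulnAC.
by move/eqP; rewrite eqn_pmul2r ?cardG_gt0 // => /eqP.
Qed.

Lemma hull_pgroup pi : pi.-group Y -> pi.-group hull.
Proof.
move=> piY; have piA : pi.-group (hull :&: A).
  by apply: pnat_dvd piY; rewrite -card_hull_capA dvdn_mulr.
rewrite /pgroup hull_mulA; apply: pnat_dvd (dvdn_cardMg _ _) _.
by rewrite pnatM; apply/andP.
Qed.

Lemma Ch_sub_hull : Y :!=: 1 -> Ch \subset hull.
Proof.
move=> ntY; apply: Ch_sub_factorised; rewrite ?hull_factor ?hull_sub ?hull_normal //.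
by apply: contra ntY => /eqP hull1; rewrite -subG1 -hull1 sub_hull.
Qed.

End Hull.

(* Towards a contradiction, [N] is a subgroup of [B] of prime order, normal in [GV], that does not
   contain [Ch]. *)
Section PrimeKernel.

Variables (N : {group gT}) (s : nat).
Hypotheses (sNB : N \subset B) (nsN : N <| GV) (s_pr : prime s) (oN : #|N| = s).
Hypothesis not_ChN : ~~ (Ch \subset N).

Let nNV := normal_norm nsN.
Let sNGam := subset_trans (normal_sub nsN) sVGam.
Let cNB : B \subset 'C(N). Proof. by rewrite (subset_trans abB) // centS. Qed.
Let sgN : s.-group N. Proof. by rewrite /pgroup oN pnat_id. Qed.
Let ntN : N :!=: 1. Proof. by rewrite -cardG_gt1 oN prime_gt1. Qed.
Let ntCh : Ch :!=: 1. Proof. by apply: contra not_ChN => /eqP->; apply: sub1G. Qed.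

Let L : {group gT} := <<class_support N Gam>>%G.

Let closure_sub (X : {group gT}) : N \subset X -> Gam \subset 'N(X) -> L \subset X.
Proof. by move=> sNX nX; rewrite gen_subG class_support_sub_norm. Qed.

Let sNL : N \subset L.
Proof. by apply/subsetP=> n Nn; rewrite mem_gen // -(conjg1 n) imset2_f. Qed.

Let nsL : L <| Gam.
Proof. by rewrite /normal closure_sub ?normG // norms_gen ?class_support_norm. Qed.

Let sLF : L \subset GF.
Proof.
rewrite gen_subG; apply/subsetP=> _ /imset2P[n g Nn Gg ->].
have : g \in GV * A by rewrite -invMG defGam invGid.
case/mulsgP=> v a GVv Aa ->; rewrite conjgM groupJ ?(subsetP sAF a) //.
by rewrite (subsetP sBF) // (subsetP sNB) // memJ_norm // (subsetP nNV).
Qed.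

Let ntL : L :!=: 1.
Proof. by apply: contra ntN => /eqP L1; rewrite -subG1 -L1. Qed.

Let Ch_B : Ch \subset B.
Proof.
by rewrite -capGFGV subsetI Ch_GV (subset_trans (Ch_sub_hull nsL sLF ntL)) ?hull_sub.
Qed.

Let core_sub_normal (X : {group gT}) :
  X \subset B -> X \subset core -> GV \subset 'N(X) -> X <| Gam.
Proof.
move=> sXB sXC nXV; rewrite /normal (subset_trans sXB) ?(subset_trans sBV) //=.
have charX : X \char core :&: B.
  by rewrite sub_cyclic_char ?subsetI ?sXC // (cyclicS (subsetIr _ _)) ?cycle_cyclic.
have defCB : core :&: B = core :&: GF.
  apply/eqP; rewrite eqEsubset setIS //= subsetI subsetIl -capGFGV subsetI subsetIr /=.
  by rewrite subIset ?sCoreV.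
have nXF : GF \subset 'N(X).
  apply: char_norm_trans charX _.
  by rewrite /= defCB normsI ?normG // (subset_trans sFGam (normal_norm nsCore)).
apply: norm_Gam; [|exact: (subsetP nXV)|exact: (subsetP nXV)].
by rewrite (subsetP nXF) // (subsetP sAF) ?cycle_id.
Qed.

Let Ch_sub_core_sub (X : {group gT}) :
  X \subset B -> X \subset core -> GV \subset 'N(X) -> X :!=: 1 -> Ch \subset X.
Proof.
move=> sXB sXC nXV ntX; apply: Ch_sub_factorised => //; first exact: core_sub_normal.
  exact: subset_trans sXB sBF.
by rewrite (subset_trans _ (mulG_subr _ _)) // subsetI subxx.
Qed.

Let l := #|Ch|.

Let l_pr : prime l.
Proof.
have Ch_gt1 : 1 < #|Ch| by rewrite cardG_gt1.
have [q q_pr /(Cauchy q_pr)[y Chy oy]] := pdivP Ch_gt1.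
have sYCh : <[y]> \subset Ch by rewrite cycle_subG.
suff sChY : Ch \subset <[y]>.
  by rewrite /l (_ : Ch :=: <[y]>) -?orderE ?oy //; apply/eqP; rewrite eqEsubset sChY.
apply: Ch_sub_core_sub; rewrite ?(subset_trans sYCh) ?Ch_sub_core //.
  apply: char_norm_trans nChGV.
  by rewrite sub_cyclic_char // (cyclicS Ch_B) ?cycle_cyclic.
by rewrite -cardG_gt1 -orderE oy prime_gt1.
Qed.

Let Ch_sub_lgroup (X : {group gT}) :
  X \subset B -> l.-group X -> X :!=: 1 -> Ch \subset X.
Proof.
move=> sXB lX ntX; have [_ dvl _] := pgroup_pdiv lX ntX.
by rewrite -(cardSg_cyclic (cycle_cyclic s2)).
Qed.

Let neq_sl : s != l.
Proof.
by apply: contra not_ChN => /eqP sl; rewrite -(cardSg_cyclic (cycle_cyclic s2)) // oN sl.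
Qed.

Let l'_sgroup (rT : finGroupType) (X : {group rT}) : s.-group X -> l^'.-group X.
Proof. by apply: sub_pgroup => q; rewrite !inE => /eqP->. Qed.

Let tiNcore : N :&: core = 1.
Proof.
apply: prime_TIg; rewrite ?oN //; apply: contra not_ChN => sNC.
exact: Ch_sub_core_sub.
Qed.

(* [N] and the core are normal in [GV] with trivial intersection, so they commute; hence so do the
   closure [L] and the core. *)
Let cLcore : L \subset 'C(core).
Proof.
apply: closure_sub; last by apply: norms_cent; apply: normal_norm.
apply/commG1P/trivgP; rewrite -tiNcore subsetI commg_subl commg_subr.
rewrite (subset_trans sCoreV nNV) /=.
exact: subset_trans sNGam (normal_norm nsCore).
Qed.

Let l'_normal_trivial (Y : {group gT}) :
  Y <| Gam -> Y \subset GF -> l^'.-group Y -> Y :=: 1.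
Proof.
move=> nsY sYF l'Y; apply/eqP/negPn/negP => ntY.
have := pgroupS (Ch_sub_hull nsY sYF ntY) (hull_pgroup nsY sYF l'Y).
by rewrite /pgroup p'natE // dvdnn.
Qed.

Let nilpotent_normal_lgroup (Y : {group gT}) :
  Y <| Gam -> Y \subset GF -> nilpotent Y -> l.-group Y.
Proof.
move=> nsY sYF nilY; have := nilpotent_pcoreC l nilY.
rewrite (_ : 'O_l^'(Y) = 1) ?dprodg1 => [<-|]; first exact: pcore_pgroup.
apply: l'_normal_trivial; rewrite ?pcore_pgroup ?(subset_trans (pcore_sub _ _)) //.
exact: char_normal_trans (pcore_char _ _) nsY.
Qed.

Let R : {group gT} := L^`(1)%G.

Let nsRL : R <| L. Proof. exact: der_normal. Qed.
Let nsR : R <| Gam. Proof. exact: char_normal_trans (der_char 1 L) nsL. Qed.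
Let sRL := normal_sub nsRL.
Let sRF := subset_trans sRL sLF.
Let nRL := normal_norm nsRL.
Let nRGam := normal_norm nsR.
Let abLR : abelian (L / R). Proof. exact: der_abelian. Qed.
Let abR : abelian R.
Proof. exact: abelianS (dergS 1 sLF) (Ito_der1_abelian defGF abA abB). Qed.
Let lgR : l.-group R.
Proof. by apply: nilpotent_normal_lgroup => //; apply: abelian_nil. Qed.

(* [L / R] is abelian and generated by conjugates of the image of the [s]-group [N]. *)
Let sgLR : s.-group (L / R).
Proof.
suff sLO : L / R \subset 'O_s(L / R) by apply: pgroupS sLO (pcore_pgroup _ _).
have sCL : class_support N Gam \subset 'N(R) by apply: subset_trans nRL; apply: subset_gen.
apply: (@subset_trans _ _ <<class_support N Gam / R>>); first by rewrite -quotient_gen.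
rewrite gen_subG; apply/subsetP=> _ /morphimP[x nRx /imset2P[n g Nn Gg def_x] ->].
have Lx : x \in L by rewrite def_x mem_gen // imset2_f.
rewrite -cycle_subG -quotient_cycle //; apply: pcore_max; last first.
  by rewrite -sub_abelian_normal // quotientS // cycle_subG.
by rewrite quotient_pgroup // /pgroup /= -orderE def_x orderJ; apply: mem_p_elt sgN Nn.
Qed.

Let lgroup_sub_R (X : {group gT}) : X \subset L -> l.-group X -> X \subset R.
Proof.
move=> sXL lX; rewrite -quotient_sub1 ?(subset_trans sXL) // subG1 trivg_card1.
apply/eqP; apply: pnat_1 (quotient_pgroup R lX) _.
exact: l'_sgroup (pgroupS (quotientS _ sXL) sgLR).
Qed.

Let nilpotent_centR (Y : {group gT}) : Y \subset L -> R \subset 'C(Y) -> nilpotent Y.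
Proof.
move=> sYL cRY; have sYZ : Y^`(1) \subset 'Z(Y).
  rewrite subsetI der_sub; apply: subset_trans cRY; exact: dergS.
by rewrite -quotient_center_nil abelian_nil // sub_der1_abelian.
Qed.

Let not_cRN : ~~ (N \subset 'C(R)).
Proof.
apply/negP => cRN.
have cRL : L \subset 'C(R) by apply: closure_sub => //; apply: norms_cent.
have lgL : l.-group L.
  by apply: nilpotent_normal_lgroup => //; apply: nilpotent_centR; rewrite // centsC.
have := pnat_1 (pgroupS sNL lgL) (l'_sgroup sgN).
by apply/eqP; rewrite -trivg_card1.
Qed.

Let ntR : R :!=: 1. Proof. by apply: contra not_cRN => /eqP->; apply: cents1. Qed.

Let sub_centL_R : 'C_L(R) \subset R.
Proof.
have nsC : 'C_L(R) <| Gam.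
  rewrite /normal (subset_trans (subsetIl _ _) (normal_sub nsL)) /=.
  by rewrite normsI ?norms_cent // normal_norm.
have sCL : 'C_L(R) \subset L by apply: subsetIl.
apply: lgroup_sub_R => //; apply: nilpotent_normal_lgroup => //.
  exact: subset_trans sCL sLF.
by apply: nilpotent_centR; rewrite // centsC subsetIr.
Qed.

(* [Gam] acts on [R] with an abelian image once [R] is cyclic. *)
Let commg_Gam_N : cyclic R -> [~: Gam, N] \subset R.
Proof.
move=> cycR; apply: subset_trans sub_centL_R; rewrite subsetI; apply/andP; split.
  by apply: subset_trans (commgS _ sNL) _; rewrite commg_subr normal_norm.
apply: subset_trans (der1_norm_cyclic_cents cycR).
exact: subset_trans (commgS _ sNGam) (dergS 1 nRGam).
Qed.

Let K : {group gT} := hull R.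

Let nsK : K <| Gam. Proof. exact: hull_normal. Qed.
Let lgK : l.-group K. Proof. exact: hull_pgroup. Qed.
Let sChK : Ch \subset K. Proof. exact: Ch_sub_hull. Qed.
Let sRK : R \subset K. Proof. exact: sub_hull. Qed.
Let facK : (K :&: A) * (K :&: B) = K. Proof. exact: hull_factor. Qed.
Let mulRA : K = R * (K :&: A) :> {set gT}. Proof. exact: hull_mulA. Qed.
Let nKN : N \subset 'N(K). Proof. exact: subset_trans sNGam (normal_norm nsK). Qed.
Let coKN : coprime #|K| #|N|. Proof. exact: pnat_coprime lgK (l'_sgroup sgN). Qed.
Let solK : solvable K. Proof. exact: pgroup_sol lgK. Qed.
Let lgKA : l.-group (K :&: A). Proof. exact: pgroupS (subsetIl _ _) lgK. Qed.
Let lgKB : l.-group (K :&: B). Proof. exact: pgroupS (subsetIl _ _) lgK. Qed.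

Let commg_hull :
  [/\ cyclic [~: K, N], [~: K, N] * (K :&: B) = K & 2 < l].
Proof.
have /cyclicP[x defx] : cyclic (K :&: A) by apply: cyclicS (subsetIr _ _) (cycle_cyclic _).
have /cyclicP[y defy] : cyclic (K :&: B) by apply: cyclicS (subsetIr _ _) (cycle_cyclic _).
have defK : <[x]> * <[y]> = K by rewrite -defx -defy.
have cNy : y \in 'C(N) by rewrite -cycle_subG -defy subIset // cNB orbT.
have neq_xK : <[x]> != K.
  rewrite -defx; apply: contra ntCh => /eqP capA.
  by rewrite -subG1 -tiAGV subsetI Ch_GV andbT (subset_trans sChK) // -capA subsetIr.
have not_cKN : ~~ (N \subset 'C(K)).
  by apply: contra not_cRN => cKN; rewrite (subset_trans cKN) ?centS.
rewrite defy; split.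
- exact: cyclic_commg_prod_cycles l_pr lgK defK nKN coKN cNy neq_xK not_cKN.
- exact: commg_mul_prod_cycles l_pr lgK defK nKN coKN cNy neq_xK not_cKN.
exact: coprime_prod_cycles_gt2 l_pr lgK defK nKN coKN cNy neq_xK not_cKN.
Qed.

Let odd_l : odd l.
Proof. by have [_ _ l_gt2] := commg_hull; case: (even_prime l_pr) l_gt2 => [->|]. Qed.

Let odd_lgroup (rT : finGroupType) (X : {group rT}) : l.-group X -> odd #|X|.
Proof.
move=> lX; rewrite -coprimen2; apply: pnat_coprime lX _.
by rewrite p'natE // -prime_coprime // coprimen2.
Qed.

Let tiKN_cent : [~: K, N] :&: 'C(N) = 1.
Proof.
have [cycKN _ _] := commg_hull.
rewrite -{1}(coprime_commGid nKN coKN solK).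
apply: coprime_abel_cent_TI (cyclic_abelian cycKN); first exact: commg_normr.
by apply: coprimeSg coKN; rewrite commg_subl.
Qed.

Let cent_sub_B : 'C_K(N) \subset B.
Proof.
have [_ mulKB _] := commg_hull.
apply/subsetP=> k /setIP[]; rewrite -{1}mulKB => /mulsgP[r b Rr /setIP[_ Bb] ->] cNrb.
have : r \in [~: K, N] :&: 'C(N) by rewrite inE Rr -(groupMr _ (subsetP cNB b Bb)).
by rewrite tiKN_cent => /set1gP->; rewrite mul1g.
Qed.

Let cent_Sylow (S : {group gT}) : S \subset L -> N \subset S -> abelian S ->
  coprime #|R| #|S| -> S \subset 'C('C_R(N)).
Proof.
move=> sSL sNS abS coRS; rewrite centsC; apply/commG1P/eqP/negPn/negP => ntXS.
have nXS : S \subset 'N('C_R(N)).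
  rewrite normsI ?(subset_trans sSL nRL) // norms_cent //.
  by rewrite (subset_trans abS) // (subset_trans (centS sNS)) ?cent_sub.
have sXSX : [~: 'C_R(N), S] \subset 'C_R(N) by rewrite commg_subl.
have sCh : Ch \subset [~: 'C_R(N), S].
  apply: Ch_sub_lgroup => //; last by apply: pgroupS lgR; rewrite (subset_trans sXSX) ?subsetIl.
  by rewrite (subset_trans sXSX) // (subset_trans _ cent_sub_B) ?setSI.
have coXS : coprime #|'C_R(N)| #|S| by apply: coprimeSg coRS; apply: subsetIl.
have abX : abelian 'C_R(N) by apply: abelianS abR; apply: subsetIl.
case/negP: ntCh; rewrite -subG1 -(coprime_abel_cent_TI nXS coXS abX) subsetI sCh.
by rewrite centsC (subset_trans sSL) // (subset_trans cLcore) // centS ?Ch_sub_core.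
Qed.

Let defR : R = [~: K, N] :> {set gT}.
Proof.
apply/eqP; rewrite eqEsubset; apply/andP; split; last first.
  apply: lgroup_sub_R; last by apply: pgroupS lgK; rewrite commg_subl.
  apply: subset_trans (commgS K sNL) _; rewrite commg_subr.
  exact: subset_trans (normal_sub nsK) (normal_norm nsL).
have [S sylS sNS] := Sylow_superset sNL sgN.
have sSL := pHall_sub sylS; have nRS := subset_trans sSL nRL.
have coRS : coprime #|R| #|S| by apply: pnat_coprime lgR (l'_sgroup (pHall_pgroup sylS)).
have abS : abelian S.
  rewrite (isog_abelian (quotient_isog nRS (coprime_TIg coRS))).
  exact: abelianS (quotientS _ sSL) abLR.
apply: (@subset_trans _ _ [~: R, N]); last exact: commSg.
apply: (der1_sub_commg (quotient_Sylow_mul nsRL sylS sgLR) abR abS nRS sNS).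
  exact: coprimegS sNS coRS.
exact: cent_Sylow.
Qed.

Let cycR : cyclic R. Proof. by rewrite defR; case: commg_hull. Qed.
Let tiRB : R :&: B = 1. Proof. by apply/trivgP; rewrite -tiKN_cent -defR setIS. Qed.
Let mulRB : R * (K :&: B) = K. Proof. by rewrite defR; case: commg_hull. Qed.

Let card_capA : #|K :&: A| = #|R|.
Proof. by rewrite -(@card_hull_capA R) // tiRB cards1 muln1. Qed.

Let quotient_capA : (K :&: A) / R = (K :&: B) / R.
Proof. by rewrite -(quotientMidl _ (K :&: A)) -mulRA -(quotientMidl _ (K :&: B)) mulRB. Qed.

(* A generator [n] of [N] has no fixed point in ['O_l(A)], and its conjugates lie in [R n]. *)
Let pcoreA : 'O_l(A) = K :&: A.
Proof.
have sOA : 'O_l(A) \subset A by apply: pcore_sub.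
apply/eqP; rewrite eq_sym eqEcard; apply/andP; split.
  by apply: pcore_max; rewrite // -sub_abelian_normal ?subsetIr.
have /cyclicP[n defN] : cyclic N by apply: prime_cyclic; rewrite oN.
have Nn : n \in N by rewrite defN cycle_id.
have fix1 : 'C_('O_l(A))[n] = 1.
  apply/eqP/negPn/negP => ntC.
  have lgC : l.-group 'C_('O_l(A))[n] by apply: pgroupS (subsetIl _ _) (pcore_pgroup l A).
  have ntKA : K :&: A != 1 by rewrite -cardG_gt1 card_capA cardG_gt1.
  have [_ dvKA _] := pgroup_pdiv lgKA ntKA; have [_ dvC _] := pgroup_pdiv lgC ntC.
  have [x /setIP[Kx Ax] ox] := Cauchy l_pr dvKA.
  have sxC : <[x]> \subset 'C_('O_l(A))[n].
    rewrite -(cardSg_cyclic (cycle_cyclic s1)) -?orderE ?ox ?cycle_subG //.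
    exact: subset_trans (subsetIl _ _) sOA.
  have cNx : x \in 'C_K(N).
    by apply/setIP; split=> //; move: sxC; rewrite defN cent_cycle cycle_subG => /setIP[].
  have : x \in A :&: B by rewrite inE Ax (subsetP cent_sub_B).
  by rewrite tiAB => /set1gP x1; move: (prime_gt1 l_pr); rewrite -ox x1 order1.
have := index_cent1 'O_l(A) n; rewrite fix1 indexg1 card_capA => ->.
rewrite -(card_rcoset R n); apply: subset_leq_card.
apply/subsetP=> _ /imsetP[a Oa ->]; rewrite mem_rcoset.
apply: (subsetP (commg_Gam_N cycR)).
have -> : n ^ a * n^-1 = [~ a, n^-1] by rewrite commgEr invgK.
by rewrite mem_commg ?groupV // (subsetP sAGam) // (subsetP sOA).
Qed.

Let invert_capB : {in K :&: B, forall b, b ^ s3 = b^-1}.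
Proof.
move=> b /setIP[Kb Bb].
have -> : b ^ s3 = b ^ (s2 * s3).
  by rewrite conjgM (@conjg_cent _ B b s2) // (subsetP abB) ?cycle_id.
have GV23 : s2 * s3 \in GV by rewrite groupM.
have nRx x : x \in Gam -> x \in 'N(R) by apply: (subsetP nRGam).
have Rbb : b ^ (s2 * s3) * b \in R.
  have /mulsgP[r a Rr /setIP[_ Aa] def_b] : b \in R * (K :&: A) by rewrite -mulRA.
  have -> : b ^ (s2 * s3) * b = r ^ (s2 * s3) * r ^ a.
    by rewrite def_b conjMg (invA Aa) [r ^ a]conjgE !mulgA.
  rewrite groupM // memJ_norm // nRx //; first exact: (subsetP sVGam).
  exact: (subsetP sAGam).
have Bbb : b ^ (s2 * s3) * b \in B.
  by rewrite -capGFGV; apply/setIP; rewrite (subsetP sRF) // groupM ?groupJ // (subsetP sBV).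
have : b ^ (s2 * s3) * b \in R :&: B by apply/setIP.
by rewrite tiRB => /set1gP bb1; apply: (mulIg b); rewrite mulVg.
Qed.

Let nRF := subset_trans sFGam nRGam.
Let nRB := subset_trans sBF nRF.
Let sOB : 'O_l(B) \subset B. Proof. exact: pcore_sub. Qed.
Let sKBO : K :&: B \subset 'O_l(B).
Proof. by apply: pcore_max; rewrite // -sub_abelian_normal ?subsetIr. Qed.
Let hall_pcore (C : {group gT}) : abelian C -> l.-Hall(C) 'O_l(C).
Proof. by move/abelian_nil; apply: nilpotent_pcore_Hall. Qed.

Let Sylow_quotientB : l.-Sylow(GF / R) ('O_l(B) / R).
Proof.
have nRO := subset_trans sOB nRB.
rewrite -(quotientMidl R 'O_l(B)) -norm_joinEr //; apply: quotient_pHall.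
  by rewrite join_subG normG nRO.
apply: (TI_mul_pHall defGF tiAB); first by rewrite join_subG sRF (subset_trans sOB).
have tiRO : R :&: 'O_l(B) = 1 by apply/trivgP; rewrite -tiRB setIS.
by rewrite /= norm_joinEr // (TI_cardMg tiRO) -card_capA -pcoreA !(card_Hall (hall_pcore _)).
Qed.

Let cent_ChR : Ch / R \subset 'C(GF / R).
Proof.
rewrite -defGF quotientMl ?(subset_trans sAF nRF) // centM subsetI; apply/andP; split; last first.
  by apply: quotient_cents; apply: subset_trans Ch_B abB.
apply: (@subset_trans _ _ ((K :&: A) / R)).
  by rewrite -(quotientMidl _ (K :&: A)) -mulRA quotientS.
by apply: quotient_cents; apply: subset_trans (subsetIr _ _) abA.
Qed.

(* Transfer in [GF / R]: the images of [A] and [B] agree, so the Hall subgroups of [A] and [B] have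
   the same image. *)
Let pcoreB : 'O_l(B) = K :&: B.
Proof.
have cycS : cyclic ('O_l(B) / R) by apply: quotient_cyclic; apply: cyclicS sOB (cycle_cyclic _).
have oChR : #|Ch / R| = l.
  have tiRCh : R :&: Ch = 1 by apply/trivgP; rewrite -tiRB setIS.
  by rewrite -(card_isog (quotient_isog _ tiRCh)) // (subset_trans Ch_B).
have sChO : Ch / R \subset 'O_l(B) / R.
  by apply: quotientS; apply: subset_trans sKBO; rewrite subsetI sChK.
have sylS := Sylow_quotientB; have [_ lgS _] := and3P sylS.
have [f [sfS fS]] := cyclic_Sylow_transfer_onto l_pr sylS cycS sChO oChR cent_ChR.
have lgf (X : {group coset_of R}) : X \subset GF / R -> l.-group (f @* X).
  by move=> sXF; apply: pgroupS (subset_trans (morphimS f sXF) sfS) lgS.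
have fAB : f @* (A / R) = f @* (B / R).
  have [GF1 GF2] : s1 \in GF /\ s2 \in GF by rewrite -!cycle_subG sAF sBF.
  rewrite !quotient_cycle ?(subsetP nRF) //; apply: morphim_cycle_mul_sq1.
  - exact/odd_lgroup/lgf.
  - exact: mem_quotient.
  - exact: mem_quotient.
  by rewrite -!morphM ?(subsetP nRF) // -morphX ?(subsetP nRF) ?groupM // mul12_sq1 morph1.
have fA : f @* ('O_l(A) / R) = f @* (A / R).
  apply: pHall_id (lgf _ (quotientS R sAF)).
  have sOA : 'O_l(A) \subset A by apply: pcore_sub.
  apply: morphim_pHall; first exact: quotientS (subset_trans sOA sAF).
  by apply: quotient_pHall (hall_pcore abA); rewrite (subset_trans sOA) ?(subset_trans sAF).
have tiRO : R :&: 'O_l(B) = 1 by apply/trivgP; rewrite -tiRB setIS.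
apply/eqP; rewrite eq_sym eqEcard sKBO (card_isog (quotient_isog (subset_trans sOB nRB) tiRO)).
rewrite -fS; apply: leq_trans (subset_leq_card (morphimS f (quotientS R sOB))) _.
rewrite -fAB -fA pcoreA quotient_capA.
exact: leq_trans (leq_morphim _ _) (leq_morphim _ _).
Qed.

Lemma no_prime_kernel : False.
Proof.
have sKBV : K :&: B \subset GV by rewrite subIset // sBV orbT.
have abKB : abelian (K :&: B) by apply: abelianS (subsetIr _ _) abB.
have c2 : s2 \in 'C(K :&: B).
  by rewrite (subsetP (centS (subsetIr K B))) // (subsetP abB) ?cycle_id.
have nKBV : GV \subset 'N(K :&: B).
  rewrite -defGV mul_subG ?cycle_subG ?(subsetP (cent_sub _) _ c2) //.
  by rewrite inE; apply/subsetP=> _ /imsetP[b KBb ->]; rewrite invert_capB ?groupV.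
have nsKB : K :&: B <| GV by rewrite /normal sKBV.
have hallKB : l.-Hall(B) (K :&: B) by rewrite -pcoreB; apply: hall_pcore.
have splitKB : [splits GV, over K :&: B].
  exact: TI_mul_Hall_splits defGV tiBD _ _ hallKB abKB nsKB (abelian_nil (cycle_abelian s3)).
have [H /complP[tiH defH] Hs3] :=
  inverting_complement nsKB abKB (odd_lgroup lgKB) splitKB GVs3 invert_capB.
case/negP: ntCh; rewrite -subG1.
rewrite -(chirality_TI_complement defH tiH abKB nKBV GVs2 c2 Hs3 invert_capB).
by rewrite subsetI subxx subsetI sChK Ch_B.
Qed.

End PrimeKernel.

Theorem chirality_sub_kernel (N : {group gT}) :
  N \subset B -> N <| GV -> N :!=: 1 -> Ch \subset N.
Proof.
move=> sNB nsN ntN; apply/negPn/negP => not_ChN.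
have N_gt1 : 1 < #|N| by rewrite cardG_gt1.
have [s s_pr /(Cauchy s_pr)[y Ny oy]] := pdivP N_gt1.
have sYN : <[y]> \subset N by rewrite cycle_subG.
apply: (@no_prime_kernel <[y]> s) => //.
- exact: subset_trans sYN sNB.
- apply: char_normal_trans nsN.
  by rewrite sub_cyclic_char // (cyclicS sNB) ?cycle_cyclic.
by apply: contra not_ChN => /subset_trans; apply.
Qed.

End TightFactorisation.

(** * Flags and words *)

Section Chains.

Variables (T : finType) (le : rel T).
Implicit Types (x y z : T) (A B C P Q : {set T}).

Lemma chainP C : reflect {in C &, forall x y, le x y || le y x} (chain le C).
Proof.
apply: (iffP forall_inP) => [chC x y Cx Cy | chC x Cx].
  by have /forall_inP := chC x Cx; apply.
by apply/forall_inP => y Cy; apply: chC.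
Qed.

Lemma chainS C C' : C' \subset C -> chain le C -> chain le C'.
Proof. by move=> /subsetP sC /chainP chC; apply/chainP => x y /sC Cx /sC Cy; apply: chC. Qed.

Lemma chainU C C' : chain le C -> chain le C' ->
  {in C & C', forall x y, le x y || le y x} -> chain le (C :|: C').
Proof.
move=> /chainP chC /chainP chC' cmp; apply/chainP => x y /setUP[Cx|Cx] /setUP[Cy|Cy].
- exact: chC.
- exact: cmp.
- by rewrite orbC cmp.
exact: chC'.
Qed.

Lemma chain1 x : le x x -> chain le [set x].
Proof. by move=> xx; apply/chainP => _ _ /set1P-> /set1P->; rewrite xx. Qed.

Lemma flag_chain P : flag le P -> chain le P.
Proof. by case/andP. Qed.

Lemma chain_flag C : chain le C -> exists2 P, flag le P & C \subset P.
Proof.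
move=> chC; have [P /maxsetP[chP maxP] sCP] := maxset_exists chC.
exists P => //; rewrite /flag chP; apply/forall_inP => x xP.
apply/negP => /maxP/(_ (subsetUr _ _)) eP.
by move: xP; rewrite -eP !inE eqxx.
Qed.

Lemma flag_max P x : flag le P -> {in P, forall y, le x y || le y x} -> le x x -> x \in P.
Proof.
case/andP=> chP /forall_inP maxP cmp xx; apply: contraT => /maxP /negP[].
by apply: chainU (chain1 xx) chP _ => _ y /set1P-> /cmp.
Qed.

Variable n : nat.
Hypothesis poset_le : partial_order le.
Hypothesis card_flag : forall P, flag le P -> #|P| = n.+2.

Let lexx : reflexive le. Proof. by case: poset_le. Qed.
Let le_anti : antisymmetric le. Proof. by case: poset_le. Qed.
Let le_trans : transitive le. Proof. by case: poset_le. Qed.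

Lemma card_chain C : chain le C -> #|C| <= n.+2.
Proof. by case/chain_flag=> P fP sCP; rewrite -(card_flag fP) subset_leq_card. Qed.

Lemma flag_sub P Q : flag le P -> flag le Q -> P \subset Q -> P = Q.
Proof. by move=> fP fQ sPQ; apply/eqP; rewrite eqEcard sPQ !card_flag /=. Qed.

Lemma chain_card_flag C : chain le C -> #|C| = n.+2 -> flag le C.
Proof.
case/chain_flag=> P fP sCP oC; suff -> : C = P by [].
by apply/eqP; rewrite eqEcard sCP (card_flag fP) oC /=.
Qed.

Lemma rk_flag P x : flag le P -> x \in P -> rk le x = #|[set y in P | le y x]|.
Proof.
move=> fP Px; have /chainP chP := flag_chain fP.
set D := [set y in P | le y x]; apply/eqP; rewrite eqn_leq; apply/andP; split.
  apply/bigmax_leqP => C /andP[chC /subsetP sC].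
  have le_x y : y \in C -> le y x by move/sC; rewrite inE.
  have ge_x y : y \in P :\: D -> ~~ le y x /\ le x y.
    rewrite !inE => /andP[+ Py]; rewrite Py => /= nyx; split=> //.
    by have := chP _ _ Px Py; rewrite (negbTE nyx) orbF.
  have tiU : C :&: (P :\: D) = set0.
    by apply/setP=> y; rewrite !inE; case Cy: (y \in C); rewrite //= le_x // andbT andNb.
  have chU : chain le (C :|: (P :\: D)).
    apply: chainU chC (chainS (subsetDl P D) (flag_chain fP)) _ => y z Cy /ge_x[_ xz].
    by rewrite (le_trans (le_x _ Cy) xz).
  have := card_chain chU; rewrite cardsU tiU cards0 subn0 -(card_flag fP).
  rewrite -(cardsID D P) (_ : P :&: D = D) ?leq_add2r //.
  by apply/setIidPr/subsetP => y; rewrite inE => /andP[].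
have sDP : D \subset P by apply/subsetP => y; rewrite inE => /andP[].
apply: (@leq_bigmax_cond _ _ (fun C : {set T} => #|C|) D).
rewrite (chainS sDP (flag_chain fP)).
by apply/subsetP => y; rewrite !inE => /andP[].
Qed.

Lemma flag3 x y z : le x y -> le y z -> exists P, [/\ flag le P, x \in P, y \in P & z \in P].
Proof.
move=> xy yz; have xz := le_trans xy yz.
have ch3 : chain le [set x; y; z].
  apply: chainU (chain1 (lexx z)) _ => [|u _ + /set1P->].
    apply: chainU (chain1 (lexx x)) (chain1 (lexx y)) _ => _ _ /set1P-> /set1P->.
    by rewrite xy.
  by case/set2P=> ->; rewrite (xz, yz).
have [P fP /subsetP sP] := chain_flag ch3.
by exists P; rewrite !sP ?inE ?eqxx ?orbT.
Qed.

Lemma flag2 x y : le x y -> exists P, [/\ flag le P, x \in P & y \in P].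
Proof. by move=> xy; have [P [fP Px Py _]] := flag3 xy (lexx y); exists P. Qed.

Lemma flag1 x : exists2 P, flag le P & x \in P.
Proof. by have [P [fP Px _]] := flag2 (lexx x); exists P. Qed.

Lemma le_rk x y : le x y -> rk le x <= rk le y.
Proof.
move=> xy; have [P [fP Px Py]] := flag2 xy; rewrite !(rk_flag fP) //.
by apply/subset_leq_card/subsetP => z; rewrite !inE => /andP[-> /le_trans->].
Qed.

Lemma ltp_rk x y : ltp le x y -> rk le x < rk le y.
Proof.
case/andP=> nxy xy; have [P [fP Px Py]] := flag2 xy; rewrite !(rk_flag fP) //.
apply/proper_card/properP; split.
  by apply/subsetP => z; rewrite !inE => /andP[-> /le_trans->].
exists y; rewrite !inE Py ?lexx //=; apply: contra nxy => yx.
by apply/eqP/le_anti; rewrite xy.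
Qed.

Lemma le_rk_eq x y : le x y -> rk le x = rk le y -> x = y.
Proof.
move=> xy eq_rk; apply/eqP/negPn/negP => nxy.
by have := @ltp_rk x y; rewrite /ltp nxy xy eq_rk ltnn => /(_ isT).
Qed.

Lemma flag_le P x y : flag le P -> x \in P -> y \in P -> le x y = (rk le x <= rk le y).
Proof.
move=> fP Px Py; apply/idP/idP => [|rxy]; first exact: le_rk.
have /chainP chP := flag_chain fP; case/orP: (chP _ _ Px Py) => // yx.
suff -> : y = x by rewrite lexx.
by apply: le_rk_eq => //; apply/eqP; rewrite eqn_leq le_rk.
Qed.

Lemma flag_ltp P x y : flag le P -> x \in P -> y \in P -> ltp le x y = (rk le x < rk le y).
Proof.
move=> fP Px Py; apply/idP/idP => [|rxy]; first exact: ltp_rk.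
rewrite /ltp (flag_le fP) // (ltnW rxy) andbT.
by apply: contraTneq rxy => ->; rewrite ltnn.
Qed.

Lemma flag_inj P x y : flag le P -> x \in P -> y \in P -> rk le x = rk le y -> x = y.
Proof. by move=> fP Px Py eq_rk; apply: le_rk_eq => //; rewrite (flag_le fP) // eq_rk. Qed.

Lemma rk_gt0 x : 0 < rk le x.
Proof.
have [P fP Px] := flag1 x; rewrite (rk_flag fP) // card_gt0; apply/set0Pn.
by exists x; rewrite inE Px lexx.
Qed.

Lemma rk_max x : rk le x <= n.+2.
Proof.
have [P fP Px] := flag1 x; rewrite (rk_flag fP) // -(card_flag fP).
by apply/subset_leq_card/subsetP => y; rewrite inE => /andP[].
Qed.

Lemma flag_face P i : flag le P -> 0 < i <= n.+2 -> exists2 x, x \in P & rk le x = i.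
Proof.
move=> fP /andP[i0 iN]; pose f x : 'I_n.+3 := inord (rk le x).
have val_f x : f x = rk le x :> nat by rewrite inordK // ltnS rk_max.
have of_f : #|f @: P| = n.+2.
  rewrite card_in_imset ?card_flag // => x y Px Py /(congr1 val) /=; rewrite !val_f.
  exact: flag_inj fP Px Py.
have im_f : f @: P = [set~ ord0].
  apply/eqP; rewrite eqEcard of_f cardsC1 card_ord leqnn andbT.
  apply/subsetP => _ /imsetP[x _ ->]; rewrite !inE -val_eqE /= val_f.
  by rewrite -lt0n rk_gt0.
have : (Ordinal (iN : i < n.+3)) \in f @: P by rewrite im_f !inE -val_eqE /= -lt0n.
by case/imsetP=> x Px /(congr1 val) /= def_i; exists x => //; rewrite -val_f -def_i.
Qed.

Lemma flag_rk P x : flag le P -> exists2 y, y \in P & rk le y = rk le x.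
Proof. by move=> fP; apply: flag_face; rewrite ?rk_gt0 ?rk_max. Qed.

Lemma card_interval P x y : flag le P -> x \in P -> y \in P -> le x y ->
  #|[set z in P | le x z && le z y]| + rk le x = (rk le y).+1.
Proof.
move=> fP Px Py xy; rewrite (rk_flag fP Px) (rk_flag fP Py).
have /chainP chP := flag_chain fP.
rewrite -(cardsID [set z | le x z] [set z in P | le z y]) -addnS; congr (_ + _).
  by apply: eq_card => z; rewrite !inE; case: (z \in P); rewrite //= andbC.
rewrite (cardsD1 x) !inE Px lexx add1n; congr _.+1; apply: eq_card => z.
rewrite !inE; case Pz: (z \in P); rewrite ?andbF //=.
apply/andP/andP => [[nzx zx]|[nxz zy]].
  split; last exact: le_trans xy.
  by apply: contra nzx => xz; apply/eqP/le_anti; rewrite zx.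
have := chP _ _ Px Pz; rewrite (negbTE nxz) /= => ->; split=> //.
by apply: contra nxz => /eqP->; apply: lexx.
Qed.

Lemma chain_splice P C a c : flag le P -> chain le C ->
  {in C, forall x, le a x && le x c} -> chain le (C :|: [set y in P | le y a || le c y]).
Proof.
move=> fP chC bC; apply: chainU chC _ _.
  by apply: chainS (flag_chain fP); apply/subsetP => y; rewrite inE => /andP[].
move=> x y /bC/andP[ax xc]; rewrite inE => /andP[_ /orP[ya|cy]].
  by rewrite (le_trans ya ax) orbT.
by rewrite (le_trans xc cy).
Qed.

Definition agree i A B := {in A, forall x, rk le x <> i -> x \in B}.

Lemma agree_sym i A B : flag le A -> flag le B -> agree i A B -> agree i B A.
Proof.
move=> fA fB agAB y By ni; have [x Ax eq_rk] := flag_rk y fA.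
suff <- : x = y by [].
by apply: (flag_inj fB) => //; apply: agAB; rewrite // eq_rk.
Qed.

Lemma agree_face i A B x : flag le A -> flag le B -> agree i A B ->
  x \in A -> x \in B -> rk le x = i -> A = B.
Proof.
move=> fA fB agAB Ax Bx rx; apply: flag_sub => //; apply/subsetP => z Az.
have [rz|nz] := eqVneq (rk le z) i; last by apply: agAB => //; apply/eqP.
by rewrite (flag_inj fA Az Ax) ?rz ?rx.
Qed.

End Chains.

(* Letters are the values of [rk] at proper faces: the letter of vertices is 2. *)
Definition letter (n i : nat) : bool := 1 < i < n.+2.

Lemma letter3 i : letter 3 i = (i \in [:: 2; 3; 4]).
Proof. by rewrite /letter !inE; lia. Qed.

Lemma letter4 i : letter 4 i = (i \in [:: 2; 3; 4; 5]).
Proof. by rewrite /letter !inE; lia. Qed.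

Section PolytopeBasics.

Variables (T : finType) (le : rel T) (n : nat).
Hypothesis polyP : polytope le n.
Implicit Types (x y z : T) (A B C P Q : {set T}) (w : seq nat).
Local Notation letter := (letter n).

Lemma polytope_poset : partial_order le. Proof. by case: polyP => -[]. Qed.
Lemma polytope_card_flag P : flag le P -> #|P| = n.+2.
Proof. by case: polyP => _ _ + _ _; apply. Qed.
Let po := polytope_poset.
Let fs := polytope_card_flag.
Let lexx : reflexive le. Proof. by case: po. Qed.
Let le_trans : transitive le. Proof. by case: po. Qed.

Lemma improper_flag P x : flag le P -> ~~ letter (rk le x) -> x \in P.
Proof.
move=> fP; rewrite /letter => nl.
have [[_ [b hb]] [t ht] _ _ _] := polyP.
have [Pb Pt] : b \in P /\ t \in P.
  by split; apply: (flag_max fP) => // y _; rewrite ?hb ?ht ?orbT.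
have [rx|nx] := eqVneq (rk le x) 1%N.
  rewrite -(@le_rk_eq _ _ _ po fs b x) //; apply/eqP.
  by rewrite eqn_leq (le_rk po fs) //= rx (rk_gt0 po fs).
rewrite (@le_rk_eq _ _ _ po fs x t) //; apply/eqP; rewrite eqn_leq (le_rk po fs) //=.
have := rk_gt0 po fs x; have := rk_max po fs t; lia.
Qed.

Lemma least_face b x : rk le b = 1%N -> le b x.
Proof.
move=> rb; have [B fB Bx] := flag1 po x.
have Bb : b \in B by apply: improper_flag; rewrite ?rb.
by rewrite (flag_le po fs fB) // rb (rk_gt0 po fs).
Qed.

Lemma greatest_face c x : rk le c = n.+2 -> le x c.
Proof.
move=> rc; have [B fB Bx] := flag1 po x.
have Bc : c \in B by apply: improper_flag; rewrite ?rc /letter ?ltnn ?andbF.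
by rewrite (flag_le po fs fB) // rc (rk_max po fs).
Qed.

Lemma agree_letter i A B : flag le A -> flag le B -> agree le i A B -> A <> B -> letter i.
Proof.
move=> fA fB agAB nAB; apply: contraT => nl; case: nAB; apply: (flag_sub fs) => //.
apply/subsetP => x Ax; have [rx|/eqP] := eqVneq (rk le x) i; last exact: agAB.
by apply: improper_flag; rewrite // rx.
Qed.

Lemma diamond_unique F G x y y' : rk le G = (rk le F).+2 -> ltp le F G ->
  ltp le F x && ltp le x G -> ltp le F y && ltp le y G -> ltp le F y' && ltp le y' G ->
  y <> x -> y' <> x -> y = y'.
Proof.
move=> rG FG hx hy hy' /eqP nyx /eqP ny'x; apply/eqP/negPn/negP => nyy'.
have [_ _ _ dia _] := polyP; have o2 := dia F G FG rG.
have o3 : #|x |: [set y; y']| = 3.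
  by rewrite cardsU1 cards2 nyy' !inE !(eq_sym x) negb_or nyx ny'x.
have : x |: [set y; y'] \subset [set H | ltp le F H && ltp le H G].
  by apply/subsetP => z; rewrite !inE => /orP[/eqP->|/orP[]/eqP->].
by move/subset_leq_card; rewrite o2 o3.
Qed.

Lemma letter_face i A : flag le A -> letter i -> exists2 x, x \in A & rk le x = i.
Proof. by move=> fA li; apply: (flag_face po fs fA); move: li; rewrite /letter; lia. Qed.

Lemma letter_between E F : rk le F = (rk le E).+2 -> letter (rk le E).+1.
Proof. by move=> rF; have := rk_gt0 po fs E; have := rk_max po fs F; rewrite /letter; lia. Qed.

Lemma letter_faces i A : flag le A -> letter i -> exists F G,
  [/\ F \in A, G \in A, (rk le F).+1 = i & rk le G = i.+1].
Proof.
rewrite /letter => fA li.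
have [|F AF rF] := @flag_face _ _ _ po fs A i.-1 fA; first by lia.
have [|G AG rG] := @flag_face _ _ _ po fs A i.+1 fA; first by lia.
by exists F, G; rewrite rF prednK //; case/andP: li => /ltnW.
Qed.

Lemma agree_diamond i A B F G x y : flag le A -> flag le B -> agree le i A B ->
  F \in A -> G \in A -> x \in A -> y \in B ->
  (rk le F).+1 = i -> rk le G = i.+1 -> rk le x = i -> rk le y = i ->
  [/\ ltp le F G, rk le G = (rk le F).+2, ltp le F x && ltp le x G
    & ltp le F y && ltp le y G].
Proof.
move=> fA fB agAB AF AG Ax By rF rG rx ry.
have BF : F \in B by apply: agAB => //; rewrite -rF; apply: n_Sn.
have BG : G \in B by apply: agAB => //; rewrite rG; apply/nesym/n_Sn.
rewrite (flag_ltp po fs fA AF AG) (flag_ltp po fs fA AF Ax) (flag_ltp po fs fA Ax AG).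
by rewrite (flag_ltp po fs fB BF By) (flag_ltp po fs fB By BG) rG rx ry -rF !ltnS !leqnn leqnSn.
Qed.

Definition swap i A := odflt A [pick Q | [&& flag le Q,
  [forall x in A, (rk le x != i) ==> (x \in Q)] & Q != A]].

Lemma swapP i A : flag le A -> flag le (swap i A) /\ agree le i A (swap i A).
Proof.
move=> fA; rewrite /swap; case: pickP => /= [Q /and3P[fQ /forall_inP agQ _] | _]; last by split.
by split=> // x Ax /eqP nx; have /implyP := agQ x Ax; apply.
Qed.

Lemma flag_swap i A : flag le A -> flag le (swap i A).
Proof. by case/(swapP i). Qed.

Lemma swap_agree i A : flag le A -> agree le i A (swap i A).
Proof. by case/(swapP i). Qed.

Lemma swap_agree_sym i A : flag le A -> agree le i (swap i A) A.
Proof. by move=> fA; apply: (agree_sym po fs); rewrite ?flag_swap //; apply: swap_agree. Qed.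

Lemma swap_unique i A Q : flag le A -> flag le Q -> agree le i A Q -> Q <> A -> Q = swap i A.
Proof.
move=> fA fQ agQ nQA.
have li : letter i by apply: (agree_letter fA fQ agQ) => eAQ; apply: nQA.
have nS : swap i A <> A.
  rewrite /swap; case: pickP => /= [Q' /and3P[_ _ /eqP] // | /(_ Q)/negP[]].
  apply/and3P; split=> //; last exact/eqP.
  by apply/forall_inP => x Ax; apply/implyP => /eqP; apply: agQ.
have fS := flag_swap i fA; have agS := @swap_agree i A fA.
have [F [G [AF AG rF rG]]] := letter_faces fA li.
have [x Ax rx] := letter_face fA li; have [y Qy ry] := letter_face fQ li.
have [z Sz rz] := letter_face fS li.
have [FG rFG hx hy] := agree_diamond fA fQ agQ AF AG Ax Qy rF rG rx ry.
have [_ _ _ hz] := agree_diamond fA fS agS AF AG Ax Sz rF rG rx rz.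
have def_y : y = z.
  apply: (diamond_unique rFG FG hx hy hz) => [y_x|z_x].
    by apply/nQA/esym/(agree_face po fs fA fQ agQ Ax); rewrite -?y_x.
  by apply/nS/esym/(agree_face po fs fA fS agS Ax); rewrite -?z_x.
have agQS : agree le i Q (swap i A).
  by move=> u Qu nu; apply: agS => //; apply: (agree_sym po fs fA fQ agQ).
by apply: (agree_face po fs fQ fS agQS Qy); rewrite // def_y.
Qed.

Lemma swap_neq i A : flag le A -> letter i -> swap i A <> A.
Proof.
move=> fA li; have [F [G [AF AG rF rG]]] := letter_faces fA li.
have [x Ax rx] := letter_face fA li.
have [|FG rFG hx _] := agree_diamond fA fA _ AF AG Ax Ax rF rG rx rx; first by [].
have [_ _ _ dia _] := polyP; have := dia F G FG rFG.
rewrite (cardsD1 x) inE hx add1n => -[] /eqP/cards1P[y def_y].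
have : y \in [set H | ltp le F H && ltp le H G] :\ x by rewrite def_y set11.
rewrite !inE => /and3P[nyx Fy yG].
have nAy : y \notin A.
  apply: contra nyx => Ay; apply/eqP; apply: (flag_inj po fs fA) => //.
  by rewrite rx; apply/eqP; rewrite eqn_leq -ltnS -rG -rF !(ltp_rk po fs).
have bFG : {in [set y], forall u, le F u && le u G}.
  by move=> _ /set1P->; case/andP: Fy => _ ->; case/andP: yG.
have [B fB /subsetP sB] := chain_flag (chain_splice po fA (chain1 (lexx y)) bFG).
have agB : agree le i A B.
  move=> z Az /eqP nz; apply: sB; rewrite !inE Az !(flag_le po fs fA) // rG.
  by rewrite -ltnS rF -neq_ltn nz orbT.
have nBA : B <> A by move=> eBA; case/negP: nAy; rewrite -eBA sB // !inE eqxx.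
by rewrite -(swap_unique fA fB agB nBA).
Qed.

Lemma swap_id i A : flag le A -> ~~ letter i -> swap i A = A.
Proof.
move=> fA nl; apply/eqP/negPn/negP => /eqP nS.
case/negP: nl; apply: (agree_letter fA (flag_swap i fA) (@swap_agree i A fA)).
by move=> eAS; apply: nS.
Qed.

Lemma swapK i A : flag le A -> swap i (swap i A) = A.
Proof.
move=> fA; have [li|nl] := boolP (letter i); last by rewrite !swap_id.
by apply/esym; apply: swap_unique; rewrite ?flag_swap //;
  [apply: swap_agree_sym | apply/nesym/swap_neq].
Qed.

Lemma swap_face_neq i A x y : flag le A -> letter i -> x \in A -> y \in swap i A ->
  rk le y = i -> y <> x.
Proof.
move=> fA li Ax Sy ry y_x; apply: (swap_neq fA li); apply/esym.
by apply: (agree_face po fs fA (flag_swap i fA) (@swap_agree i A fA) Ax); rewrite -?y_x.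
Qed.

(* The new face of rank [i] depends only on the faces of ranks [i - 1], [i] and [i + 1]. *)
Lemma swap_local i A B y y' : flag le A -> flag le B -> letter i ->
  (forall u, u \in A -> i <= (rk le u).+1 <= i.+2 -> u \in B) ->
  y \in swap i A -> y' \in swap i B -> rk le y = i -> rk le y' = i -> y = y'.
Proof.
move=> fA fB li AB Sy Sy' ry ry'.
have [F [G [AF AG rF rG]]] := letter_faces fA li.
have [x Ax rx] := letter_face fA li.
have BF : F \in B by apply: AB; rewrite // rF leqnn !leqW.
have BG : G \in B by apply: AB; rewrite // rG leqnn andbT !leqW.
have Bx : x \in B by apply: AB; rewrite // rx !leqnSn.
have [FG rFG hx hy] :=
  agree_diamond fA (flag_swap i fA) (@swap_agree i A fA) AF AG Ax Sy rF rG rx ry.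
have [_ _ _ hy'] :=
  agree_diamond fB (flag_swap i fB) (@swap_agree i B fB) BF BG Bx Sy' rF rG rx ry'.
by apply: (diamond_unique rFG FG hx hy hy');
  [apply: (swap_face_neq fA li Ax Sy) | apply: (swap_face_neq fB li Bx Sy')].
Qed.

Lemma swapC i j A : flag le A -> i.+1 < j -> swap i (swap j A) = swap j (swap i A).
Proof.
move=> fA ij; have [li|nl] := boolP (letter i); last by rewrite !(@swap_id i) ?flag_swap.
have [lj|nl] := boolP (letter j); last by rewrite !(@swap_id j) ?flag_swap.
have [fi fj] := (flag_swap i fA, flag_swap j fA).
have fij := flag_swap j fi.
apply/esym; apply: swap_unique => //.
  move=> z Cz nz; have [rz|nj] := eqVneq (rk le z) j; last first.
    have Az : z \in A by apply: (@swap_agree_sym j A fA z Cz); apply/eqP.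
    by apply: (swap_agree fi); [apply: (swap_agree fA) | apply/eqP].
  have [y Qy ry] := letter_face fij lj.
  suff -> : z = y by [].
  apply: (@swap_local j A (swap i A) z y) => // u Au ru.
  by apply: swap_agree => // ri; rewrite ri leqNgt ij in ru.
have nij : i <> j by move=> eq_ij; rewrite eq_ij ltnNge leqnSn in ij.
move=> eS; have [x Ax rx] := letter_face fA li; have [y Sy ry] := letter_face fi li.
have Cx : x \in swap j A by apply: swap_agree; rewrite // rx.
have Qy : y \in swap j (swap i A) by apply: swap_agree; rewrite // ry.
apply: (swap_face_neq fA li Ax Sy ry).
by apply: (flag_inj po fs fj); rewrite ?rx ?ry // -eS.
Qed.

Definition run A w := foldl (fun B i => swap i B) A w.

Lemma run_cat A w w' : run A (w ++ w') = run (run A w) w'.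
Proof. exact: foldl_cat. Qed.

Lemma flag_run A w : flag le A -> flag le (run A w).
Proof. by elim: w A => //= i w IH A fA; apply/IH/flag_swap. Qed.

Lemma run_keep A w x : flag le A -> x \in A -> rk le x \notin w -> x \in run A w.
Proof.
elim: w A => //= i w IH A fA Ax; rewrite inE negb_or => /andP[/eqP ni nw].
by apply: IH; rewrite ?flag_swap //; apply: swap_agree.
Qed.

Lemma run_rev A w : flag le A -> run (run A w) (rev w) = A.
Proof.
elim: w A => //= i w IH A fA; rewrite rev_cons -cats1 run_cat IH ?flag_swap //=.
exact: swapK.
Qed.

Lemma run_far_square i j A : flag le A -> i.+1 < j -> run A [:: j; i; j; i] = A.
Proof. by move=> fA ij /=; rewrite (swapC _ ij) ?flag_swap // !swapK ?flag_swap. Qed.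

Lemma run2_neq A i j : flag le A -> letter i -> letter j -> i <> j -> run A [:: j; i] <> A.
Proof.
move=> fA li lj nij /= eqA; have [x Ax rx] := letter_face fA lj.
have eqS : swap j A = swap i A by rewrite -{2}eqA swapK ?flag_swap.
apply: (swap_face_neq fA lj Ax (y := x)) => //.
by rewrite eqS; apply: (swap_agree fA) => //; rewrite rx; apply/nesym.
Qed.

Lemma adjacent_swap A Q : flag le A -> flag le Q -> adjacent A Q ->
  exists2 i, letter i & Q = swap i A.
Proof.
move=> fA fQ /cards1P[x def_x].
have Ax : x \in A :\: Q by rewrite def_x set11.
have nQA : Q <> A by move=> eQA; move: Ax; rewrite eQA setDv inE.
have agQ : agree le (rk le x) A Q.
  move=> z Az nz; apply: contra_notT nz => nQz.
  by have : z \in A :\: Q by [rewrite inE nQz]; rewrite def_x => /set1P->.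
exists (rk le x); first by apply: (agree_letter fA fQ agQ) => eAQ; apply: nQA.
exact: swap_unique.
Qed.

Lemma swap_adjacent i A : flag le A -> letter i -> adjacent A (swap i A).
Proof.
move=> fA li; have [x Ax rx] := letter_face fA li; apply/cards1P; exists x.
apply/setP => z; rewrite !inE; apply/andP/eqP => [[nz Az] | ->].
  apply: (flag_inj po fs fA) => //; rewrite rx; apply/eqP.
  by apply: contraR nz => /eqP; apply: swap_agree.
split=> //; apply/negP => Sx.
exact: (swap_face_neq fA li Ax Sx).
Qed.

Lemma run_connect A B : flag le A -> flag le B -> exists w,
  [/\ all letter w, run A w = B & forall i x, i \in w -> x \in A -> x \in B -> rk le x <> i].
Proof.
move=> fA fB; have [_ _ _ _ con] := polyP; have [s [ps lst als]] := con A B fA fB.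
suff [w [lw rw avoid]] : exists w, [/\ all letter w, run A w = last A s
    & forall i x, i \in w -> x \in A :&: B -> rk le x <> i].
  exists w; split=> // [|i x iw Ax Bx]; first by rewrite rw.
  by apply: (avoid i); rewrite // inE Ax.
move: (A :&: B) (subsetIl A B) als => I; clear lst B fB.
elim: s A fA ps => [|Q s IH] A fA /=; first by exists [::].
case/andP=> adjAQ ps sIA /andP[/andP[fQ sIQ] als].
have [i li defQ] := adjacent_swap fA fQ adjAQ.
have [w [lw rw avoid]] := IH Q fQ ps sIQ als.
exists (i :: w); rewrite /= li lw -defQ; split=> // j x.
rewrite inE => /orP[/eqP->|jw] Ix; last exact: avoid.
move=> rx; apply: (@swap_face_neq i A x x) => //; first exact: (subsetP sIA).
by rewrite -defQ (subsetP sIQ).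
Qed.

(* The image of a run under [F] is a chain of adjacent flags through [I], as required by strong
   flag-connectedness. *)
Lemma run_path (T' : finType) (F : {set T} -> {set T'}) (I A : {set T}) w :
  flag le A -> I \subset A -> all letter w ->
  (forall i x, i \in w -> x \in I -> rk le x <> i) ->
  (forall B i, flag le B -> I \subset B -> i \in w -> letter i ->
     adjacent (F B) (F (swap i B))) ->
  exists s, [/\ path (@adjacent T') (F A) s, last (F A) s = F (run A w)
    & forall L, L \in s -> exists B, [/\ flag le B, I \subset B & L = F B]].
Proof.
elim: w A => [|i w IH] A fA sIA /=; first by exists [::].
case/andP=> li lw avoid adj; have fS := flag_swap i fA.
have sIS : I \subset swap i A.
  apply/subsetP => x Ix; apply: (swap_agree fA); first exact: (subsetP sIA).
  by apply: avoid; rewrite ?inE ?eqxx.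
have [||s [ps ls sL]] := IH _ fS sIS lw.
- by move=> j x jw; apply: avoid; rewrite inE jw orbT.
- by move=> B j fB sB jw lj; apply: adj; rewrite // inE jw orbT.
exists (F (swap i A) :: s); split=> //=; first by rewrite ps adj // inE eqxx.
by move=> L; rewrite inE => /orP[/eqP->|/sL //]; exists (swap i A).
Qed.

End PolytopeBasics.

(** * Flag maps and automorphisms *)

Definition flag_map (T1 T2 : finType) (le1 : rel T1) (le2 : rel T2) (n : nat)
    (h : T1 -> T2) : Prop :=
  [/\ forall x, rk le2 (h x) = rk le1 x,
      forall A, flag le1 A -> flag le2 (h @: A) &
      forall A i, flag le1 A -> letter n i -> h @: swap le1 i A = swap le2 i (h @: A)].

Section FlagMaps.

Variables (T1 T2 : finType) (le1 : rel T1) (le2 : rel T2) (n : nat).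
Hypotheses (polyP1 : polytope le1 n) (polyP2 : polytope le2 n).
Let po1 := polytope_poset polyP1.
Let po2 := polytope_poset polyP2.
Let fs1 := polytope_card_flag polyP1.
Let fs2 := polytope_card_flag polyP2.

Lemma flag_map_intro (h : T1 -> T2) :
  (forall x, rk le2 (h x) = rk le1 x) -> (forall x y, le1 x y -> le2 (h x) (h y)) ->
  (forall A i, flag le1 A -> letter n i -> h @: swap le1 i A <> h @: A) ->
  flag_map le1 le2 n h.
Proof.
move=> rk_h mono_h neq_h.
have fh A : flag le1 A -> flag le2 (h @: A).
  move=> fA; apply: (chain_card_flag fs2).
    apply/chainP => _ _ /imsetP[x Ax ->] /imsetP[y Ay ->].
    by have /chainP/(_ x y Ax Ay)/orP[/mono_h->|/mono_h->] := flag_chain fA; rewrite ?orbT.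
  rewrite card_in_imset ?fs1 // => x y Ax Ay eq_h.
  by apply: (flag_inj po1 fs1 fA) => //; rewrite -!rk_h eq_h.
split=> // A i fA li; apply: (swap_unique polyP2); rewrite ?fh ?flag_swap //; last exact: neq_h.
by move=> _ /imsetP[x Ax ->]; rewrite rk_h => nx; apply/imset_f/swap_agree.
Qed.

Lemma covering_flag_map h : covering le1 le2 h -> flag_map le1 le2 n h.
Proof.
case=> _ rk_h mono_h adj; apply: flag_map_intro => // A i fA li eqS.
have := adj _ _ fA (flag_swap i fA) (swap_adjacent polyP1 fA li).
by rewrite eqS /adjacent setDv cards0.
Qed.

Lemma flag_map_run h A w : flag_map le1 le2 n h -> flag le1 A -> all (letter n) w ->
  h @: run le1 A w = run le2 (h @: A) w.
Proof.
case=> _ _ hS; elim: w A => //= i w IH A fA /andP[li lw].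
by rewrite IH ?flag_swap // hS.
Qed.

Lemma flag_map_face h A x y : flag_map le1 le2 n h -> flag le1 A -> x \in A ->
  y \in h @: A -> rk le2 y = rk le1 x -> h x = y.
Proof.
move=> [rk_h fh _] fA Ax Hy eq_rk.
by apply: (flag_inj po2 fs2 (fh _ fA)); rewrite ?imset_f // rk_h.
Qed.

Lemma flag_map_eq h1 h2 A : flag_map le1 le2 n h1 -> flag_map le1 le2 n h2 ->
  flag le1 A -> h1 @: A = h2 @: A -> h1 =1 h2.
Proof.
move=> m1 m2 fA eqA x; have [B fB Bx] := flag1 po1 x.
have [w [lw rw _]] := run_connect polyP1 fA fB.
apply: (flag_map_face m1 fB Bx); last by case: m2 => ->.
by rewrite -rw (flag_map_run m1) // eqA -(flag_map_run m2) // rw imset_f.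
Qed.

End FlagMaps.

Lemma flag_map_comp (T1 T2 T3 : finType) (le1 : rel T1) (le2 : rel T2) (le3 : rel T3) n f g :
  flag_map le1 le2 n f -> flag_map le2 le3 n g -> flag_map le1 le3 n (g \o f).
Proof.
move=> [rkf ff Sf] [rkg fg Sg]; split=> [x|A fA|A i fA li]; first by rewrite /= rkg rkf.
  by rewrite (imset_comp g f); apply/fg/ff.
by rewrite !(imset_comp g f) Sf // Sg //; apply: ff.
Qed.

Section PermImages.

Variable T : finType.
Implicit Types (f g : {perm T}) (A B : {set T}).

Lemma perm_imsetM f g A : (f * g) @: A = g @: (f @: A).
Proof. by rewrite -imset_comp; apply: eq_imset => x; rewrite permM. Qed.

Lemma perm_imset1 A : (1 : {perm T}) @: A = A.
Proof. by rewrite -[RHS]imset_id; apply: eq_imset => x; rewrite perm1. Qed.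

Lemma perm_imsetV f A B : f @: A = B -> f^-1 @: B = A.
Proof. by move=> <-; rewrite -perm_imsetM mulgV perm_imset1. Qed.

End PermImages.

Section AutomorphismGroup.

Variables (T : finType) (le : rel T).

Definition autg : {set {perm T}} :=
  [set f : {perm T} | [forall x, forall y, le (f x) (f y) == le x y]].

Lemma autgP f : reflect (is_aut le f) (f \in autg).
Proof.
rewrite inE; apply: (iffP forallP) => [af x y|af x].
  by have /forallP/(_ y)/eqP := af x.
by apply/forallP => y; rewrite af.
Qed.

Lemma autg_group_set : group_set autg.
Proof.
apply/group_setP; split=> [|f g /autgP af /autgP ag]; apply/autgP => x y.
  by rewrite !perm1.
by rewrite !permM ag af.
Qed.
Canonical autg_group := Group autg_group_set.

Lemma same_orbitP A B : same_orbit le A B <-> exists2 g, g \in autg & g @: A = B.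
Proof. by split=> [[g [/autgP]]|[g /autgP]]; exists g. Qed.

Lemma same_orbit_refl A : same_orbit le A A.
Proof. by apply/same_orbitP; exists 1; rewrite ?group1 ?perm_imset1. Qed.

Lemma same_orbit_sym A B : same_orbit le A B -> same_orbit le B A.
Proof.
move/same_orbitP=> [g Gg gA]; apply/same_orbitP.
by exists g^-1; rewrite ?groupV // (perm_imsetV gA).
Qed.

Lemma same_orbit_trans B A C : same_orbit le A B -> same_orbit le B C -> same_orbit le A C.
Proof.
move=> /same_orbitP[g Gg gA] /same_orbitP[h Gh hB]; apply/same_orbitP.
by exists (g * h); rewrite ?groupM // perm_imsetM gA.
Qed.

(* If [f] is monotone and onto, its inverse is a power of the permutation it defines, hence
   monotone too. *)
Lemma mono_onto_aut (f : T -> T) :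
  (forall x y, le x y -> le (f x) (f y)) -> (forall y, exists x, f x = y) ->
  exists2 g, g \in autg & g =1 f.
Proof.
move=> mono_f /fin_all_exists[f' fK].
have [h _ hf'] : bijective f' := injF_bij (can_inj fK).
have inj_f : injective f.
  have fh : f =1 h by move=> x; rewrite -{1}(hf' x) fK.
  by move=> x y; rewrite !fh => /(can_inj hf').
have mono_powers k x y : le x y -> le ((perm inj_f ^+ k) x) ((perm inj_f ^+ k) y).
  by elim: k => [|k IH] xy; rewrite ?expg0 ?perm1 // !expgSr !permM !permE; apply/mono_f/IH.
exists (perm inj_f) => [|x]; last by rewrite permE.
apply/autgP => x y; apply/idP/idP => [fxy|xy]; last exact: (mono_powers 1%N).
by have := mono_powers #[perm inj_f].-1 _ _ fxy; rewrite -invg_expg !permK.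
Qed.

End AutomorphismGroup.

Section Automorphisms.

Variables (T : finType) (le : rel T) (n : nat).
Hypothesis polyP : polytope le n.
Let po := polytope_poset polyP.
Let fs := polytope_card_flag polyP.
Implicit Types (f g h : {perm T}) (A B : {set T}) (w u v : seq nat).
Local Notation G := (autg le).

Lemma aut_flag g A : g \in G -> flag le A -> flag le (g @: A).
Proof.
move/autgP=> ag fA; apply: (chain_card_flag fs); last by rewrite card_imset ?fs //; apply: perm_inj.
apply/chainP => _ _ /imsetP[x Ax ->] /imsetP[y Ay ->]; rewrite !ag.
by have /chainP := flag_chain fA; apply.
Qed.

Lemma aut_rk g x : g \in G -> rk le (g x) = rk le x.
Proof.
move=> Gg; have [A fA Ax] := flag1 po x; have ag := elimT (autgP _ _) Gg.
rewrite (rk_flag po fs fA Ax) (rk_flag po fs (aut_flag Gg fA)) ?imset_f //.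
rewrite -[RHS](card_imset _ (@perm_inj _ g)); apply: eq_card => y.
apply/idP/imsetP => [|[z]]; rewrite !inE.
  by case/andP=> /imsetP[z Az ->] zx; exists z; rewrite // !inE Az -ag.
by case/andP=> Az zx ->; rewrite imset_f // ag.
Qed.

Lemma aut_ltp g x y : g \in G -> ltp le (g x) (g y) = ltp le x y.
Proof. by move/autgP=> ag; rewrite /ltp ag (inj_eq perm_inj). Qed.

Lemma aut_flag_map g : g \in G -> flag_map le le n g.
Proof.
move=> Gg; apply: (flag_map_intro polyP polyP) => [x|x y|A i fA li]; first exact: aut_rk.
  by rewrite (elimT (autgP _ _) Gg).
by move/(imset_inj (@perm_inj _ g)); apply: (swap_neq polyP).
Qed.

Lemma aut_run g A w : g \in G -> flag le A -> all (letter n) w ->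
  g @: run le A w = run le (g @: A) w.
Proof. by move=> Gg; apply: flag_map_run; apply: aut_flag_map. Qed.

Lemma aut_eq g h A : g \in G -> h \in G -> flag le A -> g @: A = h @: A -> g = h.
Proof.
move=> Gg Gh fA eqA; apply/permP.
exact: (flag_map_eq polyP polyP (aut_flag_map Gg) (aut_flag_map Gh) fA eqA).
Qed.

Lemma aut_face g A x y : g \in G -> flag le A -> x \in A -> y \in g @: A ->
  rk le y = rk le x -> g x = y.
Proof. by move=> Gg; apply: (flag_map_face polyP); apply: aut_flag_map. Qed.

Lemma mirror_inverts r g A i c w : r \in G -> g \in G -> flag le A -> letter n i -> letter n c ->
  r @: A = swap le c A -> g @: A = run le A w -> w \in [:: [:: i; c]; [:: c; i]] -> g ^ r = g^-1.
Proof.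
move=> Gr Gg fA li lc rA gA wic.
have lw : all (letter n) w by move: wic; rewrite !inE => /orP[]/eqP->; rewrite /= li lc.
have wcw : run le A (w ++ c :: w) = swap le c A.
  by move: wic; rewrite !inE => /orP[]/eqP->; rewrite /= !(swapK polyP) ?flag_swap.
apply: (aut_eq (groupJ Gg Gr) (groupVr Gg) (aut_flag Gr fA)).
have -> : (g ^ r) @: (r @: A) = run le (swap le c A) w.
  by rewrite conjgE !perm_imsetM (perm_imsetV (erefl (r @: A))) gA aut_run // rA.
rewrite rA; apply/esym/perm_imsetV; rewrite -[RHS]wcw run_cat -gA.
by apply: (aut_run Gg fA (w := c :: w)); rewrite /= lc.
Qed.

Lemma aut_fix_improper g A x : g \in G -> flag le A -> x \in A -> ~~ letter n (rk le x) ->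
  g x = x.
Proof.
move=> Gg fA Ax nl; apply: (aut_face Gg fA Ax) => //.
exact: (improper_flag polyP (aut_flag Gg fA)).
Qed.

Section Transport.

Variables A B : {set T}.
Hypotheses (fA : flag le A) (fB : flag le B).
Hypothesis loop_AB : forall w, all (letter n) w -> run le A w = A -> run le B w = B.

Let transport_unique w w' x y y' : all (letter n) w -> all (letter n) w' ->
  x \in run le A w -> x \in run le A w' -> y \in run le B w -> y' \in run le B w' ->
  rk le y = rk le x -> rk le y' = rk le x -> y = y'.
Proof.
move=> lw lw' xw xw' yw yw' ry ry'.
have fl C v : flag le C -> flag le (run le C v) by apply: flag_run.
have [u [lu ru avoid]] := run_connect polyP (fl _ w fA) (fl _ w' fA).
have loopA : run le A (w ++ u ++ rev w') = A by rewrite !run_cat ru (run_rev polyP).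
have loopB : run le B (w ++ u ++ rev w') = B.
  by apply: loop_AB => //; rewrite !all_cat lw lu all_rev.
have runB : run le (run le B w) u = run le B w'.
  rewrite -[in RHS]loopB !run_cat -{2}(revK w') (run_rev polyP) //.
  by apply/fl/fl.
apply: (flag_inj po fs (fl _ w' fB)) => //; last by rewrite ry ry'.
rewrite -runB; apply: run_keep => //; first exact: fl.
by apply/negP => /avoid/(_ xw xw'); rewrite ry.
Qed.

(* The image of a face of [run A w] is the face of the same rank of [run B w]. *)
Let transport : exists f : T -> T, forall x w, all (letter n) w -> x \in run le A w ->
  f x \in run le B w /\ rk le (f x) = rk le x.
Proof.
apply: (fin_all_exists (P := fun x y => forall w, all (letter n) w -> x \in run le A w ->
  y \in run le B w /\ rk le y = rk le x)) => x.
have [C fC Cx] := flag1 po x; have [v [lv rv _]] := run_connect polyP fA fC.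
have [y By ry] := flag_rk po fs x (flag_run v fB).
exists y => w lw xw; split=> //; have [z Bz rz] := flag_rk po fs x (flag_run w fB).
by rewrite (@transport_unique v w x y z) // rv.
Qed.

Lemma extend_flag : exists2 g, g \in G & g @: A = B.
Proof.
have [f fP] := transport.
have mono_f x y : le x y -> le (f x) (f y).
  move=> xy; have [C [fC Cx Cy]] := flag2 po xy; have [w [lw rw _]] := run_connect polyP fA fC.
  have [|fx rx] := fP x w lw; first by rewrite rw.
  have [|fy ry] := fP y w lw; first by rewrite rw.
  by rewrite (flag_le po fs _ fx fy) ?flag_run // rx ry (le_rk po fs).
have onto_f y : exists x, f x = y.
  have [C fC Cy] := flag1 po y; have [w [lw rw _]] := run_connect polyP fB fC.
  have [x Ax rx] := flag_rk po fs y (flag_run w fA).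
  exists x; have [fx rfx] := fP x w lw Ax.
  by apply: (flag_inj po fs fC) => //; rewrite -?rw // rfx.
have [g Gg def_g] := mono_onto_aut mono_f onto_f.
exists g => //; apply: (flag_sub fs) => //; first exact: aut_flag.
by apply/subsetP => _ /imsetP[x Ax ->]; rewrite def_g; case: (fP x [::]).
Qed.

End Transport.

(** * Automorphisms given by words *)

Definition aut_word A w : {perm T} := odflt 1 [pick g in G | g @: A == run le A w].

Lemma aut_word_unique g A w : g \in G -> flag le A -> g @: A = run le A w -> aut_word A w = g.
Proof.
move=> Gg fA gA; rewrite /aut_word; case: pickP => /= [h /andP[Gh /eqP hA] | /(_ g)].
  by apply: (aut_eq Gh Gg fA); rewrite hA gA.
by rewrite Gg gA eqxx.
Qed.

Lemma aut_wordP A w : same_orbit le A (run le A w) ->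
  aut_word A w \in G /\ aut_word A w @: A = run le A w.
Proof.
case/same_orbitP=> g Gg gA; rewrite /aut_word.
case: pickP => /= [h /andP[Gh /eqP hA] // | /(_ g)].
by rewrite Gg gA eqxx.
Qed.

Lemma eq_aut_word A w w' : run le A w = run le A w' -> aut_word A w = aut_word A w'.
Proof. by rewrite /aut_word => ->. Qed.

(* Abstract rotations: [rot A i] turns the base flag [A] one step around its section of ranks
   [i - 2] to [i + 1]. *)
Definition rot A i : {perm T} := aut_word A [:: i.+2; i.+1].

End Automorphisms.

(** * Chiral polytopes *)

Definition even_word (n : nat) (w : seq nat) : bool := all (letter n) w && ~~ odd (size w).

Lemma even_word2 n i j : letter n i -> letter n j -> even_word n [:: i; j].
Proof. by rewrite /even_word /= => -> ->. Qed.

Lemma even_word_rot n i : 0 < i < n -> even_word n [:: i.+2; i.+1].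
Proof. by move=> ir; apply: even_word2; rewrite /letter; lia. Qed.

Lemma even_word_cat n u v : even_word n u -> even_word n v -> even_word n (u ++ v).
Proof.
move=> /andP[lu eu] /andP[lv ev].
by rewrite /even_word all_cat lu lv size_cat oddD (negbTE eu) (negbTE ev).
Qed.

Lemma even_word_rev n w : even_word n (rev w) = even_word n w.
Proof. by rewrite /even_word all_rev size_rev. Qed.

Lemma even_word_ind n (P : seq nat -> Prop) : P [::] ->
  (forall i j w, letter n i -> letter n j -> even_word n w -> P w -> P (i :: j :: w)) ->
  forall w, even_word n w -> P w.
Proof.
move=> P0 PS w; have [m] := ubnP (size w); elim: m w => // m IH [|i [|j w]] //=.
  by rewrite /even_word /= andbF.
rewrite /even_word /= negbK => szw /andP[/and3P[li lj lw] ew].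
have evw : even_word n w by apply/andP.
by apply: PS => //; apply: IH => //; lia.
Qed.

Section FaceStabilisers.

Variables (T : finType) (le : rel T).

Implicit Types (A : {set T}) (g : {perm T}).

Definition face_stab A (i : nat) : {group {perm T}} :=
  'C_(autg le)([set x in A | rk le x == i] | 'P)%G.

Lemma face_stabP A i (g : {perm T}) :
  reflect (g \in autg le /\ {in A, forall x, rk le x = i -> g x = x}) (g \in face_stab A i).
Proof.
apply: (iffP setIP) => -[Gg fix_g]; split=> //.
  by move=> x Ax rx; apply: (astabP fix_g); rewrite inE Ax rx eqxx.
by apply/astabP => x; rewrite inE => /andP[Ax /eqP]; apply: fix_g.
Qed.

Lemma face_stab_sub A i : face_stab A i \subset autg le.
Proof. exact: subsetIl. Qed.

End FaceStabilisers.

Section Chiral.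

Variables (T : finType) (le : rel T) (n : nat).
Hypotheses (polyP : polytope le n) (chiralP : chiral le).
Let po := polytope_poset polyP.
Let fs := polytope_card_flag polyP.
Implicit Types (f g h : {perm T}) (A B C : {set T}) (w u v : seq nat) (i j c : nat).
Local Notation G := (autg le).
Local Notation run := (run le).
Local Notation swap := (swap le).
Local Notation letter := (letter n).
Local Notation even_word := (even_word n).
Local Notation aut_word := (aut_word le).
Local Notation rot := (rot le).
Local Notation stab := (face_stab le).

Lemma two_orbits A B C : flag le A -> flag le B -> flag le C ->
  ~ same_orbit le A B -> ~ same_orbit le B C -> same_orbit le A C.
Proof.
case: chiralP => _ [P0 [P1 [_ _ _ orb]]] fA fB fC nAB nBC.
have join (P X Y : {set T}) : same_orbit le P X -> same_orbit le P Y -> same_orbit le X Y.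
  by move=> /same_orbit_sym; apply: same_orbit_trans.
case: (orb A fA) => oA; case: (orb B fB) => oB; case: (orb C fC) => oC; try exact: join oA oC.
- by case: nAB; apply: join oA oB.
- by case: nBC; apply: join oB oC.
- by case: nBC; apply: join oB oC.
by case: nAB; apply: join oA oB.
Qed.

Lemma swap_orbit A i : flag le A -> letter i -> ~ same_orbit le A (swap i A).
Proof.
by case: chiralP => adj _ fA li; apply: adj; rewrite ?flag_swap //; apply: (swap_adjacent polyP).
Qed.

Lemma even_orbit A w : flag le A -> even_word w -> same_orbit le A (run A w).
Proof.
move=> + ew; elim/even_word_ind: ew A => [|i j w' li lj _ IH] A fA; first exact: same_orbit_refl.
have fi := flag_swap i fA; have fj := flag_swap j fi.
apply: same_orbit_trans (IH _ fj).
by apply: (two_orbits fA fi fj); apply: swap_orbit.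
Qed.

Lemma odd_orbit A w : flag le A -> all letter w -> odd (size w) -> ~ same_orbit le A (run A w).
Proof.
case: w => //= i w fA /andP[li lw] ow orb; apply: (swap_orbit fA li).
apply: same_orbit_trans orb _; apply: same_orbit_sym; apply: even_orbit; last exact/andP.
exact: flag_swap.
Qed.

Lemma no_aut_swap g A i : g \in G -> flag le A -> letter i -> g @: A <> swap i A.
Proof. by move=> Gg fA li gA; apply: (swap_orbit fA li); apply/same_orbitP; exists g. Qed.

Lemma flag_orbit2 A B i : flag le A -> flag le B -> letter i ->
  same_orbit le A B \/ same_orbit le A (swap i B).
Proof.
move=> fA fB li; have [w [lw rw _]] := run_connect polyP fA fB.
have [ow|ew] := boolP (odd (size w)); last first.
  by left; rewrite -rw; apply: even_orbit => //; apply/andP.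
right; rewrite -rw -[swap i _]/(run (run A w) [:: i]) -run_cat; apply: even_orbit => //.
by rewrite /even_word all_cat lw /= li size_cat addn1 /= ow.
Qed.

Lemma flag_image_off A B i : flag le A -> flag le B -> letter i ->
  exists2 g, g \in G & {in A, forall x, rk le x <> i -> g x \in B}.
Proof.
move=> fA fB li; have [] := flag_orbit2 fA fB li => /same_orbitP[g Gg gA]; exists g => // x Ax nx.
  by rewrite -gA imset_f.
by apply: (swap_agree_sym polyP (i := i) fB); rewrite -?gA ?imset_f ?(aut_rk polyP).
Qed.

Lemma aut_transitive A x y i : flag le A -> x \in A -> rk le y = rk le x ->
  letter i -> rk le x <> i -> exists2 g, g \in G & g x = y.
Proof.
move=> fA Ax ryx li nx; have [B fB By] := flag1 po y.
have [g Gg gA] := flag_image_off fA fB li; exists g => //.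
by apply: (flag_inj po fs fB); rewrite ?gA ?(aut_rk polyP).
Qed.

Lemma aut_word_autg A w : flag le A -> even_word w -> aut_word A w \in G.
Proof. by move=> fA /(even_orbit fA)/aut_wordP[]. Qed.

Lemma imset_aut_word A w : flag le A -> even_word w -> aut_word A w @: A = run A w.
Proof. by move=> fA /(even_orbit fA)/aut_wordP[]. Qed.

Lemma aut_wordM A u v : flag le A -> even_word u -> even_word v ->
  aut_word A u * aut_word A v = aut_word A (v ++ u).
Proof.
move=> fA eu ev; have /andP[lu _] := eu; have Gv := aut_word_autg fA ev.
apply/esym/(aut_word_unique polyP) => //; first by rewrite groupM ?aut_word_autg.
by rewrite perm_imsetM !imset_aut_word // (aut_run polyP) // imset_aut_word // -run_cat.
Qed.

Lemma aut_wordV A w : flag le A -> even_word w -> (aut_word A w)^-1 = aut_word A (rev w).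
Proof.
move=> fA ew; apply/eqP; rewrite eq_invg_mul aut_wordM ?even_word_rev //; apply/eqP.
apply: (aut_word_unique polyP); rewrite ?group1 // perm_imset1 run_cat.
by rewrite -[w in run _ w]revK (run_rev polyP).
Qed.

Lemma aut_word1 A w : flag le A -> run A w = A -> aut_word A w = 1.
Proof. by move=> fA wA; apply: (aut_word_unique polyP); rewrite ?group1 // perm_imset1. Qed.

Lemma aut_word_cons2 A i j c w : flag le A -> letter i -> letter j -> letter c -> even_word w ->
  aut_word A (i :: j :: w) =
    aut_word A w * ((aut_word A [:: j; c])^-1 * aut_word A [:: i; c]).
Proof.
move=> fA li lj lc ew; have [ejc eic] := (even_word2 lj lc, even_word2 li lc).
rewrite aut_wordV // !aut_wordM ?even_word_cat ?even_word_rev //.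
by apply: eq_aut_word; rewrite /= (swapK polyP) // flag_swap.
Qed.

Lemma aut_word_far_sq1 A i j : flag le A -> letter i -> letter j -> i.+1 < j ->
  aut_word A [:: j; i] ^+ 2 = 1.
Proof.
move=> fA li lj ij; have ew := even_word2 lj li.
by rewrite expg2 aut_wordM // aut_word1 // (run_far_square polyP).
Qed.

Lemma aut_word_stab A i w : flag le A -> even_word w -> i \notin w -> aut_word A w \in stab A i.
Proof.
move=> fA ew nwi; have Gw := aut_word_autg fA ew; apply/face_stabP; split=> // x Ax rx.
by apply: (aut_face polyP Gw fA Ax) => //; rewrite imset_aut_word // run_keep // rx.
Qed.

Lemma mem_face_stab A i g x : flag le A -> g \in G -> x \in A -> rk le x = i ->
  (g \in stab A i) = (g x == x).
Proof.
move=> fA Gg Ax rx; apply/face_stabP/eqP => [[_]|gx]; first exact.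
by split=> // y Ay ry; rewrite (flag_inj po fs fA Ay Ax) ?ry ?rx.
Qed.

Section WordGeneration.

Variables (I : pred nat) (c : nat).
Hypothesis lc : letter c.

Lemma aut_word_pair (H : {group {perm T} * {perm T}}) A B : flag le A -> flag le B ->
  (forall i, I i -> letter i -> (aut_word A [:: i; c], aut_word B [:: i; c]) \in H) ->
  forall w, even_word w -> all I w -> (aut_word A w, aut_word B w) \in H.
Proof.
move=> fA fB gens w; elim/even_word_ind => [|i j {}w li lj ew IH] /=.
  by rewrite !aut_word1 // (group1 H).
case/and3P=> Ii Ij /IH Hw.
rewrite (aut_word_cons2 fA li lj lc ew) (aut_word_cons2 fB li lj lc ew).
exact: (groupM Hw (groupM (groupVr (gens j Ij lj)) (gens i Ii li))).
Qed.

Lemma aut_word_mem (H : {group {perm T}}) A w : flag le A ->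
  (forall i, I i -> letter i -> aut_word A [:: i; c] \in H) ->
  even_word w -> all I w -> aut_word A w \in H.
Proof.
move=> fA gens ew Iw.
have := @aut_word_pair (setX_group H H) A A fA fA _ w ew Iw.
by rewrite !inE andbb; apply=> i Ii li; rewrite !inE gens.
Qed.

Lemma stab_gen (H : {group {perm T}}) A g : flag le A ->
  (forall i, I i -> letter i -> aut_word A [:: i; c] \in H) ->
  g \in G -> (forall i, letter i -> ~~ I i -> g \in stab A i) -> g \in H.
Proof.
move=> fA gens Gg fix_g; have fgA := aut_flag polyP Gg fA.
have [w [lw rw avoid]] := run_connect polyP fA fgA.
have Iw : all I w.
  apply/allP => i iw; apply: contraT => nI; have li := allP lw i iw.
  have [x Ax rx] := letter_face polyP fA li; have /face_stabP[_ fix_i] := fix_g i li nI.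
  by case: (avoid i x iw Ax); rewrite // -(fix_i x) ?imset_f.
have ew : even_word w.
  rewrite /even_word lw /=; apply/negP => /(odd_orbit fA lw); apply.
  by apply/same_orbitP; exists g; rewrite ?rw.
by rewrite -(aut_word_unique polyP Gg fA (esym rw)) aut_word_mem.
Qed.

End WordGeneration.

Lemma stab_all_but_one A j g : flag le A -> letter j -> g \in G ->
  (forall i, letter i -> i != j -> g \in stab A i) -> g = 1.
Proof.
move=> fA lj Gg fix_g; apply/set1gP; apply: (stab_gen (I := pred1 j) lj fA) => //.
by move=> i /eqP-> _; rewrite aut_word1 ?group1 //= (swapK polyP).
Qed.

Lemma aut_word_swap A c w : flag le A -> letter c -> even_word w ->
  aut_word (swap c A) w = aut_word A (c :: w ++ [:: c]).
Proof.
move=> fA lc ew; have ecwc : even_word (c :: w ++ [:: c]).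
  have /andP[lw oddw] := ew.
  by rewrite /even_word /= all_cat size_cat addn1 lc lw /= lc negbK.
have Gw := aut_word_autg fA ecwc.
apply: (aut_word_unique polyP) => //; first exact: flag_swap.
rewrite -[swap c A]/(run A [:: c]) (aut_run polyP) //= ?lc // imset_aut_word //.
by rewrite /= run_cat /= (swapK polyP) // flag_run // flag_swap.
Qed.

Lemma aut_word_swapV A i c : flag le A -> letter i -> letter c ->
  aut_word (swap c A) [:: i; c] = (aut_word A [:: i; c])^-1.
Proof.
move=> fA li lc; rewrite aut_word_swap ?even_word2 // aut_wordV ?even_word2 //.
by apply: eq_aut_word; rewrite /= (swapK polyP) // !flag_swap.
Qed.

Section Rotations.

Variable A : {set T}.
Hypothesis fA : flag le A.

Let rot_letters i : 0 < i < n -> letter i.+1 /\ letter i.+2.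
Proof. by rewrite /letter; clear; lia. Qed.

Lemma rot_autg i : 0 < i < n -> rot A i \in G.
Proof. by move/even_word_rot; apply: aut_word_autg. Qed.

Lemma imset_rot i : 0 < i < n -> rot A i @: A = run A [:: i.+2; i.+1].
Proof. by move/even_word_rot; apply: imset_aut_word. Qed.

Lemma rot_neq1 i : 0 < i < n -> rot A i != 1.
Proof.
move=> ir; have [li1 li2] := rot_letters ir; apply/eqP => rot1.
apply: (run2_neq polyP fA li1 li2 (@n_Sn _)).
by rewrite -imset_rot // rot1 perm_imset1.
Qed.

Lemma rot_stab i j : 0 < i < n -> j \notin [:: i.+2; i.+1] -> rot A i \in stab A j.
Proof. by move=> /even_word_rot ew nj; rewrite aut_word_stab. Qed.

Lemma cycle_rot_stab i j : 0 < i < n -> j \notin [:: i.+2; i.+1] ->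
  <[rot A i]> \subset stab A j.
Proof. by rewrite cycle_subG; apply: rot_stab. Qed.

Lemma mem_cycle_rot i g : 0 < i < n -> g \in G ->
  (forall j, letter j -> j \notin [:: i.+2; i.+1] -> g \in stab A j) -> g \in <[rot A i]>.
Proof.
move=> ir Gg fix_g; have [li1 _] := rot_letters ir.
apply: (@stab_gen (mem [:: i.+2; i.+1]) _ li1 <[rot A i]>%G A) => // j; rewrite !inE.
case/orP=> /eqP-> _; first exact: cycle_id.
by rewrite aut_word1 ?group1 //= (swapK polyP).
Qed.

Lemma cycle_rot_stab_TI i j : 0 < i < n -> j \in [:: i.+2; i.+1] ->
  <[rot A i]> :&: stab A j = 1.
Proof.
move=> ir ij; have [li1 li2] := rot_letters ir; apply/trivgP/subsetP => g /setIP[rg jg].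
have Gg := subsetP (face_stab_sub _ _ _) _ jg.
pose j' := if j == i.+1 then i.+2 else i.+1.
have lj' : letter j' by rewrite /j'; case: ifP.
apply/set1gP; apply: (@stab_all_but_one A j') => // k lk nk.
have [-> //|nkj] := eqVneq k j.
apply: subsetP rg; apply: cycle_rot_stab => //.
by move: ij nk nkj; rewrite /j' !inE; case: ifP; lia.
Qed.

Lemma cycle_rot_TI i j : 0 < i < n -> 0 < j < n -> i != j -> <[rot A i]> :&: <[rot A j]> = 1.
Proof.
move=> ir jr nij; pose k := if i == j.+1 then i.+2 else i.+1.
apply/trivgP; rewrite -(@cycle_rot_stab_TI i k ir); last by rewrite /k !inE; case: ifP; lia.
by rewrite setIS // cycle_rot_stab // /k !inE; case: ifP; lia.
Qed.

Lemma rotM i : 0 < i -> i.+1 < n -> rot A i * rot A i.+1 = aut_word A [:: i.+3; i.+1].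
Proof.
move=> i0 iSn; have ir : 0 < i < n by rewrite i0 ltnW.
rewrite aut_wordM ?even_word_rot //.
by apply: eq_aut_word; rewrite /= (swapK polyP) // flag_swap.
Qed.

End Rotations.

Definition section_faces i F E := [set H | ltp le E H && ltp le H F && (rk le H == i)].

Section SectionCount.

Variables (A : {set T}) (i : nat).
Hypotheses (fA : flag le A) (irange : 0 < i < n).
Let li1 : letter i.+1. Proof. by move: irange; rewrite /letter; lia. Qed.
Let li2 : letter i.+2. Proof. by move: irange; rewrite /letter; lia. Qed.

Let section_word E F y : E \in A -> F \in A -> rk le E = i -> rk le F = i.+3 ->
  y \in section_faces i.+1 F E ->
  exists w, [/\ even_word w, all (mem [:: i.+2; i.+1]) w & y \in run A w].
Proof.
move=> AE AF rE rF; rewrite inE => /andP[/andP[/andP[_ Ey] /andP[_ yF]] /eqP ry].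
have lexx : reflexive le by case: po.
have byEF : {in [set y], forall z, le E z && le z F} by move=> _ /set1P->; rewrite Ey.
have [B fB /subsetP sB] := chain_flag (chain_splice po fA (chain1 (lexx y)) byEF).
have By : y \in B by rewrite sB // !inE eqxx.
have [w [lw rw avoid]] := run_connect polyP fA fB.
have Iw : all (mem [:: i.+2; i.+1]) w.
  apply/allP => j jw; apply: contraT => nj.
  have [z Az rz] := letter_face polyP fA (allP lw j jw).
  case: (avoid j z jw Az); rewrite // sB // !inE Az !(flag_le po fs fA) // rE rF rz.
  by apply/orP; right; move: nj; rewrite !inE; clear; lia.
have [ow|ew] := boolP (odd (size w)); last by exists w; rewrite rw /even_word lw.
exists (w ++ [:: i.+2]); rewrite /even_word !all_cat lw Iw /= li2 !inE eqxx size_cat addn1 /= ow.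
split=> //; rewrite run_cat rw /=; apply: (swap_agree fB) => //.
by rewrite ry; apply: n_Sn.
Qed.

Lemma section_faces_orbit E F x : E \in A -> F \in A -> rk le E = i -> rk le F = i.+3 ->
  x \in A -> rk le x = i.+1 -> section_faces i.+1 F E = orbit 'P <[rot A i]> x.
Proof.
move=> AE AF rE rF Ax rx; apply/setP => y; apply/idP/orbitP => [Sy|[g rg <-]].
  have [w [ew Iw wy]] := section_word AE AF rE rF Sy.
  exists (aut_word A w).
    apply: (@aut_word_mem (mem [:: i.+2; i.+1]) _ li1 <[rot A i]>%G) => // j; rewrite !inE.
    case/orP=> /eqP-> _; first exact: cycle_id.
    by rewrite aut_word1 ?group1 //= (swapK polyP).
  apply: (aut_face polyP (aut_word_autg fA ew) fA Ax); first by rewrite imset_aut_word.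
  by move: Sy; rewrite inE rx => /andP[_ /eqP].
have Gg : g \in G by apply: subsetP rg; rewrite cycle_subG rot_autg.
have fix_g z : z \in A -> rk le z \notin [:: i.+2; i.+1] -> g z = z.
  move=> Az nz; have /face_stabP[_] : g \in stab A (rk le z).
    by apply: subsetP rg; apply: cycle_rot_stab.
  exact.
have [gE gF] : g E = E /\ g F = F by split; apply: fix_g; rewrite // ?rE ?rF !inE; clear; lia.
rewrite inE /= apermE (aut_rk polyP) // rx eqxx andbT -{1}gE -{1}gF !aut_ltp //.
by rewrite !(flag_ltp po fs fA) // rE rF rx; lia.
Qed.

Lemma card_base_section E F : E \in A -> F \in A -> rk le E = i -> rk le F = i.+3 ->
  #|section_faces i.+1 F E| = #[rot A i].
Proof.
move=> AE AF rE rF; have [x Ax rx] := letter_face polyP fA li1.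
rewrite (section_faces_orbit AE AF rE rF Ax rx) orderE.
rewrite -(card_orbit_stab 'P <[rot A i]>%G x).
suff -> : 'C_<[rot A i]>[x | 'P] = 1 by rewrite cards1 muln1.
apply/trivgP; rewrite -(@cycle_rot_stab_TI A fA i i.+1) ?inE ?eqxx ?orbT //.
apply/subsetP => g /setIP[rg /astab1P gx]; rewrite inE rg.
rewrite (mem_face_stab fA _ Ax rx); first exact/eqP.
by apply: subsetP rg; rewrite cycle_subG rot_autg.
Qed.

Lemma card_section E F : ltp le E F -> rk le E = i -> rk le F = i.+3 ->
  #|section_faces i.+1 F E| = #[rot A i].
Proof.
move=> EF rE rF; have [B [fB BE BF]] := flag2 po (proj2 (andP EF)).
have [g [Gg gE gF]] : exists g, [/\ g \in G, E \in g @: A & F \in g @: A].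
  have [/same_orbitP|/same_orbitP] := flag_orbit2 fA fB li1; case=> g Gg gA; exists g.
    by rewrite gA.
  by rewrite gA; split=> //; apply: (swap_agree fB) => //; rewrite ?rE ?rF; clear; lia.
case/imsetP: gE rE EF => E0 AE0 -> + _; case/imsetP: gF rF => F0 AF0 ->.
rewrite !(aut_rk polyP) // => rF rE; rewrite -(card_base_section AE0 AF0 rE rF).
rewrite -[RHS](card_imset _ (@perm_inj _ g)); apply: eq_card => y.
rewrite -[y](permKV g) mem_imset; last exact: perm_inj.
by rewrite !inE !aut_ltp // (aut_rk polyP).
Qed.

End SectionCount.

Section TypeAndTightness.

Variable A : {set T}.
Hypothesis fA : flag le A.

Definition rot_orders : seq nat := mkseq (fun k => #[rot A k.+1]) n.-1.

Lemma chiral_has_type : has_type le n rot_orders.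
Proof.
split=> [|i F E ir EF rE rF]; first by rewrite size_mkseq.
rewrite -/(section_faces i.+1 F E) (card_section fA ir EF) ?rF ?addn3 //.
by rewrite nth_mkseq ?prednK //; lia.
Qed.

Lemma chiral_type_unique ps : has_type le n ps -> ps = rot_orders.
Proof.
case=> szps sect_ps; apply: (@eq_from_nth _ 0); first by rewrite size_mkseq szps.
move=> k; rewrite szps => kn; have ir : 0 < k.+1 < n by lia.
have [|E AE rE] := @flag_face _ _ _ po fs A k.+1 fA; first by lia.
have [|F AF rF] := @flag_face _ _ _ po fs A k.+4 fA; first by lia.
rewrite nth_mkseq // -(card_base_section fA ir AE AF rE rF) -(sect_ps k.+1 F E) ?addn3 //.
by rewrite (flag_ltp po fs fA) // rE rF; lia.
Qed.

Lemma card_chiral_flags : 0 < n -> num_flags le = (2 * #|G|)%N.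
Proof.
move=> n0; have l2 : letter 2 by rewrite /letter; lia.
have f2 := flag_swap 2 fA; pose orb (B : {set T}) := [set g @: B | g : {perm T} in G].
have orbP (B C : {set T}) : reflect (exists2 g, g \in G & g @: B = C) (C \in orb B).
  by apply: (iffP imsetP) => -[g Gg]; exists g.
have card_orb B : flag le B -> #|orb B| = #|G|.
  by move=> fB; apply: card_in_imset => g h Gg Gh; apply: (aut_eq polyP).
have disj : orb A :&: orb (swap 2 A) = set0.
  apply/setP => P; rewrite !inE; apply/negP => /andP[/orbP/same_orbitP oA /orbP/same_orbitP oS].
  by apply: (swap_orbit fA l2); apply: same_orbit_trans oA (same_orbit_sym oS).
rewrite /num_flags (_ : [set P | flag le P] = orb A :|: orb (swap 2 A)).
  by rewrite cardsU disj cards0 subn0 !card_orb // mul2n addnn.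
apply/setP => P; rewrite !inE; apply/idP/orP => [fP|]; last first.
  by case=> /orbP[g Gg <-]; apply: (aut_flag polyP).
have [oA|oA] := flag_orbit2 fA fP l2; first by left; apply/orbP/same_orbitP.
right; apply/orbP/same_orbitP; apply: (two_orbits f2 fA fP) => [/same_orbit_sym|oAP].
  exact: swap_orbit.
by apply: (swap_orbit fP l2); apply: same_orbit_trans (same_orbit_sym oAP) oA.
Qed.

Lemma tight_card_aut ps : 0 < n -> tight le n ps -> #|G| = (\prod_(p <- rot_orders) p)%N.
Proof.
move=> n0 [/chiral_type_unique-> nflags]; apply/eqP.
by rewrite -(eqn_pmul2l (isT : 0 < 2)) -card_chiral_flags // nflags.
Qed.

Lemma card_aut_tight : 0 < n -> #|G| = (\prod_(p <- rot_orders) p)%N -> tight le n rot_orders.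
Proof.
move=> n0 oG; split; first exact: chiral_has_type.
by rewrite card_chiral_flags // oG.
Qed.

End TypeAndTightness.

End Chiral.

Lemma covering_morphism (T1 T2 : finType) (le1 : rel T1) (le2 : rel T2) n (h : T1 -> T2) A :
  polytope le1 n -> chiral le1 -> polytope le2 n -> chiral le2 -> covering le1 le2 h ->
  flag le1 A -> exists f : {morphism autg le1 >-> {perm T2}},
    forall w, even_word n w -> f (aut_word le1 A w) = aut_word le2 (h @: A) w.
Proof.
move=> poly1 chiral1 poly2 chiral2 covh fA; have [onto_h _ _ _] := covh.
have hmap := covering_flag_map poly1 poly2 covh.
have fhA : flag le2 (h @: A) by case: hmap => _ + _; apply.
pose lifts (g : {perm T1}) (u : {perm T2}) := forall x, h (g x) = u (h x).
have lifts_word w : even_word n w -> lifts (aut_word le1 A w) (aut_word le2 (h @: A) w).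
  move=> ew; have /andP[lw _] := ew.
  have m1 := flag_map_comp (aut_flag_map poly1 (aut_word_autg poly1 chiral1 fA ew)) hmap.
  have m2 := flag_map_comp hmap (aut_flag_map poly2 (aut_word_autg poly2 chiral2 fhA ew)).
  apply: (flag_map_eq poly1 poly2 m1 m2 fA); rewrite (imset_comp h) (imset_comp (aut_word _ _ _) h).
  rewrite (imset_aut_word poly1 chiral1) // (imset_aut_word poly2 chiral2) //.
  by rewrite (flag_map_run hmap).
have uniq_lift g u v : lifts g u -> lifts g v -> u = v.
  by move=> gu gv; apply/permP => y; have [x <-] := onto_h y; rewrite -gu -gv.
have [g Gg|g u v _|g g' u u' _ _ gu gu'|f fP] :=
  functional_morphism (G := autg_group le1) (R := lifts).
- have [w [lw rw _]] := run_connect poly1 fA (aut_flag poly1 Gg fA).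
  have ew : even_word n w.
    rewrite /even_word lw; apply/negP => /(odd_orbit poly1 chiral1 fA lw); apply.
    by apply/same_orbitP; exists g; rewrite ?rw.
  exists (aut_word le2 (h @: A) w); rewrite -(aut_word_unique poly1 Gg fA (esym rw)).
  exact: lifts_word.
- exact: uniq_lift.
- by move=> x; rewrite !permM gu' gu.
exists f => w ew; apply: uniq_lift (lifts_word w ew).
exact: fP (aut_word_autg poly1 chiral1 fA ew).
Qed.

(** * Sections *)

Section Sections.

Variables (T : finType) (le : rel T) (n : nat).
Hypothesis polyP : polytope le n.
Variables (D : pred T) (a c : T) (m : nat).
Hypothesis D_interval : forall x, D x = le a x && le x c.
Hypotheses (le_ac : le a c) (rk_ac : rk le c = rk le a + m.+1).
Let po := polytope_poset polyP.
Let fs := polytope_card_flag polyP.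
Let lexx : reflexive le. Proof. by case: po. Qed.
Let le_anti : antisymmetric le. Proof. by case: po. Qed.
Let le_trans : transitive le. Proof. by case: po. Qed.

Local Notation S := {x : T | D x}.
Implicit Types (A B P : {set T}) (x y : S) (g : {perm T}) (i : nat) (w : seq nat).

Definition sub_le : rel S := fun x y => le (val x) (val y).
Definition sect P : {set S} := [set x | val x \in P].

Let D_a : D a. Proof. by rewrite D_interval lexx le_ac. Qed.
Let D_c : D c. Proof. by rewrite D_interval lexx le_ac. Qed.
Let le_a x : le a (val x). Proof. by have := valP x; rewrite D_interval => /andP[]. Qed.
Let le_c x : le (val x) c. Proof. by have := valP x; rewrite D_interval => /andP[]. Qed.

Lemma sub_poset : partial_order sub_le.
Proof.
split=> [x | x y /le_anti/val_inj // | y x z]; first exact: lexx.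
exact: le_trans.
Qed.

Lemma sub_ltp x y : ltp sub_le x y = ltp le (val x) (val y).
Proof. by rewrite /ltp val_eqE. Qed.

Lemma chain_sect P : chain le P -> chain sub_le (sect P).
Proof. by move/chainP => chP; apply/chainP => x y; rewrite !inE; apply: chP. Qed.

Lemma card_sect B : flag le B -> a \in B -> c \in B -> #|sect B| = m.+2.
Proof.
move=> fB Ba Bc; have count := card_interval po fs fB Ba Bc le_ac.
suff defB : val @: sect B = [set z in B | le a z && le z c].
  by move: count; rewrite -defB (card_imset _ val_inj) rk_ac addnC -addnS => /addnI.
apply/setP => z; rewrite inE -D_interval; apply/imsetP/andP => [[x + ->]|[Bz Dz]].
  by rewrite inE => Bx; split=> //; apply: (valP x).
by exists (Sub z Dz); rewrite ?inE ?SubK.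
Qed.

Lemma flag_sect_lift (C : {set S}) P : flag sub_le C -> flag le P ->
  exists B, [/\ flag le B, C = sect B & {in P, forall z, le z a || le c z -> z \in B}].
Proof.
move=> fC fP.
have chC : chain le (val @: C).
  by have /chainP chC := flag_chain fC; apply/chainP => _ _ /imsetP[x Cx ->] /imsetP[y Cy ->];
    apply: chC.
have bC : {in val @: C, forall z, le a z && le z c} by move=> _ /imsetP[x _ ->]; rewrite le_a le_c.
have [B fB /subsetP sB] := chain_flag (chain_splice po fP chC bC).
have sCB x : x \in C -> val x \in B by move=> Cx; apply: sB; rewrite inE imset_f.
exists B; split=> // [|z Pz out]; last by apply: sB; rewrite !inE Pz out orbT.
apply/setP => x; rewrite inE; apply/idP/idP => [/sCB //|Bx].
apply: (flag_max fC) => [y /sCB By|]; last exact: lexx.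
by have /chainP := flag_chain fB; apply.
Qed.

Lemma sub_card_flag (C : {set S}) : flag sub_le C -> #|C| = m.+2.
Proof.
move=> fC; have [P [fP Pa Pc]] := flag2 po le_ac.
have [B [fB -> outB]] := flag_sect_lift fC fP.
by apply: card_sect => //; apply: outB; rewrite ?lexx ?orbT.
Qed.

Lemma flag_sect P : flag le P -> a \in P -> c \in P -> flag sub_le (sect P).
Proof.
move=> fP Pa Pc; apply: (chain_card_flag sub_card_flag); last exact: card_sect.
exact/chain_sect/flag_chain.
Qed.

Lemma sub_rk x : rk sub_le x + rk le a = (rk le (val x)).+1.
Proof.
have [P [fP Pa Px Pc]] := flag3 po (le_a x) (le_c x).
rewrite (rk_flag sub_poset sub_card_flag (flag_sect fP Pa Pc)) ?inE //.
rewrite -(card_interval po fs fP Pa Px (le_a x)) -(card_imset _ val_inj); congr (_ + _).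
apply: eq_card => z; rewrite inE; apply/imsetP/and3P => [[y + ->]|[Pz az zx]].
  by rewrite !inE => /andP[Py yx]; rewrite le_a.
have Dz : D z by rewrite D_interval az (le_trans zx (le_c x)).
by exists (Sub z Dz); rewrite ?inE /sub_le ?SubK ?Pz.
Qed.

Lemma adjacent_sect B i : flag le B -> a \in B -> c \in B -> rk le a < i < rk le c ->
  adjacent (sect B) (sect (swap le i B)).
Proof.
move=> fB Ba Bc /andP[ai ic].
have li : letter n i.
  by have := rk_gt0 po fs a; have := rk_max po fs c; rewrite /letter; lia.
have [x Bx rx] := letter_face polyP fB li.
have Dx : D x by rewrite D_interval !(flag_le po fs fB) // rx (ltnW ai) (ltnW ic).
apply/cards1P; exists (Sub x Dx); apply/setP => z; rewrite !inE -val_eqE SubK.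
apply/andP/eqP => [[nz Bz]|->].
  apply: (flag_inj po fs fB) => //; rewrite rx; apply/eqP.
  by apply: contraR nz => /eqP; apply: (swap_agree fB).
by split=> //; apply/negP => Sx; apply: (swap_face_neq polyP fB li Bx Sx).
Qed.

Let sub_diamond : diamond sub_le.
Proof.
move=> F G FG rFG; have [_ _ _ dia _] := polyP.
have rFG' : rk le (val G) = (rk le (val F)).+2.
  by apply/eqP; rewrite -eqSS -sub_rk rFG !addSn sub_rk.
rewrite -(dia (val F) (val G)) -?sub_ltp // -(card_imset _ val_inj); apply: eq_card => z.
apply/imsetP/idP => [[x + ->]|]; rewrite !inE ?sub_ltp // => /andP[Fz zG].
have [/andP[_ leFz] /andP[_ lezG]] := (Fz, zG).
have Dz : D z by rewrite D_interval (le_trans (le_a F) leFz) (le_trans lezG (le_c G)).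
by exists (Sub z Dz); rewrite ?inE ?sub_ltp SubK ?Fz.
Qed.

Let sub_connected : strongly_flag_connected sub_le.
Proof.
move=> C C' fC fC'; have [P [fP Pa Pc]] := flag2 po le_ac.
have [A [fA -> outA]] := flag_sect_lift fC fP.
have [B [fB -> outB]] := flag_sect_lift fC' fP.
have [[Aa Ac] [Ba Bc]] : (a \in A /\ c \in A) /\ (a \in B /\ c \in B).
  by split; split; by [apply: outA; rewrite ?lexx ?orbT | apply: outB; rewrite ?lexx ?orbT].
have [w [lw rw avoid]] := run_connect polyP fA fB.
have inside i : i \in w -> rk le a < i < rk le c.
  move=> iw; have [z Pz rz] := letter_face polyP fP (allP lw i iw).
  have out_z : ~~ (le z a || le c z).
    by apply/negP => out; apply: (avoid i z) => //; [apply: outA | apply: outB].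
  by move: out_z; rewrite !(flag_le po fs fP) // rz negb_or -!ltnNge.
have ends (L : {set T}) : A :&: B \subset L -> a \in L /\ c \in L.
  by move=> /subsetP sABL; split; apply: sABL; apply/setIP.
have [|||s [ps ls sL]] := @run_path _ le n S sect (A :&: B) A w fA _ lw.
- exact: subsetIl.
- by move=> i x iw /setIP[Ax Bx]; apply: avoid.
- by move=> L i fL /ends[La Lc] iw li; apply: adjacent_sect; rewrite ?inside.
exists s; split=> //; first by rewrite ls rw.
apply/allP => _ /sL[L [fL sABL ->]]; have [La Lc] := ends L sABL.
rewrite flag_sect //=; apply/subsetP => x; rewrite !inE => ABx.
by apply: (subsetP sABL); rewrite inE.
Qed.

Lemma sub_polytope : polytope sub_le m.
Proof.
split=> //; first by split; [apply: sub_poset | exists (Sub a D_a) => x; rewrite /sub_le SubK].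
  by exists (Sub c D_c) => x; rewrite /sub_le SubK.
exact: sub_card_flag.
Qed.

(* The letter [i] of the section is the letter [i + (rk a - 1)] of the whole polytope. *)
Definition lift_letter i := i + (rk le a).-1.

Lemma lift_letter_bounds i : letter m i = (rk le a < lift_letter i < rk le c).
Proof. by have := rk_gt0 po fs a; rewrite /letter /lift_letter rk_ac; clear; lia. Qed.

Lemma sect_swap B i : flag le B -> a \in B -> c \in B -> letter m i ->
  sect (swap le (lift_letter i) B) = swap sub_le i (sect B).
Proof.
rewrite lift_letter_bounds => fB Ba Bc hi; have fS := flag_swap (lift_letter i) fB.
apply: (swap_unique sub_polytope); first exact: flag_sect.
- by apply: flag_sect => //; apply: (swap_agree fB) => // eqi; rewrite eqi ltnn ?andbF in hi.
- move=> x; rewrite !inE => Bx nx; apply: (swap_agree fB) => // rx; apply: nx.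
  by have := sub_rk x; have := rk_gt0 po fs a; rewrite rx /lift_letter; lia.
by move=> eqS; have := adjacent_sect fB Ba Bc hi; rewrite eqS /adjacent setDv cards0.
Qed.

Lemma sect_run B w : flag le B -> a \in B -> c \in B -> all (letter m) w ->
  sect (run le B [seq lift_letter i | i <- w]) = run sub_le (sect B) w.
Proof.
elim: w B => //= i w IH B fB Ba Bc /andP[li lw].
have hi := li; rewrite lift_letter_bounds in hi.
by rewrite IH ?flag_swap ?sect_swap //; apply: (swap_agree fB) => // eqi;
  rewrite eqi ltnn ?andbF in hi.
Qed.

Lemma sub_aut g : g \in autg le -> g a = a -> g c = c ->
  exists2 g' : {perm S}, g' \in autg sub_le &
    (forall x, val (g' x) = g (val x)) /\ forall B, g' @: sect B = sect (g @: B).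
Proof.
move=> /autgP ag ga gc.
have Dg x : D (g (val x)) by rewrite D_interval -{1}ga -{1}gc !ag -D_interval; apply: (valP x).
have injg : injective (fun x => Sub (g (val x)) (Dg x) : S).
  by move=> x y /(congr1 val); rewrite !SubK => /perm_inj/val_inj.
have val_g x : val (perm injg x) = g (val x) by rewrite permE SubK.
exists (perm injg); first by apply/autgP => x y; rewrite /sub_le !val_g ag.
split=> // B; apply/setP => x; rewrite inE; apply/imsetP/imsetP => [[y + ->]|[z Bz def_x]].
  by rewrite inE => By; exists (val y).
exists ((perm injg)^-1 x); last by rewrite permKV.
by rewrite inE (_ : val _ = z) //; apply: (@perm_inj _ g); rewrite -val_g permKV.
Qed.

Section SectionRotations.

Hypothesis chiralP : chiral le.
Variable A : {set T}.
Hypotheses (fA : flag le A) (Aa : a \in A) (Ac : c \in A).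

Lemma sub_rot i : 0 < i < m ->
  [/\ rot sub_le (sect A) i \in autg sub_le,
      rot sub_le (sect A) i @: sect A = run sub_le (sect A) [:: i.+2; i.+1]
    & forall x, val (rot sub_le (sect A) i x) = rot le A (lift_letter i) (val x)].
Proof.
move=> ir; have := rk_gt0 po fs a; have := rk_max po fs c; rewrite rk_ac => rc ra.
have Ir : 0 < lift_letter i < n by rewrite /lift_letter; lia.
have fix_rot (x : T) : x \in A -> ~~ (rk le a < rk le x < rk le c) ->
    rot le A (lift_letter i) x = x.
  move=> Ax out; have [_|] := boolP (letter n (rk le x)); last first.
    exact: (aut_fix_improper polyP (rot_autg polyP chiralP fA Ir) fA Ax).
  have /face_stabP[_] : rot le A (lift_letter i) \in face_stab le A (rk le x).
    rewrite (rot_stab polyP chiralP fA Ir) // !inE.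
    by move: out; rewrite rk_ac /lift_letter; lia.
  exact.
have [||g Gg [val_g im_g]] := sub_aut (rot_autg polyP chiralP fA Ir).
- by rewrite fix_rot ?ltnn.
- by rewrite fix_rot ?ltnn ?andbF.
have gA : g @: sect A = run sub_le (sect A) [:: i.+2; i.+1].
  by rewrite im_g (imset_rot polyP chiralP fA Ir) -sect_run //= /letter; lia.
by rewrite /rot (aut_word_unique sub_polytope Gg (flag_sect fA Aa Ac) gA).
Qed.

End SectionRotations.

End Sections.

(** * Quotients *)

Definition on_faces (T : finType) (le : rel T) (A B : {set T}) (I : pred nat)
    (R : T -> T -> Prop) : Prop :=
  forall x y, x \in A -> y \in B -> rk le x = rk le y -> I (rk le x) -> R x y.

(* Face by face agreement of two flags up to [K] must be realised by a single element of [K]: this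
   is what makes images of flags in the quotient behave like flags. *)
Definition aligning (T : finType) (le : rel T) (K : {set {perm T}}) : Prop :=
  forall A B (I : pred nat), flag le A -> flag le B ->
  on_faces le A B I (fun x y => exists2 k, k \in K & k x = y) ->
  exists2 k, k \in K & on_faces le A B I (fun x y => k x = y).

Definition swap_free (T : finType) (le : rel T) (n : nat) (K : {set {perm T}}) : Prop :=
  forall k A i, k \in K -> flag le A -> letter n i -> k @: A <> swap le i A.

Section Quotient.

Variables (T : finType) (le : rel T) (n : nat).
Hypothesis polyP : polytope le n.
Let po := polytope_poset polyP.
Let fs := polytope_card_flag polyP.
Let lexx : reflexive le. Proof. by case: po. Qed.
Let le_trans : transitive le. Proof. by case: po. Qed.
Local Notation G := (autg le).

Variable K : {group {perm T}}.
Hypothesis sKG : K \subset G.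
Implicit Types (x y z : T) (A B : {set T}) (g k : {perm T}) (i : nat).

Let Krk k x : k \in K -> rk le (k x) = rk le x.
Proof. by move/(subsetP sKG); apply: (aut_rk polyP). Qed.

Local Notation Q := {O : {set T} | O \in [set orbit 'P K x | x : T]}.

Definition quo x : Q := exist _ (orbit 'P K x) (imset_f _ (erefl (x \in T))).

Definition quo_le : rel Q := fun X Y => [exists x in val X, [exists y in val Y, le x y]].

Lemma quo_onto (X : Q) : exists x, quo x = X.
Proof. by have /imsetP[x _ defX] := valP X; exists x; apply: val_inj. Qed.

Lemma quoP x y : reflect (exists2 k, k \in K & k x = y) (quo x == quo y).
Proof.
rewrite -val_eqE /= eq_sym.
by apply: (iffP eqP) => [/orbit_eqP/orbitP|] [k Kk <-]; [exists k | apply/orbit_eqP/mem_orbit].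
Qed.

Lemma quoK k x : k \in K -> quo (k x) = quo x.
Proof. by move=> Kk; apply/esym/eqP/quoP; exists k. Qed.

Lemma quo_leP x y : reflect (exists2 k, k \in K & le x (k y)) (quo_le (quo x) (quo y)).
Proof.
apply: (iffP exists_inP) => [[_ /orbitP[k Kk <-] /exists_inP[_ /orbitP[l Kl <-] /= le_kl]]|].
  exists (l * k^-1); first by rewrite groupM ?groupV.
  by rewrite permM -(elimT (autgP _ _) (subsetP sKG k Kk)) permKV.
case=> k Kk le_k; exists x; first exact: orbit_refl.
by apply/exists_inP; exists (k y) => //; apply: (mem_orbit 'P).
Qed.

Lemma quo_le_mono x y : le x y -> quo_le (quo x) (quo y).
Proof. by move=> xy; apply/quo_leP; exists 1; rewrite ?group1 ?perm1. Qed.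

Lemma quo_le_rk x y : quo_le (quo x) (quo y) -> rk le x <= rk le y.
Proof. by case/quo_leP=> k Kk /(le_rk po fs); rewrite Krk. Qed.

Lemma quo_le_eq x y : quo_le (quo x) (quo y) -> rk le x = rk le y -> quo x = quo y.
Proof.
case/quo_leP=> k Kk xy rxy; rewrite -(quoK y Kk); congr quo.
by apply: (le_rk_eq po fs xy); rewrite Krk.
Qed.

Lemma quo_eq_rk x y : quo x = quo y -> rk le x = rk le y.
Proof. by move/eqP/quoP=> [k Kk <-]; rewrite Krk. Qed.

Lemma quo_poset : partial_order quo_le.
Proof.
split=> [X | X Y | Y X Z]; have [x <-] := quo_onto X; first exact: quo_le_mono.
  have [y <-] := quo_onto Y => /andP[xy yx]; apply: quo_le_eq => //.
  by apply/eqP; rewrite eqn_leq !quo_le_rk.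
have [y <-] := quo_onto Y; have [z <-] := quo_onto Z.
move=> /quo_leP[k Kk xy] /quo_leP[l Kl yz]; apply/quo_leP.
exists (l * k); rewrite ?groupM // permM; apply: le_trans xy _.
by rewrite (elimT (autgP _ _) (subsetP sKG k Kk)).
Qed.

Lemma quo_chain A : flag le A -> chain quo_le (quo @: A).
Proof.
move=> fA; apply/chainP => _ _ /imsetP[x Ax ->] /imsetP[y Ay ->].
have /chainP/(_ _ _ Ax Ay) := flag_chain fA.
by case/orP=> /quo_le_mono ->; rewrite ?orbT.
Qed.

Let quo_greatest (C : {set Q}) : C != set0 ->
  exists2 x, quo x \in C & forall y, quo y \in C -> rk le y <= rk le x.
Proof.
pose r (X : Q) := \max_(x in val X) rk le x.
have r_quo x : r (quo x) = rk le x.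
  apply/eqP; rewrite eqn_leq; apply/andP; split.
    by apply/bigmax_leqP => _ /orbitP[l Kl <-]; rewrite /= Krk.
  apply: (@leq_bigmax_cond _ _ (fun y => rk le y) x); exact: orbit_refl.
case/set0Pn=> X0 CX0; case: (arg_maxnP r CX0) => X; have [x <-] := quo_onto X => CX maxX.
by exists x => // y /maxX; rewrite !r_quo.
Qed.

(* Lift a chain by adding its greatest element last: the lift of that element may be moved by [K]
   above the greatest face lifted so far, and only the faces below the latter are kept. *)
Lemma quo_chain_lift (C : {set Q}) : chain quo_le C -> exists2 A, flag le A & C \subset quo @: A.
Proof.
have [k] := ubnP #|C|; elim: k C => // k IH C; rewrite ltnS => oC chC.
have [->|/quo_greatest[m Cm max_m]] := eqVneq C set0.
  have [|A fA _] := @chain_flag _ le set0; first by apply/chainP => x y; rewrite inE.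
  by exists A; rewrite ?sub0set.
have [|A fA sA] := IH (C :\ quo m) _ (chainS (subD1set _ _) chC).
  by rewrite (leq_trans _ oC) // [X in _ < X](cardsD1 (quo m)) Cm.
have [C0|/quo_greatest[x1 Cx1 max_x]] := eqVneq (C :\ quo m) set0.
  have [B fB Bm] := flag1 po m; exists B => //.
  by move/eqP: C0; rewrite setD_eq0 => /subset_trans-> //; rewrite sub1set imset_f.
have /imsetP[x Ax eq_x] := subsetP sA _ Cx1; rewrite eq_x in Cx1.
have r_x := quo_eq_rk eq_x; have /setD1P[neq_xm Cx] := Cx1.
have [l Kl xm] : exists2 l, l \in K & le x (l m).
  apply/quo_leP; have /chainP/(_ _ _ Cx Cm)/orP[//|mx] := chC.
  case/eqP: neq_xm; apply/esym/quo_le_eq => //; apply/eqP.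
  by rewrite eqn_leq quo_le_rk //= max_m.
have chU : chain le ([set l m] :|: [set z in A | le z x]).
  apply: chainU (chain1 (lexx _)) _ _ => [|_ z /set1P->]; last first.
    by rewrite inE => /andP[_ zx]; rewrite (le_trans zx xm) orbT.
  by apply: chainS (flag_chain fA); apply/subsetP => z; rewrite inE => /andP[].
have [B fB /subsetP sB] := chain_flag chU; exists B => //; apply/subsetP => Y CY.
have [->|neq_Ym] := eqVneq Y (quo m).
  by rewrite -(quoK m Kl) imset_f // sB // !inE eqxx.
have CY' : Y \in C :\ quo m by rewrite !inE neq_Ym.
have /imsetP[z Az defY] := subsetP sA _ CY'; rewrite defY imset_f // sB // !inE Az.
by rewrite (flag_le po fs fA) // -r_x max_x ?orbT // -defY.
Qed.

Lemma quo_inj A x y : flag le A -> x \in A -> y \in A -> quo x = quo y -> x = y.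
Proof. by move=> fA Ax Ay /quo_eq_rk; apply: (flag_inj po fs fA). Qed.

Lemma quo_card A : flag le A -> #|quo @: A| = n.+2.
Proof. by move=> fA; rewrite card_in_imset ?fs // => x y; apply: quo_inj. Qed.

Lemma quo_flag_lift (F : {set Q}) : flag quo_le F -> exists2 A, flag le A & F = quo @: A.
Proof.
move=> fF; have [A fA sFA] := quo_chain_lift (flag_chain fF); exists A => //.
apply/eqP; rewrite eqEsubset sFA; apply/subsetP => Y AY.
have /chainP chA := quo_chain fA.
apply: (flag_max fF) => [Z /(subsetP sFA) AZ|]; first exact: chA.
by case: quo_poset => ->.
Qed.

Lemma quo_card_flag (F : {set Q}) : flag quo_le F -> #|F| = n.+2.
Proof. by case/quo_flag_lift=> A fA ->; apply: quo_card. Qed.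

Lemma quo_flag A : flag le A -> flag quo_le (quo @: A).
Proof.
by move=> fA; apply: (chain_card_flag quo_card_flag); [apply: quo_chain | apply: quo_card].
Qed.

Lemma quo_rk x : rk quo_le (quo x) = rk le x.
Proof.
have [A fA Ax] := flag1 po x.
rewrite (rk_flag quo_poset quo_card_flag (quo_flag fA)) ?imset_f // (rk_flag po fs fA Ax).
rewrite -[RHS](card_in_imset (f := quo)); last first.
  by move=> y z; rewrite !inE => /andP[Ay _] /andP[Az _]; apply: quo_inj fA Ay Az.
apply: eq_card => Y; apply/idP/imsetP => [|[z]]; rewrite !inE.
  case/andP=> /imsetP[z Az ->] /quo_le_rk zx.
  by exists z; rewrite // !inE Az (flag_le po fs fA).
by case/andP=> Az zx ->; rewrite imset_f ?quo_le_mono.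
Qed.

Hypothesis alignK : aligning le K.

Lemma quo_flag_eq A B : flag le A -> flag le B -> quo @: A = quo @: B ->
  exists2 k, k \in K & k @: A = B.
Proof.
move=> fA fB eqAB; have [x y Ax By rxy _|k Kk kAB] := @alignK A B predT fA fB.
  apply/quoP/eqP; apply: (flag_inj quo_poset quo_card_flag (quo_flag fB)).
  - by rewrite -eqAB; apply: imset_f.
  - exact: imset_f.
  by rewrite !quo_rk.
exists k => //; apply: (flag_sub fs) => //; first exact: (aut_flag polyP) (subsetP sKG k Kk) fA.
apply/subsetP=> _ /imsetP[x Ax ->]; have [y By ry] := flag_rk po fs x fB.
by rewrite (kAB x y).
Qed.

Lemma quo_interval_lift x z (Y : Q) : le x z -> quo_le (quo x) Y -> quo_le Y (quo z) ->
  exists y, [/\ quo y = Y, le x y & le y z].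
Proof.
move=> xz xY Yz; have [A [fA Ax Az]] := flag2 po xz.
have [P [fP Px PY Pz]] := flag3 quo_poset xY Yz.
have [B fB defP] := quo_flag_lift fP.
move: Px PY Pz; rewrite defP => /imsetP[x1 Bx1 eq_x] /imsetP[y1 By1 defY] /imsetP[z1 Bz1 eq_z].
have [u v Bu Av ruv|k Kk kBA] := @alignK B A (mem [:: rk le x; rk le z]) fB fA.
  rewrite !inE (quo_eq_rk eq_x) (quo_eq_rk eq_z) => /orP[]/eqP ru; apply/quoP.
    rewrite (flag_inj po fs fB Bu Bx1 ru) -eq_x; apply/eqP; congr quo.
    by apply: (flag_inj po fs fA) => //; rewrite (quo_eq_rk eq_x) -ru.
  rewrite (flag_inj po fs fB Bu Bz1 ru) -eq_z; apply/eqP; congr quo.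
  by apply: (flag_inj po fs fA) => //; rewrite (quo_eq_rk eq_z) -ru.
have [kx kz] : k x1 = x /\ k z1 = z.
  by split; apply: kBA; rewrite // -?(quo_eq_rk eq_x) -?(quo_eq_rk eq_z) // !inE eqxx ?orbT.
have ak := elimT (autgP _ _) (subsetP sKG k Kk).
have [x1y1 y1z1] : quo_le (quo x1) (quo y1) /\ quo_le (quo y1) (quo z1).
  by rewrite -eq_x -eq_z -defY.
by exists (k y1); rewrite quoK // -kx -kz !ak !(flag_le po fs fB) // !quo_le_rk.
Qed.

Hypothesis freeK : swap_free le n K.

Lemma quo_swap_neq A i : flag le A -> letter n i -> quo @: swap le i A <> quo @: A.
Proof.
move=> fA li /esym eqS; have [k Kk] := quo_flag_eq fA (flag_swap i fA) eqS.
exact: freeK.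
Qed.

Lemma quo_swap_agree A i : flag le A -> agree quo_le i (quo @: A) (quo @: swap le i A).
Proof.
by move=> fA _ /imsetP[x Ax ->]; rewrite quo_rk => nx; apply/imset_f/(swap_agree fA).
Qed.

Let quo_swap_face A i x y : flag le A -> letter n i -> x \in A -> y \in swap le i A ->
  rk le x = i -> quo x <> quo y.
Proof.
move=> fA li Ax Sy rx eq_q; apply: (quo_swap_neq fA li); apply/esym.
have [qA qS] := (quo_flag fA, quo_flag (flag_swap i fA)).
apply: (agree_face quo_poset quo_card_flag qA qS (quo_swap_agree fA) (imset_f _ Ax)).
  by rewrite eq_q imset_f.
by rewrite quo_rk.
Qed.

Lemma quo_adjacent A i : flag le A -> letter n i -> adjacent (quo @: A) (quo @: swap le i A).
Proof.
move=> fA li; have [x Ax rx] := letter_face polyP fA li.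
apply/cards1P; exists (quo x); apply/setP => Y; rewrite !inE.
apply/andP/eqP => [[nY /imsetP[z Az defY]]|->].
  rewrite defY; congr quo; apply: (flag_inj po fs fA) => //; rewrite rx; apply/eqP.
  by apply: contraR nY => /eqP nz; rewrite defY quo_swap_agree ?imset_f ?quo_rk.
split; last exact: imset_f.
by apply/negP => /imsetP[y Sy]; apply: quo_swap_face Sy rx.
Qed.

Let quo_inj_between E F : ltp le E F -> rk le F = (rk le E).+2 ->
  {in [set H | ltp le E H && ltp le H F] &, injective quo}.
Proof.
move=> EF rEF y y'; rewrite !inE => hy hy' eq_q; apply/eqP/negPn/negP => /eqP neq_y.
have /andP[/andP[_ Ey] /andP[_ yF]] := hy.
have [A [fA AE Ay AF]] := flag3 po Ey yF; have li := letter_between polyP rEF.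
have ry : rk le y = (rk le E).+1.
  case/andP: hy => /(ltp_rk po fs) ry1 /(ltp_rk po fs); rewrite rEF ltnS => ry2.
  by apply/eqP; rewrite eqn_leq ry2.
have [x Sx rx] := letter_face polyP (flag_swap (rk le E).+1 fA) li.
have [_ _ _ hx] :=
  agree_diamond polyP fA (flag_swap _ fA) (swap_agree fA) AE AF Ay Sx erefl rEF ry rx.
have def_y' : y' = x.
  apply: (diamond_unique polyP rEF EF hy hy' hx) => [eq_y|]; first exact: neq_y.
  exact: (swap_face_neq polyP fA li Ay Sx rx).
by apply: (quo_swap_face fA li Ay Sx ry); rewrite eq_q def_y'.
Qed.

Let quo_diamond : diamond quo_le.
Proof.
move=> E0 F0; have [E <-] := quo_onto E0; have [F <-] := quo_onto F0.
move=> /andP[_ /quo_leP[k Kk]]; rewrite -(quoK F Kk) !quo_rk.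
move: (k F) => {Kk k F0}{}F leEF rEF.
have quo_ltp x y : le x y -> ltp quo_le (quo x) (quo y) = ltp le x y.
  move=> xy; rewrite /ltp xy quo_le_mono // !andbT; congr (~~ _).
  by apply/eqP/eqP => [/quo_eq_rk/(le_rk_eq po fs xy)|->].
have ltEF : ltp le E F.
  by rewrite /ltp leEF andbT; apply: contra_eqN rEF => /eqP->; rewrite ltn_eqF.
have [_ _ _ dia _] := polyP; rewrite -(dia E F ltEF rEF).
rewrite -(card_in_imset (quo_inj_between ltEF rEF)); apply: eq_card => Y.
rewrite inE; apply/idP/imsetP => [/andP[EY YF]|[y + ->]]; last first.
  rewrite inE => /andP[Ey yF].
  by case/andP: (Ey) (yF) => [_ leEy] /andP[_ leyF]; rewrite !quo_ltp ?Ey.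
have [y [defY leEy leyF]] := quo_interval_lift leEF (proj2 (andP EY)) (proj2 (andP YF)).
by exists y; rewrite ?defY // inE -!quo_ltp // defY EY.
Qed.

Let quo_connected : strongly_flag_connected quo_le.
Proof.
move=> P0 P1 /quo_flag_lift[A fA ->] /quo_flag_lift[B fB ->].
pose I i := [exists x in A, [exists y in B, [&& rk le x == i, rk le y == i & quo x == quo y]]].
have [x y Ax By rxy|k Kk kAB] := @alignK A B I fA fB.
  case/exists_inP=> x1 Ax1 /exists_inP[y1 By1 /and3P[/eqP rx1 /eqP ry1 eq_q]]; apply/quoP.
  have -> : x = x1 by apply: (flag_inj po fs fA).
  by have -> : y = y1 by apply: (flag_inj po fs fB); rewrite // -rxy.
have Gk := subsetP sKG k Kk; have fkA := aut_flag polyP Gk fA.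
have defA : quo @: (k @: A) = quo @: A.
  by rewrite -imset_comp; apply: eq_imset => x /=; rewrite quoK.
have [w [lw rw avoid]] := run_connect polyP fkA fB.
have [|||s [ps ls sL]] :=
  @run_path _ le n _ (fun X => quo @: X) (k @: A :&: B) (k @: A) w fkA _ lw.
- exact: subsetIl.
- by move=> i x iw /setIP[Ax Bx]; apply: avoid.
- by move=> C i fC _ _ li; apply: quo_adjacent.
rewrite /= defA rw in ps ls; exists s; split=> //.
apply/allP => L /sL[C [fC /subsetP sC ->]]; rewrite quo_flag //=.
apply/subsetP => Z /setIP[/imsetP[x Ax ->] /imsetP[y By eq_q]].
have kx : k x = y.
  apply: kAB; rewrite ?(quo_eq_rk eq_q) //; apply/exists_inP; exists x => //.
  by apply/exists_inP; exists y; rewrite // eq_q (quo_eq_rk eq_q) !eqxx.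
by rewrite eq_q; apply: imset_f; apply: sC; rewrite inE By -kx imset_f.
Qed.

Lemma quo_polytope : polytope quo_le n.
Proof.
have [[_ [b hb]] [t ht] _ _ _] := polyP.
split=> //; first split; first exact: quo_poset.
- by exists (quo b) => X; have [x <-] := quo_onto X; apply: quo_le_mono.
- by exists (quo t) => X; have [x <-] := quo_onto X; apply: quo_le_mono.
exact: quo_card_flag.
Qed.

Lemma quo_covering : covering le quo_le quo.
Proof.
split; [exact: quo_onto | exact: quo_rk | exact: quo_le_mono |].
by move=> P R fP fR /(adjacent_swap polyP fP fR)[i li ->]; apply: quo_adjacent.
Qed.

Lemma quo_aut g : g \in G -> g \in 'N(K) ->
  exists2 g' : {perm Q}, g' \in autg quo_le & forall x, g' (quo x) = quo (g x).
Proof.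
move=> Gg nKg; have ag := elimT (autgP _ _) Gg.
have gV : g^-1 \in 'N(K) by rewrite groupV.
have normK h k x : h \in 'N(K) -> k \in K -> exists2 l, l \in K & h (k x) = l (h x).
  move=> nKh Kk; exists (k ^ h); first by rewrite memJ_norm.
  by rewrite -!permM conjgE !mulgA mulgV mul1g.
have quo_g x y : (quo (g x) == quo (g y)) = (quo x == quo y).
  apply/quoP/quoP => -[k Kk eq_k].
    have [l Kl def_l] := normK _ k (g x) gV Kk; rewrite permK in def_l.
    by exists l; rewrite // -def_l eq_k permK.
  by have [l Kl def_l] := normK g k x nKg Kk; exists l; rewrite // -def_l eq_k.
have quo_g_le x y : quo_le (quo (g x)) (quo (g y)) = quo_le (quo x) (quo y).
  apply/quo_leP/quo_leP => -[k Kk le_k].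
    have [l Kl def_l] := normK _ k (g y) gV Kk; rewrite permK in def_l.
    by exists l => //; rewrite -ag -def_l permKV.
  by have [l Kl def_l] := normK g k y nKg Kk; exists l; rewrite // -def_l ag.
have [rep repK] : exists rep : Q -> T, forall X, quo (rep X) = X := fin_all_exists quo_onto.
have inj_g : injective (fun X => quo (g (rep X))).
  by move=> X Y /eqP; rewrite quo_g !repK => /eqP.
exists (perm inj_g) => [|x]; last by apply/eqP; rewrite permE quo_g repK.
by apply/autgP => X Y; rewrite !permE quo_g_le !repK.
Qed.

Lemma quo_imset g (g' : {perm Q}) A :
  (forall x, g' (quo x) = quo (g x)) -> g' @: (quo @: A) = quo @: (g @: A).
Proof. by move=> def_g; rewrite -!imset_comp; apply: eq_imset => x /=; rewrite def_g. Qed.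

Lemma quo_fix_mem g : g \in G -> (forall x, quo (g x) = quo x) -> g \in K.
Proof.
move=> Gg fix_g; have [|A fA _] := @chain_flag _ le set0; first by apply/chainP => x y; rewrite inE.
have [|k Kk kA] := quo_flag_eq fA (aut_flag polyP Gg fA).
  by rewrite -imset_comp; apply: eq_imset => x /=; rewrite fix_g.
by rewrite (aut_eq polyP Gg (subsetP sKG k Kk) fA (esym kA)).
Qed.

Lemma quo_morphism : G \subset 'N(K) -> exists f : {morphism G >-> {perm Q}},
  forall g, g \in G -> f g \in autg quo_le /\ forall x, f g (quo x) = quo (g x).
Proof.
move=> nKG; apply: (functional_morphism (R := fun g (g' : {perm Q}) =>
  g' \in autg quo_le /\ forall x, g' (quo x) = quo (g x))).
- by move=> g Gg; have [g' Gg' def_g] := quo_aut Gg (subsetP nKG g Gg); exists g'.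
- move=> g u v _ [_ def_u] [_ def_v]; apply/permP => X.
  by have [x <-] := quo_onto X; rewrite def_u def_v.
move=> g h u v _ _ [Gu def_u] [Gv def_v]; split=> [|x]; first exact: groupM.
by rewrite !permM def_u def_v.
Qed.

End Quotient.

Section ChiralQuotients.

Variables (T : finType) (le : rel T) (n : nat).
Hypotheses (polyP : polytope le n) (chiralP : chiral le).
Local Notation G := (autg le).

Lemma swap_free_aut (K : {set {perm T}}) : K \subset G -> swap_free le n K.
Proof. by move=> sKG k A i /(subsetP sKG); apply: (no_aut_swap polyP chiralP). Qed.

Variable K : {group {perm T}}.
Hypotheses (nsKG : K <| G) (alignK : aligning le K).
Local Notation q := (quo K).
Local Notation qle := (quo_le le (K := K)).
Implicit Types (A B : {set T}) (g : {perm T}) (i c : nat).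

Let sKG : K \subset G := normal_sub nsKG.
Let freeK : swap_free le n K := swap_free_aut sKG.
Let polyQ : polytope qle n := quo_polytope polyP sKG alignK freeK.
Let qmap : flag_map le qle n q :=
  covering_flag_map polyP polyQ (quo_covering polyP sKG alignK freeK).
Let fq A : flag le A -> flag qle (q @: A). Proof. by case: qmap => _ + _; apply. Qed.
Let qS A i : flag le A -> letter n i -> q @: swap le i A = swap qle i (q @: A).
Proof. by case: qmap => _ _; apply. Qed.

Lemma quo_same_orbit A B : same_orbit le A B -> same_orbit qle (q @: A) (q @: B).
Proof.
case/same_orbitP=> g Gg <-; have nKg := subsetP (normal_norm nsKG) _ Gg.
have [g' Gg' def_g] := quo_aut sKG Gg nKg.
by apply/same_orbitP; exists g'; rewrite ?(quo_imset _ def_g).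
Qed.

Lemma quo_chiral A c : flag le A -> letter n c ->
  ~ same_orbit qle (q @: A) (q @: swap le c A) -> chiral qle.
Proof.
move=> fA lc nAS; have fS := flag_swap c fA; split=> [X Y fX fY|].
  case/(adjacent_swap polyQ fX fY) => i li ->; have [B fB ->] := quo_flag_lift polyP sKG fX.
  rewrite -qS // => oB; apply: nAS.
  have to_B C : flag le C -> same_orbit qle (q @: C) (q @: B).
    move=> fC; have [/quo_same_orbit //|/quo_same_orbit oC] := flag_orbit2 polyP chiralP fC fB li.
    exact: same_orbit_trans oC (same_orbit_sym oB).
  exact: same_orbit_trans (to_B _ fA) (same_orbit_sym (to_B _ fS)).
exists (q @: A), (q @: swap le c A); split; rewrite ?fq // => X fX.
have [B fB ->] := quo_flag_lift polyP sKG fX.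
by have [] := flag_orbit2 polyP chiralP fB fA lc; move/quo_same_orbit/same_orbit_sym; [left|right].
Qed.

Section QuotientMorphism.

Variable f : {morphism G >-> {perm {O : {set T} | O \in [set orbit 'P K x | x : T]}}}.
Hypothesis fP : forall g, g \in G -> f g \in autg qle /\ forall x, f g (q x) = q (g x).
Let Gf g : g \in G -> f g \in autg qle. Proof. by case/fP. Qed.
Let f_imset g A : g \in G -> f g @: (q @: A) = q @: (g @: A).
Proof. by case/fP=> _ /quo_imset. Qed.

Lemma ker_quo : 'ker f \subset K.
Proof.
apply/subsetP => g /morphpreP[Gg /set1P fg1].
by apply: (quo_fix_mem polyP sKG alignK Gg) => x; case: (fP Gg) => _ <-; rewrite fg1 perm1.
Qed.

Lemma quo_aut_word A w : flag le A -> even_word n w ->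
  f (aut_word le A w) = aut_word qle (q @: A) w.
Proof.
move=> fA ew; have Gw := aut_word_autg polyP chiralP fA ew; have /andP[lw _] := ew.
apply/esym/(aut_word_unique polyQ (Gf Gw) (fq fA)).
by rewrite f_imset // (imset_aut_word polyP chiralP) // (flag_map_run qmap).
Qed.

Lemma quo_autE A i : flag le A -> letter n i -> chiral qle -> f @* G = autg qle.
Proof.
move=> fA li chiralQ; apply/eqP; rewrite eqEsubset; apply/andP; split.
  by apply/subsetP => _ /morphimP[g Gg _ ->]; apply: Gf.
apply/subsetP => g' Gg'; have [B fB def_B] := quo_flag_lift polyP sKG (aut_flag polyQ Gg' (fq fA)).
have [/same_orbitP[g Gg gA]|oA] := flag_orbit2 polyP chiralP fA fB li.
  rewrite (aut_eq polyQ Gg' (Gf Gg) (fq fA)) ?mem_morphim //.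
  by rewrite f_imset // gA.
case: (swap_orbit polyQ chiralQ (fq fB) li); rewrite -qS //.
apply: same_orbit_trans (quo_same_orbit oA); apply: same_orbit_sym.
by rewrite -def_B; apply/same_orbitP; exists g'.
Qed.

End QuotientMorphism.

End ChiralQuotients.

Section RankFour.

Variables (T : finType) (le : rel T) (F : {set T}).
Hypotheses (polyP : polytope le 4) (chiralP : chiral le) (fF : flag le F).
Local Notation G := (autg le).
Local Notation stab := (face_stab le F).
Local Notation s1 := (rot le F 1).
Local Notation s2 := (rot le F 2).
Local Notation s3 := (rot le F 3).
Implicit Types (g h : {perm T}) (i j : nat).

Lemma stabI_cycle i j k : perm_eq [:: i.+1; i.+2; j; k] [:: 2; 3; 4; 5] ->
  stab j :&: stab k = <[rot le F i]>.
Proof.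
move=> eq_l; have letter_mem l : letter 4 l = (l \in [:: i.+1; i.+2; j; k]).
  by rewrite (perm_mem eq_l) letter4.
have uniq_l : uniq [:: i.+1; i.+2; j; k] by rewrite (perm_uniq eq_l).
have ir : 0 < i < 4.
  have [] : letter 4 i.+1 /\ letter 4 i.+2 by rewrite !letter_mem !inE !eqxx ?orbT.
  by rewrite /letter; clear; lia.
apply/eqP; rewrite eqEsubset subsetI !(cycle_rot_stab polyP chiralP fF ir) ?andbT.
- apply/subsetP => g /setIP[gj gk]; have Gg := subsetP (face_stab_sub _ _ _) _ gj.
  apply: (mem_cycle_rot polyP chiralP fF ir Gg) => l.
  by rewrite letter_mem mem_seq4 mem_seq2 => /or4P[]/eqP->; rewrite ?eqxx ?orbT.
- by move: uniq_l; rewrite /= !inE; clear; lia.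
by move: uniq_l; rewrite /= !inE; clear; lia.
Qed.

Lemma rot12 : s1 * s2 = aut_word le F [:: 4; 2].
Proof. exact: (rotM polyP chiralP fF). Qed.

Lemma rot23 : s2 * s3 = aut_word le F [:: 5; 3].
Proof. exact: (rotM polyP chiralP fF). Qed.

Lemma rot123 : s1 * s2 * s3 = aut_word le F [:: 5; 2].
Proof.
rewrite rot12 (aut_wordM polyP chiralP fF) //.
by apply: eq_aut_word; rewrite /= (swapK polyP) // flag_swap.
Qed.

Lemma rot12_sq1 : (s1 * s2) ^+ 2 = 1.
Proof. by rewrite rot12 (aut_word_far_sq1 polyP chiralP fF). Qed.

Lemma rot23_sq1 : (s2 * s3) ^+ 2 = 1.
Proof. by rewrite rot23 (aut_word_far_sq1 polyP chiralP fF). Qed.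

Lemma rot123_sq1 : (s1 * s2 * s3) ^+ 2 = 1.
Proof. by rewrite rot123 (aut_word_far_sq1 polyP chiralP fF). Qed.

Lemma rot3_conj_rot12 : s3 ^ (s1 * s2) = s3^-1.
Proof. exact: invg_conj_involution rot12_sq1 rot123_sq1. Qed.

Lemma rot1_conj_rot23 : s1 ^ (s2 * s3) = s1^-1.
Proof.
by apply: (invg_conj_involution rot23_sq1); apply: mulg_sq1C; rewrite mulgA rot123_sq1.
Qed.

Lemma stab3E : <[s1 * s2]> * <[s3]> = stab 3.
Proof.
apply/eqP; rewrite eqEsubset; apply/andP; split.
  by rewrite mul_subG // cycle_subG ?rot12 (aut_word_stab polyP chiralP fF).
rewrite -norm_joinEl; last by rewrite cycle_subG inE -cycleJ rot3_conj_rot12 cycleV.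
apply/subsetP => g g3; have Gg := subsetP (face_stab_sub _ _ _) _ g3.
apply: (@stab_gen _ _ _ polyP chiralP (mem [:: 2; 4; 5]) 4 isT (<[s1 * s2]> <*> <[s3]>)%G F) => //.
  move=> i; rewrite !inE => /or3P[]/eqP-> _.
  - rewrite -groupV (aut_wordV polyP chiralP fF) // -rot12.
    by rewrite mem_gen // inE cycle_id.
  - by rewrite (aut_word1 polyP fF) ?group1 //= (swapK polyP).
  by rewrite mem_gen // inE cycle_id orbT.
by move=> i; rewrite letter4 mem_seq4 => /or4P[]/eqP->.
Qed.

Lemma stab4E : <[s1]> * <[s2 * s3]> = stab 4.
Proof.
apply/eqP; rewrite eqEsubset; apply/andP; split.
  by rewrite mul_subG // cycle_subG ?rot23 (aut_word_stab polyP chiralP fF).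
rewrite -norm_joinEr; last by rewrite cycle_subG inE -cycleJ rot1_conj_rot23 cycleV.
apply/subsetP => g g4; have Gg := subsetP (face_stab_sub _ _ _) _ g4.
apply: (@stab_gen _ _ _ polyP chiralP (mem [:: 2; 3; 5]) 3 isT (<[s1]> <*> <[s2 * s3]>)%G F) => //.
  move=> i; rewrite !inE => /or3P[]/eqP-> _.
  - rewrite -groupV (aut_wordV polyP chiralP fF) //.
    by rewrite mem_gen // inE cycle_id.
  - by rewrite (aut_word1 polyP fF) ?group1 //= (swapK polyP).
  by rewrite -rot23 mem_gen // inE cycle_id orbT.
by move=> i; rewrite letter4 mem_seq4 => /or4P[]/eqP->.
Qed.

Let s_autg i : 0 < i < 4 -> rot le F i \in G. Proof. exact: rot_autg. Qed.

Lemma prod_rot_orders4 : (\prod_(p <- rot_orders le 4 F) p)%N = (#[s1] * (#[s2] * #[s3]))%N.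
Proof. by rewrite /rot_orders /mkseq /= !big_cons big_nil muln1. Qed.

Lemma cycle1_stab2_TI : <[s1]> :&: stab 2 = 1.
Proof. exact: (cycle_rot_stab_TI polyP chiralP fF). Qed.

Lemma stab5_cycle3_TI : stab 5 :&: <[s3]> = 1.
Proof. by rewrite setIC; apply: (cycle_rot_stab_TI polyP chiralP fF). Qed.

Lemma cycle12_sub_stab5 : <[s1]> * <[s2]> \subset stab 5.
Proof. by rewrite mul_subG // (cycle_rot_stab polyP chiralP fF). Qed.

Lemma cycle23_sub_stab2 : <[s2]> * <[s3]> \subset stab 2.
Proof. by rewrite mul_subG // (cycle_rot_stab polyP chiralP fF). Qed.

Lemma card_cycle23 : #|<[s2]> * <[s3]>| = (#[s2] * #[s3])%N.
Proof. by rewrite TI_cardMg // (cycle_rot_TI polyP chiralP fF). Qed.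

Lemma card_cycle1_stab2 : #|<[s1]> * stab 2| = (#[s1] * #|stab 2|)%N.
Proof. by rewrite TI_cardMg // cycle1_stab2_TI. Qed.

Lemma cycle1_stab2_sub : <[s1]> * stab 2 \subset G.
Proof. by rewrite mul_subG ?face_stab_sub // cycle_subG s_autg. Qed.

Lemma leq_card_stab2 : #[s2] * #[s3] <= #|stab 2|.
Proof. by rewrite -card_cycle23 subset_leq_card ?cycle23_sub_stab2. Qed.

Lemma leq_card_autg : #[s1] * (#[s2] * #[s3]) <= #|G|.
Proof.
apply: leq_trans (subset_leq_card cycle1_stab2_sub).
by rewrite card_cycle1_stab2 leq_mul2l leq_card_stab2 orbT.
Qed.

Hypothesis card_G : #|G| = (#[s1] * (#[s2] * #[s3]))%N.

Lemma card_stab2 : #|stab 2| = (#[s2] * #[s3])%N.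
Proof.
apply/eqP; rewrite eqn_leq leq_card_stab2 andbT.
rewrite -(leq_pmul2l (order_gt0 s1)) -card_G -card_cycle1_stab2.
by rewrite subset_leq_card ?cycle1_stab2_sub.
Qed.

Lemma stab2E : <[s2]> * <[s3]> = stab 2.
Proof. by apply/eqP; rewrite eqEcard cycle23_sub_stab2 card_cycle23 card_stab2 leqnn. Qed.

Lemma autgE : <[s1]> * stab 2 = G.
Proof.
by apply/eqP; rewrite eqEcard cycle1_stab2_sub card_cycle1_stab2 card_stab2 card_G leqnn.
Qed.

Lemma stab5E : <[s1]> * <[s2]> = stab 5.
Proof.
apply/eqP; rewrite eqEcard cycle12_sub_stab5 TI_cardMg ?(cycle_rot_TI polyP chiralP fF) //=.
have card52 : (#|stab 5| * #|stab 2| <= #|G| * #[s2])%N.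
  rewrite mul_cardG setIC (@stabI_cycle 2) // leq_mul2r subset_leq_card ?orbT //.
  by rewrite mul_subG ?face_stab_sub.
rewrite -(leq_pmul2r (order_gt0 s2)) -(leq_pmul2r (order_gt0 s3)).
by rewrite -mulnA -card_stab2 (leq_trans card52) // card_G mulnA mulnAC.
Qed.

Section CompatibleKernel.

Variable K : {group {perm T}}.
Hypotheses (nsKG : K <| G) (capK1 : <[s1]> :&: K * stab 2 \subset K)
  (capK3 : <[s3]> :&: K * stab 5 \subset K).
Hypotheses (Ks1 : s1 \notin K) (Ks2 : s2 \notin K) (Ks3 : s3 \notin K).
Local Notation q := (coset K).

Let nKG : G \subset 'N(K) := normal_norm nsKG.
Let nK g : g \in G -> g \in 'N(K). Proof. exact: (subsetP nKG). Qed.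
Let cycle_autg i : 0 < i < 4 -> <[rot le F i]> \subset G.
Proof. by rewrite cycle_subG; apply: s_autg. Qed.
Let sAG := subsetP (cycle_autg (isT : 0 < 1 < 4)).
Let sBG := subsetP (cycle_autg (isT : 0 < 2 < 4)).
Let sDG := subsetP (cycle_autg (isT : 0 < 3 < 4)).

Let qM : {in G &, {morph q : x y / x * y}}.
Proof. by move=> x y Gx Gy; rewrite morphM ?nK. Qed.

Let tiK1 : <[s1]> / K :&: stab 2 / K = 1.
Proof. exact: quotient_TI. Qed.

Let tiK3 : stab 5 / K :&: <[s3]> / K = 1.
Proof. by rewrite setIC quotient_TI. Qed.

Let coset_factors a b d a' b' d' :
  a \in <[s1]> -> b \in <[s2]> -> d \in <[s3]> -> a' \in <[s1]> -> b' \in <[s2]> -> d' \in <[s3]> ->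
  q (a * b * d) = q (a' * b' * d') -> [/\ q a = q a', q b = q b' & q d = q d'].
Proof.
move=> Aa Bb Dd Aa' Bb' Dd'.
have [Ga Gb Gd] := And3 (sAG Aa) (sBG Bb) (sDG Dd).
have [Ga' Gb' Gd'] := And3 (sAG Aa') (sBG Bb') (sDG Dd').
rewrite !qM ?groupM // => eq_abd.
have stabs b1 d1 : b1 \in <[s2]> -> d1 \in <[s3]> -> q b1 * q d1 \in stab 2 / K.
  by move=> Bb1 Dd1; rewrite -(qM (sBG Bb1) (sDG Dd1)) mem_quotient // -stab2E mem_mulg.
have eq_a : q a = q a'.
  by apply: (TI_mulg_inj tiK1 _ _ (stabs b d Bb Dd) (stabs b' d' Bb' Dd'));
    rewrite ?mem_quotient // !mulgA.
move: eq_abd; rewrite eq_a -!mulgA => /mulgI eq_bd.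
have Sq b1 : b1 \in <[s2]> -> q b1 \in stab 5 / K.
  by move=> Bb1; rewrite mem_quotient // -stab5E -[b1]mul1g mem_mulg.
have eq_b : q b = q b'.
  by apply: (TI_mulg_inj tiK3 (Sq b Bb) (Sq b' Bb') _ _ eq_bd); rewrite mem_quotient.
by split=> //; move: eq_bd; rewrite eq_b => /mulgI.
Qed.

Let coset_rep s x : s \in 'N(K) -> s \notin K -> x \in <[s]> ->
  exists2 y, y \in <[s]> & [/\ q y = q x, q x = q 1 -> y = 1 & q x = q s -> y = s].
Proof.
move=> nKs Ks sx; have nqs : q s <> q 1 by rewrite morph1 => /(coset_idr nKs); apply/negP.
have [->|/eqP nqx1] := eqVneq (q x) (q 1); first by exists 1 => //; split=> // /esym.
have [->|/eqP nqxs] := eqVneq (q x) (q s); first by exists s; first exact: cycle_id.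
by exists x.
Qed.

(* Representatives modulo [K] of the three factors, chosen to be 1 or the rotation itself whenever
   possible, bring every coset to a form lying in all the face stabilisers it meets. *)
Lemma coset_normal_form g : g \in G -> exists2 y, y \in G &
  q y = q g /\ forall i, letter 4 i -> q g \in stab i / K -> y \in stab i.
Proof.
rewrite -{1}autgE => /mulsgP[a c Aa]; rewrite -{1}stab2E => /mulsgP[b d Bb Dd -> ->]; rewrite mulgA.
have [a0 Aa0 [qa a1 aS]] := coset_rep (nK (s_autg (isT : 0 < 1 < 4))) Ks1 Aa.
have [b0 Bb0 [qb b1 bS]] := coset_rep (nK (s_autg (isT : 0 < 2 < 4))) Ks2 Bb.
have [d0 Dd0 [qd d1 dS]] := coset_rep (nK (s_autg (isT : 0 < 3 < 4))) Ks3 Dd.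
have [Ga Gb Gd] := And3 (sAG Aa) (sBG Bb) (sDG Dd).
have [Ga0 Gb0 Gd0] := And3 (sAG Aa0) (sBG Bb0) (sDG Dd0).
exists (a0 * b0 * d0); rewrite ?groupM //; split=> [|i li].
  by rewrite !qM ?groupM // qa qb qd.
case/morphimP=> x _ Sx eq_q.
have factors a' b' d' : a' \in <[s1]> -> b' \in <[s2]> -> d' \in <[s3]> -> x = a' * b' * d' ->
    [/\ q a = q a', q b = q b' & q d = q d'].
  by move=> Aa' Bb' Dd' def_x; rewrite def_x in eq_q;
    exact: (coset_factors Aa Bb Dd Aa' Bb' Dd' eq_q).
have [A1 B1 D1] := And3 (group1 <[s1]>) (group1 <[s2]>) (group1 <[s3]>).
have [As Bs Ds] := And3 (cycle_id s1) (cycle_id s2) (cycle_id s3).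
move: li Sx; rewrite letter4 mem_seq4 => /or4P[]/eqP->.
- rewrite -{1}stab2E => /mulsgP[b' d' Bb' Dd' def_x].
  have [|/a1-> _ _] := factors 1 b' d' A1 Bb' Dd'; first by rewrite mul1g.
  by rewrite mul1g -stab2E mem_mulg.
- rewrite -{1}stab3E => /mulsgP[t d' /(cycle_involution rot12_sq1)[]-> Dd' def_x].
    have [|/a1-> /b1-> _] := factors 1 1 d' A1 B1 Dd'; first by rewrite mulg1.
    by rewrite mulg1 -stab3E mem_mulg.
  have [//|/aS-> /bS-> _] := factors s1 s2 d' As Bs Dd'.
  by rewrite -stab3E mem_mulg ?cycle_id.
- rewrite -{1}stab4E => /mulsgP[a' t Aa' /(cycle_involution rot23_sq1)[]-> def_x].
    have [|_ /b1-> /d1->] := factors a' 1 1 Aa' B1 D1; first by rewrite mulg1.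
    by rewrite mulg1 -stab4E mem_mulg.
  have [|_ /bS-> /dS->] := factors a' s2 s3 Aa' Bs Ds; first by rewrite -mulgA.
  by rewrite -mulgA -stab4E mem_mulg ?cycle_id.
rewrite -{1}stab5E => /mulsgP[a' b' Aa' Bb' def_x].
have [|_ _ /d1->] := factors a' b' 1 Aa' Bb' D1; first by rewrite mulg1.
by rewrite mulg1 -stab5E mem_mulg.
Qed.

Lemma align_images g h (I : pred nat) : g \in G -> h \in G ->
  {in F, forall x, I (rk le x) -> exists2 k, k \in K & k (g x) = h x} ->
  exists2 k, k \in K & {in F, forall x, I (rk le x) -> k (g x) = h x}.
Proof.
move=> Gg Gh align_gh; have GhV := groupVr Gh; have GgV := groupVr Gg.
have [y Gy [qy fix_y]] := coset_normal_form (groupM Gg GhV).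
exists (g^-1 * y * h) => [|x Fx Ix].
  apply: coset_idr; first by rewrite nK ?groupM.
  by rewrite !qM ?groupM // qy -!qM ?groupM // mulKg mulVg morph1.
rewrite -permM !mulgA mulgV mul1g permM; congr (h _).
have [lx|nlx] := boolP (letter 4 (rk le x)); last exact: (aut_fix_improper polyP Gy fF Fx nlx).
have [k Kk eq_k] := align_gh x Fx Ix; have Gk := subsetP (normal_sub nsKG) _ Kk.
have /face_stabP[_] : y \in stab (rk le x); last exact.
apply: fix_y lx _.
have -> : q (g * h^-1) = q (g * k * h^-1) by rewrite !qM ?groupM // (coset_id Kk) mulg1.
rewrite mem_quotient // (mem_face_stab polyP fF _ Fx erefl) ?groupM //.
by rewrite !permM eq_k permK.
Qed.

Lemma align_missing_letter j A B (I : pred nat) : letter 4 j -> ~~ I j -> flag le A -> flag le B ->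
  on_faces le A B I (fun x y => exists2 k, k \in K & k x = y) ->
  exists2 k, k \in K & on_faces le A B I (fun x y => k x = y).
Proof.
have [po fs] := (polytope_poset polyP, polytope_card_flag polyP).
move=> lj nIj fA fB align_AB.
have [g Gg gF] := flag_image_off polyP chiralP fF fA lj.
have [h Gh hF] := flag_image_off polyP chiralP fF fB lj.
have off x : I (rk le x) -> rk le x <> j by move=> Ix rx; rewrite -rx Ix in nIj.
have [x Fx Ix|k Kk kF] := @align_images g h I Gg Gh.
  by apply: align_AB; rewrite ?gF ?hF ?(aut_rk polyP) //; apply: off.
exists k => // x y Ax By rxy Ix; have [z Fz rz] := flag_rk po fs x fF.
have Iz : I (rk le z) by rewrite rz.
have -> : x = g z by apply: (flag_inj po fs fA); rewrite ?gF ?(aut_rk polyP) //; apply: off.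
have -> : y = h z.
  by apply: (flag_inj po fs fB); rewrite ?hF ?(aut_rk polyP) -?rxy ?rz //; apply: off.
exact: kF.
Qed.

Lemma kernel_neq_swap2 A k x y : k \in K -> flag le A -> x \in A -> y \in swap le 2 A ->
  rk le x = 2 -> rk le y = 2 -> k x <> y.
Proof.
suff base h l u v : h \in G -> l \in K -> u \in h @: F -> v \in swap le 2 (h @: F) ->
    rk le u = 2 -> rk le v = 2 -> l u <> v.
  move=> Kk fA Ax Sy rx ry kx.
  have [] := flag_orbit2 polyP chiralP fF fA (isT : letter 4 2) => /same_orbitP[h Gh hF].
    by rewrite -hF in Ax Sy; apply: (base h k x y).
  apply: (base h k^-1 y x); rewrite ?groupV ?hF ?(swapK polyP) //.
  by rewrite -kx permK.
move=> Gh Kl; have fS := flag_swap 2 fF; have Gs1 : s1 \in G by apply: s_autg.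
have [[_ _ hS] [_ _ s1S]] := (aut_flag_map polyP Gh, aut_flag_map polyP Gs1).
rewrite -hS // => /imsetP[z Fz ->] /imsetP[z' Sz' ->]; rewrite !(aut_rk polyP) // => rz rz' eq_l.
have s1z' : s1 z' = z.
  apply: (aut_face polyP Gs1 fS Sz'); rewrite ?rz //.
  rewrite s1S // (imset_rot polyP chiralP fF) //.
  by rewrite /= (swapK polyP) ?flag_swap //; apply: swap_agree; rewrite ?rz.
have Kl' : l ^ h^-1 \in K by rewrite memJ_norm ?nK ?groupV.
case/negP: Ks1; apply: (subsetP capK1); rewrite inE cycle_id /=.
have -> : s1 = (l ^ h^-1)^-1 * (l ^ h^-1 * s1) by rewrite mulKg.
rewrite mem_mulg ?groupV // (mem_face_stab polyP fF _ Fz rz).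
  by rewrite conjgE invgK !permM eq_l permK s1z'.
by rewrite groupM // (subsetP (normal_sub nsKG)).
Qed.

Lemma kernel_aligning : aligning le K.
Proof.
have [po fs] := (polytope_poset polyP, polytope_card_flag polyP).
move=> A B I fA fB align_AB.
have [/allP allI|/allPn[j]] := boolP (all I [:: 2; 3; 4; 5]); last first.
  by rewrite -letter4 => lj nIj; apply: align_missing_letter nIj _ _ _.
have [|x y Ax By rxy /andP[lx _]|k Kk kA] :=
  @align_missing_letter 2 A B [pred i | letter 4 i & i != 2] isT _ fA fB; first by [].
  by apply: align_AB => //; apply: allI; rewrite -letter4.
have Gk := subsetP (normal_sub nsKG) _ Kk; have fkA := aut_flag polyP Gk fA.
suff kAB : k @: A = B.
  by exists k => // x y Ax By rxy _; apply: (aut_face polyP Gk fA Ax); rewrite ?kAB.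
have agB : agree le 2 B (k @: A).
  move=> y By /eqP ry; have [ly|nly] := boolP (letter 4 (rk le y)); last first.
    exact: (improper_flag polyP fkA nly).
  have [x Ax rx] := flag_rk po fs y fA.
  by rewrite -(kA x y Ax By rx) ?imset_f // inE rx ly.
apply/eqP/negPn/negP => /eqP nkA; have defS := swap_unique polyP fB fkA agB nkA.
have [x Ax rx] := letter_face polyP fA (isT : letter 4 2).
have [y By ry] := letter_face polyP fB (isT : letter 4 2).
have [||l Kl lx] := align_AB x y Ax By; rewrite ?rx ?ry ?allI //.
have Kj : l^-1 * k \in K by rewrite groupM ?groupV.
have kSx : k x \in swap le 2 B by rewrite -defS imset_f.
apply: (kernel_neq_swap2 Kj fB By kSx ry); first by rewrite (aut_rk polyP).
by rewrite permM -lx permK.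
Qed.

Local Notation qle := (quo_le le (K := K)).
Local Notation FQ := (quo K @: F).
Local Notation Ch := (chirality_group s2 s3).

Let sKG : K \subset G := normal_sub nsKG.
Let freeK : swap_free le 4 K := swap_free_aut polyP chiralP sKG.
Let polyQ : polytope qle 4 := quo_polytope polyP sKG kernel_aligning freeK.
Let fFQ : flag qle FQ := quo_flag polyP sKG fF.
Let qmap : flag_map le qle 4 (quo K) :=
  covering_flag_map polyP polyQ (quo_covering polyP sKG kernel_aligning freeK).
Let qS i : letter 4 i -> quo K @: swap le i F = swap qle i FQ.
Proof. by move=> li; case: qmap => _ _ ->. Qed.

Lemma mirror_quo_chirality_sub :
  same_orbit qle FQ (quo K @: swap le 4 F) -> Ch \subset K.
Proof.
have [f fP] := quo_morphism sKG nKG.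
case/same_orbitP=> r Gr; rewrite qS // => rF.
apply: subset_trans (ker_quo polyP nsKG kernel_aligning fP).
have invert i j : letter 4 j -> 0 < i < 4 -> [:: i.+2; i.+1] \in [:: [:: j; 4]; [:: 4; j]] ->
    f (rot le F i) ^ r = (f (rot le F i))^-1.
  move=> lj ir; have [Gf def_f] := fP _ (s_autg ir).
  apply: (mirror_inverts polyQ Gr Gf fFQ lj (isT : letter 4 4) rF).
  rewrite (quo_imset _ def_f) (imset_rot polyP chiralP fF ir) (flag_map_run qmap) //.
  by case/andP: (even_word_rot ir).
apply: (@chirality_sub_ker _ _ _ f s2 s3 _ _ r); rewrite ?s_autg //.
  exact: (@invert 2 3).
exact: (@invert 3 5).
Qed.

Lemma quo_chiral4 : ~~ (Ch \subset K) -> chiral qle.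
Proof.
move=> nChK; apply: (quo_chiral polyP chiralP nsKG kernel_aligning fF (isT : letter 4 4)).
by move/mirror_quo_chirality_sub; apply/negP.
Qed.

End CompatibleKernel.

End RankFour.

Section AtomicKernel.

Variables (T : finType) (le : rel T) (F : {set T}) (ps : seq nat).
Hypotheses (polyP : polytope le 4) (chiralP : chiral le) (fF : flag le F) (tightP : tight le 4 ps).
Local Notation G := (autg le).
Local Notation stab := (face_stab le F).
Local Notation s1 := (rot le F 1).
Local Notation s2 := (rot le F 2).
Local Notation s3 := (rot le F 3).
Local Notation Ch := (chirality_group s2 s3).

Lemma card_tight4 : #|G| = (#[s1] * (#[s2] * #[s3]))%N.
Proof. by rewrite (tight_card_aut polyP chiralP fF _ tightP) // prod_rot_orders4. Qed.

Variable K : {group {perm T}}.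
Hypotheses (nsKG : K <| G) (capK1 : <[s1]> :&: K * stab 2 \subset K)
  (capK3 : <[s3]> :&: K * stab 5 \subset K).
Hypotheses (Ks1 : s1 \notin K) (Ks2 : s2 \notin K) (Ks3 : s3 \notin K).
Local Notation qle := (quo_le le (K := K)).
Local Notation FQ := (quo K @: F).

Let sKG : K \subset G := normal_sub nsKG.
Let alignK : aligning le K :=
  kernel_aligning polyP chiralP fF card_tight4 nsKG capK1 capK3 Ks1 Ks2 Ks3.
Let freeK := swap_free_aut polyP chiralP sKG.
Let polyQ : polytope qle 4 := quo_polytope polyP sKG alignK freeK.
Let fFQ : flag qle FQ := quo_flag polyP sKG fF.

Lemma quo_tight4 : chiral qle -> tight qle 4 (rot_orders qle 4 FQ).
Proof.
move=> chiralQ; apply: (card_aut_tight polyQ chiralQ fFQ) => //.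
apply/eqP; rewrite prod_rot_orders4 eqn_leq (leq_card_autg polyQ chiralQ fFQ) andbT.
have [f fP] := quo_morphism sKG (normal_norm nsKG).
rewrite -(quo_autE polyP chiralP nsKG alignK fP fF (isT : letter 4 2) chiralQ).
have Gs i : 0 < i < 4 -> rot le F i \in G by apply: (rot_autg polyP).
have f_cycle i : 0 < i < 4 -> f @* <[rot le F i]> = <[rot qle FQ i]>.
  move=> ir; rewrite morphim_cycle ?Gs // (quo_aut_word polyP chiralP nsKG alignK fP fF) //.
  exact: even_word_rot.
have card_mul (X Y Z : {group {perm T}}) : X * Y = Z -> X \subset G ->
    #|f @* Z| <= #|f @* X| * #|f @* Y|.
  by move=> <- sXG; rewrite morphimMl // mul_cardG leq_pmulr.
apply: leq_trans (card_mul _ _ _ (autgE polyP chiralP fF card_tight4) _) _.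
  by rewrite cycle_subG Gs.
rewrite f_cycle // leq_mul2l; apply/orP; right.
apply: leq_trans (card_mul _ _ _ (stab2E polyP chiralP fF card_tight4) _) _.
  by rewrite cycle_subG Gs.
by rewrite !f_cycle.
Qed.

Hypothesis atomic : forall (T' : finType) (le' : rel T') (m : nat) (qs : seq nat),
  polytope le' m -> chiral le' -> tight le' m qs -> ~ properly_covers le le'.

Theorem atomic_kernel : K :!=: 1 -> Ch \subset K.
Proof.
move=> ntK; apply/negPn/negP => nChK.
have chiralQ := quo_chiral4 polyP chiralP fF card_tight4 nsKG capK1 capK3 Ks1 Ks2 Ks3 nChK.
apply: (atomic polyQ chiralQ (quo_tight4 chiralQ)).
exists (quo K); split=> [|[/bij_inj inj_q _]]; first exact: (quo_covering polyP sKG alignK freeK).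
case/negP: ntK; rewrite eqEsubset sub1G andbT; apply/subsetP => k Kk.
by apply/set1gP/permP => x; rewrite perm1; apply/inj_q/quoK.
Qed.

End AtomicKernel.

(** * Polyhedra *)

Section Polyhedra.

Variables (T : finType) (le : rel T) (F : {set T}).
Hypotheses (polyP : polytope le 3) (chiralP : chiral le) (fF : flag le F).
Local Notation t1 := (rot le F 1).
Local Notation t2 := (rot le F 2).

Let aut_word_cycles i : letter 3 i ->
  (aut_word le F [:: i; 3] \in <[t1]>) || (aut_word le F [:: i; 3] \in <[t2]>).
Proof.
rewrite letter3 mem_seq3 => /or3P[]/eqP->.
- by rewrite -groupV (aut_wordV polyP chiralP fF) ?cycle_id.
- by rewrite (aut_word1 polyP fF) ?group1 //= (swapK polyP).
by rewrite cycle_id orbT.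
Qed.

Lemma autg3_sub (H : {group {perm T}}) : t1 \in H -> t2 \in H -> autg le \subset H.
Proof.
rewrite -!cycle_subG => sH1 sH2; apply/subsetP => g Gg.
apply: (@stab_gen _ _ _ polyP chiralP predT 3 isT H F) => // i _ /aut_word_cycles.
by case/orP; [apply: (subsetP sH1) | apply: (subsetP sH2)].
Qed.

(* Otherwise reflecting every word in [swap 3 F] would define an automorphism. *)
Lemma chirality_group_neq1 : chirality_group t1 t2 :!=: 1.
Proof.
apply/negP => /eqP Ch1; have fS := flag_swap 3 fF.
have loop w : all (letter 3) w -> run le F w = F -> run le (swap le 3 F) w = swap le 3 F.
  move=> lw wF; have ew : even_word 3 w.
    rewrite /even_word lw; apply/negP => /(odd_orbit polyP chiralP fF lw); apply.
    by rewrite wF; apply: same_orbit_refl.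
  rewrite -(imset_aut_word polyP chiralP fS ew).
  suff : aut_word le (swap le 3 F) w \in chirality_group t1 t2.
    by rewrite Ch1 => /set1gP->; rewrite perm_imset1.
  rewrite mem_chirality_group -(aut_word1 polyP fF wF).
  apply: (@aut_word_pair _ _ _ polyP chiralP predT 3 isT (mirror_pairs t1 t2)) ew _ => // [i _ li|].
    by rewrite (aut_word_swapV polyP chiralP) // mirror_pairs_cycle ?aut_word_cycles.
  exact/allP.
have [g Gg gF] := extend_flag polyP fF fS loop.
exact: (no_aut_swap polyP chiralP Gg fF (isT : letter 3 3) gF).
Qed.

End Polyhedra.

(** * Regular facets *)

Section Restriction.

Variables (T : finType) (D : pred T) (g : {perm T}) (g' : {perm {x : T | D x}}).
Hypothesis val_g : forall x, val (g' x) = g (val x).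

Lemma val_expg i x : val ((g' ^+ i) x) = (g ^+ i) (val x).
Proof. by elim: i x => [|i IH] x; rewrite ?perm1 // !expgSr !permM val_g IH. Qed.

Lemma val_invg x : val (g'^-1 x) = g^-1 (val x).
Proof. by apply: (@perm_inj _ g); rewrite -val_g !permKV. Qed.

End Restriction.

Section RegularFacet.

Variables (T : finType) (le : rel T) (F : {set T}).
Hypotheses (polyP : polytope le 4) (chiralP : chiral le) (fF : flag le F).
Local Notation G := (autg le).
Local Notation stab := (face_stab le F).
Local Notation s1 := (rot le F 1).
Local Notation s2 := (rot le F 2).
Local Notation s3 := (rot le F 3).
Hypothesis card_G : #|G| = (#[s1] * (#[s2] * #[s3]))%N.
Variables z x : T.
Hypotheses (Fz : z \in F) (rz : rk le z = 2) (Fx : x \in F) (rx : rk le x = 5).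
Hypothesis regF : regular (@facet_le T le x).
Let po := polytope_poset polyP.
Let fs := polytope_card_flag polyP.
Local Notation S := {y : T | le y x}.

Lemma vertex_cycle v : rk le v = 2 -> exists i, (s1 ^+ i) z = v.
Proof.
rewrite -rz => rv; have [|g Gg gz] := aut_transitive polyP chiralP fF Fz rv (isT : letter 4 3).
  by rewrite rz.
move: (groupVr Gg); rewrite /= -{1}(autgE polyP chiralP fF card_G) => /mulsgP[a c Aa Gc def_gV].
have /cycleP[i def_a] : a^-1 \in <[s1]> by rewrite groupV.
exists i; rewrite -def_a -gz -[g]invgK def_gV invMg permM; congr (a^-1 _).
by apply/esym; have /face_stabP[_] : c^-1 \in stab 2 by [rewrite groupV]; apply.
Qed.

Lemma facet_mirror : exists r t1 t2 : {perm S},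
  [/\ forall y, val (t1 y) = s1 (val y), forall y, val (t2 y) = s2 (val y),
      t1 ^ r = t1^-1, t2 ^ r = t2^-1 & forall y, val y = z -> r y = y].
Proof.
have [b Fb rb] := flag_face po fs fF (isT : 0 < 1 <= 6).
have Dx y : le y x = le b y && le y x by rewrite (least_face polyP y rb).
have bx := least_face polyP x rb; have rbx : rk le x = rk le b + 4 by rewrite rx rb.
have polyS := sub_polytope polyP Dx bx rbx; have fS := flag_sect polyP Dx bx rbx fF Fb Fx.
have lift i : lift_letter le b i = i by rewrite /lift_letter rb addn0.
have [Gt1 t1F] := sub_rot polyP Dx bx rbx chiralP fF Fb Fx (isT : 0 < 1 < 3).
have [Gt2 t2F] := sub_rot polyP Dx bx rbx chiralP fF Fb Fx (isT : 0 < 2 < 3).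
rewrite !lift => val_t2 val_t1; have /same_orbitP[r Gr rF] := regF fS (flag_swap 3 fS).
exists r; eexists; eexists; split; [exact: val_t1 | exact: val_t2 | | | move=> y def_y].
- exact: (mirror_inverts polyS Gr Gt1 fS (isT : letter 3 2) (isT : letter 3 3) rF t1F).
- exact: (mirror_inverts polyS Gr Gt2 fS (isT : letter 3 4) (isT : letter 3 3) rF t2F).
have ry : rk (@facet_le T le x) y = 2.
  by have := sub_rk polyP Dx bx rbx y; rewrite rb def_y rz addn1 => -[].
have Sy : y \in sect (fun y => le y x) F by rewrite inE def_y.
by apply: (aut_face polyS Gr fS Sy) => //; rewrite rF; apply: (swap_agree fS); rewrite ?ry.
Qed.

(* On vertices the reflection [r] of the facet acts as the involution [s2 * s3], since both fix [z]
   and invert [s1]; as [r] also inverts [s2], so does [s2 * s3] on vertices. *)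
Lemma square_fixes_vertices v : rk le v = 2 -> (s3 ^+ 2) v = v.
Proof.
have [r [t1 [t2 [val_t1 val_t2 inv1 inv2 rz']]]] := facet_mirror.
have zx : le z x by rewrite (flag_le po fs fF) // rz rx.
pose z' : S := Sub z zx.
have val_t1X i : val ((t1 ^+ i) z') = (s1 ^+ i) z by rewrite (val_expg val_t1).
have facet u : rk le u = 2 -> exists i, u = val ((t1 ^+ i) z').
  by case/vertex_cycle=> i <-; exists i.
have tauz : (s2 * s3) z = z.
  have /face_stabP[_] : s2 * s3 \in stab 2; last exact.
  by rewrite groupM // (rot_stab polyP chiralP fF).
have tau_r y : rk le (val y) = 2 -> (s2 * s3) (val y) = val (r y).
  case/facet=> i /val_inj->; rewrite val_t1X -[LHS]permJ -[X in val X]permJ tauz rz' //.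
  by rewrite !conjXg inv1 (rot1_conj_rot23 polyP chiralP fF) (val_expg (val_invg val_t1)).
have Gs2 := rot_autg polyP chiralP fF (isT : 0 < 2 < 4).
move=> rv; have ru : rk le (s2^-1 v) = 2 by rewrite (aut_rk polyP) ?groupV.
have [i def_u] := facet _ ru; set y : S := (t1 ^+ i) z' in def_u.
have tau_s2 : (s2 * s3) v = s2^-1 (s3 v).
  have -> : v = val (t2 y) by rewrite val_t2 -def_u permKV.
  rewrite tau_r; last by rewrite val_t2 -def_u permKV.
  rewrite -permJ inv2 (val_invg val_t2) -tau_r -?def_u //.
  by rewrite val_t2 -def_u permKV permM permKV.
have tauV : s2 * s3 = s3^-1 * s2^-1.
  by rewrite -invMg; apply/eqP; rewrite eq_sym eq_invg_mul -expg2 (rot23_sq1 polyP chiralP fF).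
move: tau_s2; rewrite tauV permM => /perm_inj s3v.
by rewrite expg2 permM -s3v permKV.
Qed.

Lemma rot3_square_core : s3 ^+ 2 \in gcore (stab 2) G.
Proof.
have Gs3 := rot_autg polyP chiralP fF (isT : 0 < 3 < 4).
apply/bigcapP => h Gh; rewrite mem_conjg (mem_face_stab polyP fF _ Fz rz).
  by rewrite -{1}[z](permK h) permJ square_fixes_vertices ?permK ?(aut_rk polyP).
by rewrite groupJ ?groupX ?groupV.
Qed.

End RegularFacet.

(** * Vertex-figures *)

Section VertexFigure.

Variables (T : finType) (le : rel T) (F : {set T}).
Hypotheses (polyP : polytope le 4) (chiralP : chiral le) (fF : flag le F).
Local Notation G := (autg le).
Local Notation stab := (face_stab le F).
Local Notation s1 := (rot le F 1).
Local Notation s2 := (rot le F 2).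
Local Notation s3 := (rot le F 3).
Variable v : T.
Hypotheses (Fv : v \in F) (rv : rk le v = 2).
Let po := polytope_poset polyP.
Let fs := polytope_card_flag polyP.
Local Notation S := {x : T | le v x}.
Local Notation leV := (@vfig_le T le v).
Local Notation FV := (sect (le v) F).

Let top_exists : exists2 c, c \in F & rk le c = 6.
Proof. exact: (flag_face po fs fF). Qed.
Let le_v c : rk le c = 6 -> forall x, le v x = le v x && le x c.
Proof. by move=> rc x; rewrite (greatest_face polyP x rc) andbT. Qed.
Let rk_v c : rk le c = 6 -> rk le c = rk le v + 4. Proof. by rewrite rv => ->. Qed.

Lemma vfig_polytope : polytope leV 3.
Proof.
have [c _ rc] := top_exists.
exact: (sub_polytope polyP (le_v rc) (greatest_face polyP v rc) (rk_v rc)).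
Qed.

Lemma vfig_flag : flag leV FV.
Proof.
have [c Fc rc] := top_exists.
exact: (flag_sect polyP (le_v rc) (greatest_face polyP v rc) (rk_v rc)).
Qed.

Lemma vfig_rot i : 0 < i < 3 -> rot leV FV i \in autg leV /\
  forall x, val (rot leV FV i x) = rot le F i.+1 (val x).
Proof.
move=> ir; have [c Fc rc] := top_exists.
have [] := sub_rot polyP (le_v rc) (greatest_face polyP v rc) (rk_v rc) chiralP fF Fv Fc ir.
by rewrite /lift_letter rv addn1.
Qed.

Lemma vfig_faithful g : g \in stab 2 -> (forall x : S, g (val x) = val x) -> g = 1.
Proof.
move=> g2 fix_g; have Gg := subsetP (face_stab_sub _ _ _) _ g2.
apply: (stab_all_but_one polyP chiralP fF (isT : letter 4 2) Gg) => i /andP[i1 _] _.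
apply/face_stabP; split=> // x Fx rx.
have vx : le v x by rewrite (flag_le po fs fF) // rv rx.
exact: (fix_g (Sub x vx)).
Qed.

Let restricts (g : {perm T}) (g' : {perm S}) : Prop := forall x, val (g' x) = g (val x).

Let restricts_unique g u w : restricts g u -> restricts g w -> u = w.
Proof. by move=> gu gw; apply/permP => x; apply: val_inj; rewrite gu gw. Qed.

Lemma vfig_morphism : exists f : {morphism stab 2 >-> {perm S}},
  forall g, g \in stab 2 -> f g \in autg leV /\ forall x, val (f g x) = g (val x).
Proof.
apply: (functional_morphism (R := fun g g' => g' \in autg leV /\ restricts g g')).
- move=> g g2; have [c Fc rc] := top_exists; have /face_stabP[Gg fix_v] := g2.
  have gc : g c = c by apply: (aut_fix_improper polyP Gg fF Fc); rewrite rc.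
  by have [g' Gg' [val_g _]] := sub_aut (le_v rc) Gg (fix_v v Fv rv) gc; exists g'.
- by move=> g u w _ [_ gu] [_ gw]; apply: restricts_unique gu gw.
move=> g h u w _ _ [Gu gu] [Gw gw].
by split=> [|x]; [apply: groupM | rewrite !permM gw gu].
Qed.

Section RestrictionMorphism.

Variable f : {morphism stab 2 >-> {perm S}}.
Hypothesis fP : forall g, g \in stab 2 -> f g \in autg leV /\ forall x, val (f g x) = g (val x).

Lemma injm_vfig : 'injm f.
Proof.
apply/subsetP => g /morphpreP[g2 /set1P fg1]; have [_ val_g] := fP g2.
by apply/set1gP/vfig_faithful => // x; rewrite -val_g fg1 perm1.
Qed.

Lemma vfig_morphism_rot i : 0 < i < 3 -> f (rot le F i.+1) = rot leV FV i.
Proof.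
move=> ir; have [_ val_rot] := vfig_rot ir.
have stab_rot : rot le F i.+1 \in stab 2.
  by apply: (rot_stab polyP chiralP fF); move: ir; rewrite ?inE; clear; lia.
by have [_ val_f] := fP stab_rot; apply: restricts_unique val_f val_rot.
Qed.

End RestrictionMorphism.

Hypothesis card_G : #|G| = (#[s1] * (#[s2] * #[s3]))%N.
Hypothesis chiralV : chiral leV.

Let s2_stab : s2 \in stab 2.
Proof. exact: (rot_stab polyP chiralP fF). Qed.
Let s3_stab : s3 \in stab 2.
Proof. exact: (rot_stab polyP chiralP fF). Qed.

Lemma vfig_tight : tight leV 3 [:: #[s2]; #[s3]].
Proof.
have [f fP] := vfig_morphism; have [polyV fV] := (vfig_polytope, vfig_flag).
have [f2 f3] := (vfig_morphism_rot fP (isT : 0 < 1 < 3), vfig_morphism_rot fP (isT : 0 < 2 < 3)).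
have def_orders : [:: #[s2]; #[s3]] = rot_orders leV 3 FV.
  by rewrite /rot_orders /mkseq /= -f2 -f3 !(order_injm (injm_vfig fP)).
rewrite def_orders; apply: (card_aut_tight polyV chiralV fV) => //.
rewrite -def_orders !big_cons big_nil muln1 -(card_stab2 polyP chiralP fF card_G).
rewrite -(card_injm (injm_vfig fP) (subxx _)) (_ : f @* stab 2 = autg leV) //.
apply/eqP; rewrite eqEsubset; apply/andP; split.
  by apply/subsetP => _ /morphimP[g g2 _ ->]; case: (fP g g2).
by apply: (autg3_sub polyV chiralV fV); rewrite -?f2 -?f3 mem_morphim.
Qed.

Section Covering.

Variables (W : finType) (leW : rel W) (eta : S -> W).
Hypotheses (polyW : polytope leW 3) (chiralW : chiral leW) (cov : covering leV leW eta).
Local Notation t1 := (rot leW (eta @: FV) 1).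
Local Notation t2 := (rot leW (eta @: FV) 2).
Local Notation Ch := (chirality_group s2 s3).

Lemma vfig_covering_flag : flag leW (eta @: FV).
Proof. by case: (covering_flag_map vfig_polytope polyW cov) => _ + _; apply; apply: vfig_flag. Qed.

Lemma vfig_covering_morphism : exists f : {morphism stab 2 >-> {perm W}}, f s2 = t1 /\ f s3 = t2.
Proof.
have [f fP] := vfig_morphism.
have [f2 f3] := (vfig_morphism_rot fP (isT : 0 < 1 < 3), vfig_morphism_rot fP (isT : 0 < 2 < 3)).
have [h h_word] := covering_morphism vfig_polytope chiralV polyW chiralW cov vfig_flag.
have fM : {in stab 2 &, {morph (fun g => h (f g)) : x y / x * y}}.
  by move=> x y x2 y2; rewrite !morphM //; [case: (fP x x2) | case: (fP y y2)].
exists (Morphism fM); rewrite /= f2 f3.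
by rewrite /rot !h_word.
Qed.

Hypothesis kernel2 : forall N : {group {perm T}},
  N \subset <[s2]> -> N <| stab 2 -> N :!=: 1 -> Ch \subset N.
Hypothesis kernel3 : forall N : {group {perm T}},
  N \subset <[s3]> -> N <| stab 2 -> N :!=: 1 -> s3 \notin N -> Ch \subset N.

Lemma vfig_covering_orders : (#[t1] == #[s2]) = (#[t2] == #[s3]).
Proof.
have [f [f2 f3]] := vfig_covering_morphism.
have defV := stab2E polyP chiralP fF card_G.
have fW := vfig_covering_flag.
have ti_f : <[f s2]> :&: <[f s3]> = 1 by rewrite f2 f3 (cycle_rot_TI polyW chiralW fW).
have ker_sub : 'ker f \subset <[s2]> \/ 'ker f \subset <[s3]> -> ~ Ch \subset 'ker f.
  move=> /orP sK sCh; have := chirality_group_neq1 polyW chiralW fW.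
  by rewrite -f2 -f3 (chirality_group_morph1 s2_stab s3_stab) ?eqxx.
have order_inj s : s \in stab 2 -> 'ker f :==: 1 -> #[f s] = #[s].
  by move=> ss /eqP kf; apply: order_injm => //; apply/trivgP.
have ker_neq1 s : s \in stab 2 -> #[f s] != #[s] -> 'ker f :!=: 1.
  by move=> ss; apply: contra => /(order_inj s ss)->.
rewrite -f2 -f3; apply/idP/idP => /eqP eq_o; apply: contraT => neq_o.
  have sK := ker_sub_cycler s2_stab s3_stab defV ti_f eq_o.
  case: ker_sub; first by right.
  apply: kernel3 => //; first exact: ker_normal.
    exact: ker_neq1 neq_o.
  apply: contra (rot_neq1 polyW chiralW fW (isT : 0 < 2 < 3)) => /mker.
  by rewrite f3 => ->.
have sK := ker_sub_cyclel s2_stab s3_stab defV ti_f eq_o.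
case: ker_sub; first by left.
by apply: kernel2; rewrite ?ker_normal ?(ker_neq1 s2).
Qed.

End Covering.

Lemma vfig_atomic :
  (forall N : {group {perm T}}, N \subset <[s2]> -> N <| stab 2 -> N :!=: 1 ->
    chirality_group s2 s3 \subset N) ->
  (forall N : {group {perm T}}, N \subset <[s3]> -> N <| stab 2 -> N :!=: 1 -> s3 \notin N ->
    chirality_group s2 s3 \subset N) ->
  atomic_chiral_polyhedron leV.
Proof.
move=> kernel2 kernel3; exists #[s2], #[s3].
split=> //; [exact: vfig_polytope | exact: vfig_tight |].
move=> W leW p q polyW chiralW typ [eta cov].
have typW := chiral_type_unique polyW chiralW (vfig_covering_flag polyW cov).
have := vfig_covering_orders polyW chiralW cov kernel2 kernel3.
by case: typ => -[/typW[-> ->] [_ /negbTE->]]; rewrite eqxx.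
Qed.

End VertexFigure.

Section AtomicKernels.

Variables (T : finType) (le : rel T) (F : {set T}) (ps : seq nat).
Hypotheses (polyP : polytope le 4) (chiralP : chiral le) (fF : flag le F) (tightP : tight le 4 ps).
Hypothesis atomic : forall (T' : finType) (le' : rel T') (m : nat) (qs : seq nat),
  polytope le' m -> chiral le' -> tight le' m qs -> ~ properly_covers le le'.
Local Notation G := (autg le).
Local Notation stab := (face_stab le F).
Local Notation s1 := (rot le F 1).
Local Notation s2 := (rot le F 2).
Local Notation s3 := (rot le F 3).
Local Notation Ch := (chirality_group s2 s3).
Implicit Types (K N : {group {perm T}}) (i : nat).
Let card_G := card_tight4 polyP chiralP fF tightP.

Let rot_notin i (X : {set {perm T}}) : 0 < i < 4 -> <[rot le F i]> :&: X = 1 -> rot le F i \notin X.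
Proof.
move=> ir tiX; apply: contra (rot_neq1 polyP chiralP fF ir) => Xi.
by apply/eqP/set1gP; rewrite -tiX inE cycle_id.
Qed.

Lemma atomic_kernel_rot2 N : s3 ^+ 2 \in gcore (stab 2) G ->
  N \subset <[s2]> -> N <| stab 2 -> N :!=: 1 -> Ch \subset N.
Proof.
move=> core3; have tiA := cycle1_stab2_TI polyP chiralP fF.
apply: (@chirality_sub_kernel _ s1 s2 s3 (autg_group le) (stab 5) (stab 2)) => //.
- exact: (rot12_sq1 polyP chiralP fF).
- exact: (rot23_sq1 polyP chiralP fF).
- exact: (rot123_sq1 polyP chiralP fF).
- exact: (stab5E polyP chiralP fF card_G).
- exact: (stab2E polyP chiralP fF card_G).
- exact: (autgE polyP chiralP fF card_G).
- exact: (stabI_cycle polyP chiralP fF (i := 2)).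
- exact: (cycle_rot_TI polyP chiralP fF).
move=> K nsK ntK sK5 facK Ks1 Ks2.
have tiK : <[s3]> :&: stab 5 = 1 by rewrite setIC (stab5_cycle3_TI polyP chiralP fF).
apply: (atomic_kernel polyP chiralP fF tightP nsK) => //.
- apply/subsetP => a /setIP[Aa /mulsgP[k g Kk g2 def_a]].
  have /mulsgP[x y /setIP[Kx Ax] /setIP[_ By] def_k] := subsetP facK _ Kk.
  have y2 : y \in stab 2 by apply: subsetP By; rewrite (cycle_rot_stab polyP chiralP fF).
  suff -> : a = x by [].
  by apply: (TI_mulg_inj tiA Aa Ax (group1 _) (groupM y2 g2)); rewrite mulg1 mulgA -def_k.
- by rewrite mulSGid // tiK sub1G.
by apply: contra (rot_notin (isT : 0 < 3 < 4) tiK); apply: (subsetP sK5).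
Qed.

Lemma atomic_kernel_rot3 N : N \subset <[s3]> -> N <| stab 2 -> N :!=: 1 ->
  s3 \notin N -> Ch \subset N.
Proof.
move=> sN3 nsN ntN Ns3.
have tiK : <[s3]> :&: stab 5 = 1 by rewrite setIC (stab5_cycle3_TI polyP chiralP fF).
have n12 : s1 * s2 \in 'N(N).
  have /char_norms/subsetP : N \char <[s3]> by rewrite sub_cyclic_char ?cycle_cyclic.
  by apply; rewrite inE -cycleJ (rot3_conj_rot12 polyP chiralP fF) cycleV.
have n2 : s2 \in 'N(N) by rewrite (subsetP (normal_norm nsN)) ?(rot_stab polyP chiralP fF).
have n1 : s1 \in 'N(N) by rewrite -(groupMr _ n2).
have nsNG : N <| G.
  rewrite /normal (subset_trans (normal_sub nsN)) ?face_stab_sub //=.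
  by rewrite -(autgE polyP chiralP fF card_G) mul_subG ?cycle_subG // normal_norm.
have tiN i : 0 < i < 3 -> <[rot le F i]> :&: N = 1.
  move=> ir; apply/trivgP; rewrite -(@cycle_rot_TI _ _ _ polyP chiralP F fF i 3) ?setIS //.
    by move: ir; clear; lia.
  by move: ir; clear; lia.
apply: (atomic_kernel polyP chiralP fF tightP nsNG) => //.
- rewrite mulSGid ?(cycle1_stab2_TI polyP chiralP fF) ?sub1G //.
  exact: normal_sub.
- apply/subsetP => d /setIP[Dd /mulsgP[k g Nk g5 def_d]].
  suff -> : d = k by [].
  by apply: (TI_mulg_inj tiK Dd (subsetP sN3 _ Nk) (group1 _) g5); rewrite mulg1.
- by apply: rot_notin; rewrite ?tiN.
by apply: rot_notin; rewrite ?tiN.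
Qed.

End AtomicKernels.

Theorem theorem5p4 (T : finType) (le : rel T) :
  atomic_chiral4 le ->
  (forall F : T, rk le F = 5 -> regular (@facet_le T le F)) ->
  (forall v : T, rk le v = 2 -> chiral (@vfig_le T le v)) ->
  forall v : T, rk le v = 2 -> atomic_chiral_polyhedron (@vfig_le T le v).
Proof.
move=> [ps [polyP chiralP tightP atomic]] regular_facets chiral_vfigs v rv.
have [F fF Fv] := flag1 (polytope_poset polyP) v.
have card_G := card_tight4 polyP chiralP fF tightP.
have [x Fx rx] := letter_face polyP fF (isT : letter 4 5).
have core3 := rot3_square_core polyP chiralP fF card_G Fv rv Fx rx (regular_facets x rx).
apply: (vfig_atomic polyP chiralP fF Fv rv card_G (chiral_vfigs v rv)) => N.
  exact: (atomic_kernel_rot2 polyP chiralP fF tightP atomic core3).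
exact: (atomic_kernel_rot3 polyP chiralP fF tightP atomic).
Qed.
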